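(* Let $n\ge1$ be an integer, $k\ge\frac{n-1}{2n}$ with $2k+\frac2n-2>0$, and $T>0$. Let $u\in C^1([0,T],W^2_{k,n})$ be a solution of $$n|x|^{2-\frac2n}\Delta_k^x u(t,x)-\partial_t u(t,x)=0,\qquad (t,x)\in[0,T]\times\mathbb{R},$$ with initial datum $u_0=u(0,\cdot)\in L^2_{k,n}$, and assume moreover $u_0\in L^1_{k,n}$ and that there are constants $C,\delta>0$ with $$|u(T,x)|\le C\,e^{-n\delta|x|^{2/n}}\qquad\text{for all }x\in\mathbb{R}.$$ If $\delta\ge\frac1{4T}$, then $u=0$ (i.e. $u(t,\cdot)=0$ a.e. for all $t\in[0,T]$).
   Context: Notation: $\alpha=kn-\frac n2$; $j_\beta$ is the normalized Bessel function $j_\beta(z)=\Gamma(\beta+1)\sum_{m\ge0}\frac{(-1)^m}{m!\Gamma(\beta+m+1)}(z/2)^{2m}$; $d\mu_{k,n}(x)=\frac{1}{2\Gamma(kn-\frac n2+1)}(\frac n2)^{kn-\frac n2}|x|^{2k+\frac2n-2}dx$, $L^p_{k,n}=L^p(\mathbb{R},d\mu_{k,n})$. The $(k,\frac2n)$-generalized Fourier transform is $\mathcal{F}_{k,n}f(\lambda)=\int_{\mathbb{R}}f(x)B_{k,n}(x,\lambda)d\mu_{k,n}(x)$ with kernel $B_{k,n}(x,\lambda)=j_\alpha(n|\lambda x|^{1/n})+(-i)^n(\frac n2)^n\frac{\Gamma(\alpha+1)}{\Gamma(\alpha+n+1)}\lambda x\,j_{\alpha+n}(n|\lambda x|^{1/n})$,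 extended to a unitary operator on $L^2_{k,n}$. The one-dimensional Dunkl Laplacian is $\Delta_kf(x)=f''(x)+\frac{2k}{x}f'(x)-k\frac{f(x)-f(-x)}{x^2}$ ($x\neq0$). The Sobolev-type space $W^2_{k,n}$ is the set of $f\in L^2_{k,n}$ with $|x|^{2-\frac2n}\Delta_kf\in L^2_{k,n}$, where on $L^2_{k,n}$ this operator is characterized by $\mathcal{F}_{k,n}\big(|x|^{2-\frac2n}\Delta_k f\big)(\xi)=-|\xi|^{2/n}\mathcal{F}_{k,n}f(\xi)$. *)

(* Defs.v *)
From HB Require Import structures.
From mathcomp Require Import all_boot all_order all_algebra.
From mathcomp Require Import all_classical all_reals all_analysis.
From mathcomp Require Import complex.
Set Implicit Arguments. Unset Strict Implicit. Unset Printing Implicit Defensive.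
Import Order.TTheory GRing.Theory Num.Theory.
Import numFieldNormedType.Exports.
Local Open Scope classical_set_scope.
Local Open Scope ring_scope.
Local Open Scope complex_scope.

Section KNFourier.
Variable R : realType.
Local Notation leb := (@lebesgue_measure R).

Definition Gamma (s : R) : R :=
  Rintegral leb `]0, +oo[ (fun t => t `^ (s - 1) * expR (- t)).

Definition alpha (n : nat) (k : R) : R := k * n%:R - n%:R / 2.

Definition jbessel (b z : R) : R :=
  Gamma (b + 1) *
  limn (series (fun m : nat =>
     (-1) ^+ m / (m`!%:R * Gamma (b + m%:R + 1)) * (z / 2) ^+ (2 * m))).

Definition weight (n : nat) (k : R) (x : R) : R :=
  (2 * Gamma (alpha n k + 1))^-1 * (n%:R / 2) `^ (alpha n k)
  * `|x| `^ (2 * k + 2 / n%:R - 2).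

Definition Bkn (n : nat) (k : R) (x l : R) : R[i] :=
  let a := alpha n k in
  let z := n%:R * `|l * x| `^ (n%:R^-1) in
  (jbessel a z)%:C
  + (- 'i : R[i]) ^+ n
    * ((n%:R / 2) ^+ n * Gamma (a + 1) / Gamma (a + n%:R + 1)
       * l * x * jbessel (a + n%:R) z)%:C.

Definition cint_mu (n : nat) (k : R) (F : R -> R[i]) : R[i] :=
  (Rintegral leb setT (fun x => complex.Re (F x) * weight n k x))
  +i* (Rintegral leb setT (fun x => complex.Im (F x) * weight n k x)).

Definition Fkn (n : nat) (k : R) (f : R -> R[i]) (l : R) : R[i] :=
  cint_mu n k (fun x => f x * Bkn n k x l).

Definition cmeasurable (f : R -> R[i]) : Prop :=
  measurable_fun setT (fun x => complex.Re (f x)) /\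
  measurable_fun setT (fun x => complex.Im (f x)).

Definition Lpkn (n : nat) (k p : R) (f : R -> R[i]) : Prop :=
  cmeasurable f /\
  (\int[leb]_(x in setT) ((Normc.normc (f x)) `^ p * weight n k x)%:E < +oo)%E.

Definition dist2 (n : nat) (k : R) (f g : R -> R[i]) : \bar R :=
  (\int[leb]_(x in setT) ((Normc.normc (f x - g x)) ^+ 2 * weight n k x)%:E)%E.

(* h is the L^2 Fourier transform of f: the extension by continuity of Fkn
   from L^1 cap L^2 to L^2 *)
Definition FT_L2 (n : nat) (k : R) (f h : R -> R[i]) : Prop :=
  Lpkn n k 2 f /\ Lpkn n k 2 h /\
  exists fm : nat -> R -> R[i],
    (forall m, Lpkn n k 1 (fm m) /\ Lpkn n k 2 (fm m)) /\
    ((fun m => dist2 n k (fm m) f) @ \oo --> 0%E) /\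
    ((fun m => dist2 n k (Fkn n k (fm m)) h) @ \oo --> 0%E).

(* g = |x|^(2-2/n) Delta_k f on L^2_{k,n}, characterized by
   F(g)(xi) = - |xi|^(2/n) F(f)(xi) *)
Definition DkOp (n : nat) (k : R) (f g : R -> R[i]) : Prop :=
  Lpkn n k 2 f /\ Lpkn n k 2 g /\
  exists Ff Fg : R -> R[i],
    FT_L2 n k f Ff /\ FT_L2 n k g Fg /\
    {ae leb, forall xi, Fg xi = - (`|xi| `^ (2 / n%:R))%:C * Ff xi}.

Definition W2kn (n : nat) (k : R) (f : R -> R[i]) : Prop :=
  exists g, DkOp n k f g.

Definition dquot (v : R -> R -> R[i]) (t s : R) : R -> R[i] :=
  fun x => (v s x - v t x) / (s - t)%:C.

(* u in C^1([0,T], W^2_{k,n}) with derivative du, and Au t = |x|^(2-2/n) Delta_k (u t).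
   The W^2 norm is ||f||_2 + || |x|^(2-2/n) Delta_k f ||_2, so convergence in W^2
   means L^2 convergence of the functions and of their images under the operator. *)
Definition C1_W2 (n : nat) (k T : R) (u du Au : R -> R -> R[i]) : Prop :=
  exists Adu : R -> R -> R[i],
  (forall t, 0 <= t <= T -> DkOp n k (u t) (Au t) /\ DkOp n k (du t) (Adu t)) /\
  (forall t, 0 <= t <= T -> forall e : R, 0 < e -> exists2 d : R, 0 < d &
     forall s, 0 <= s <= T -> s != t -> `|s - t| < d ->
       (dist2 n k (dquot u t s) (du t) < e%:E)%E /\
       (dist2 n k (dquot Au t s) (Adu t) < e%:E)%E /\
       (dist2 n k (du s) (du t) < e%:E)%E /\
       (dist2 n k (Adu s) (Adu t) < e%:E)%E).

Definition heat_solution (n : nat) (k T : R) (u : R -> R -> R[i]) : Prop :=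
  exists du Au : R -> R -> R[i],
    C1_W2 n k T u du Au /\
    (forall t, 0 <= t <= T ->
       {ae leb, forall x, n%:R%:C * Au t x - du t x = 0}).

End KNFourier.

(* Main.v *)
Require Import Defs.
From HB Require Import structures.
From mathcomp Require Import all_boot all_order all_algebra.
From mathcomp Require Import all_classical all_reals all_analysis.
From mathcomp Require Import complex.
From mathcomp Require Import measurable_realfun.
From mathcomp Require Import ring lra.
Import Order.TTheory GRing.Theory Num.Theory.
Import numFieldNormedType.Exports.
Local Open Scope classical_set_scope.
Local Open Scope ring_scope.

(** The proof uses real variables only. Write Y = |x|^(2/n), nu = alpha + e n
    with e = 0, 1 the parity, phi_s = x^e e^(-n s Y), and let Psi_s be the
    transform of phi_s, which is (2s)^(-(nu+1)) phi_(1/(4s)) up to a unimodular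
    constant. By duality the pairing of u(t) with Psi_(q-t) does not depend on
    t. For t = 0 and t = T, with q = T/(1-tau), this relates Laplace transforms
    in Z = n Y/(4T) of g0 = u(0) x^e and of g1 = u(T) e^Z x^e, and the Gaussian
    bound with delta >= 1/(4T) says that g1 is bounded by |x|^e, hence
    integrable against a power of 1 + Z. The relation then forces the Laplace
    transform of g0 to be a polynomial that tends to 0 at infinity, so it
    vanishes; transporting back to time t, all Gaussian pairings of u(t)
    vanish, and injectivity of the Laplace transform on the shells of Y gives
    u(t) = 0 almost everywhere. *)

(** At the critical rate a Hardy-type theorem is usually proved by Phragmen-Lindelof for an entire
    function. Here the same rigidity comes from supports on the real line. Multiply the relation by
    tau^(-N) and read both sides as two-sided Laplace transforms in a new variable r. The side of g0
    is the transform of the integral of (r + Z)_+^(N-1) e^(-Z) g0; the side of g1, through its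
    factor e^(-Z/tau), is the transform of an integral of Bessel functions carried by r >= 0. Equal
    transforms give equal functions, so the first integral vanishes for almost every r < 0.
    Integrated against e^(p r) over that half-line, for any p > -1, it becomes a Taylor remainder of
    e^(-p Z), whence a polynomial of degree below N in p. Multiplying by tau^(-N) is what makes the
    g1 side absolutely convergent: it raises the Bessel order by N, and N = 2m yields decay (1 +
    Z)^(-m). The unit (-i)^n in the kernel acts on real and imaginary parts as a rotation, which can
    be undone; this is why real pairings suffice. *)

Section Toolkit.
Context {R : realType}.
Local Notation mu := (@lebesgue_measure R).
Implicit Types f g h : R -> R.

(** * Integration of real functions over the line *)

Definition itb f : Prop := mu.-integrable setT (EFin \o f).
Definition itg f : R := Rintegral mu setT f.

Lemma itb_meas {f} : itb f -> measurable_fun setT f.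
Proof. by move=> /integrableP[/measurable_EFinP]. Qed.

Lemma itb_le {f} g : measurable_fun setT f -> itb g ->
  (forall x, `|f x| <= g x) -> itb f.
Proof.
move=> mf ig fg; apply: (le_integrable measurableT _ _ ig).
  exact/measurable_EFinP.
by move=> x _ /=; rewrite lee_fin (le_trans (fg x))// ler_norm.
Qed.

Lemma itbD {f g} : itb f -> itb g -> itb (fun x => f x + g x).
Proof. exact: integrableD. Qed.

Lemma itbZ c {f} : itb f -> itb (fun x => c * f x).
Proof. by move=> h; have := integrableZl measurableT c h. Qed.

Lemma itbN {f} : itb f -> itb (fun x => - f x).
Proof. by move=> /(itbZ (-1)); congr itb; apply/funext => x; rewrite mulN1r. Qed.

Lemma itbB {f g} : itb f -> itb g -> itb (fun x => f x - g x).
Proof. by move=> hf hg; apply: itbD => //; apply: itbN. Qed.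

Lemma itb0 : itb (fun=> 0).
Proof. exact: integrable0. Qed.

Lemma itb_norm {f} : itb f -> itb (fun x => `|f x|).
Proof.
move=> hf; apply/integrableP; split.
  by apply/measurable_EFinP/measurableT_comp => //; exact: itb_meas.
move/integrableP : hf => [_]; apply: le_lt_trans.
by under eq_integral => x _ do rewrite /= normr_id.
Qed.

Lemma itb_ge0P f : measurable_fun setT f -> (forall x, 0 <= f x) ->
  (\int[mu]_x (f x)%:E < +oo)%E -> itb f.
Proof.
move=> mf f0 h; apply/integrableP; split; first exact/measurable_EFinP.
by under eq_integral => x _ do rewrite /= ger0_norm//.
Qed.

Lemma itgE {f} : itb f -> (\int[mu]_x (f x)%:E = (itg f)%:E)%E.
Proof. by move=> h; rewrite /itg /Rintegral fineK// integrable_fin_num. Qed.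

Lemma itgD {f g} : itb f -> itb g -> itg (fun x => f x + g x) = itg f + itg g.
Proof. exact: RintegralD. Qed.

Lemma itgB {f g} : itb f -> itb g -> itg (fun x => f x - g x) = itg f - itg g.
Proof. exact: RintegralB. Qed.

Lemma itgZ c {f} : itb f -> itg (fun x => c * f x) = c * itg f.
Proof. exact: RintegralZl. Qed.

Lemma itgN {f} : itb f -> itg (fun x => - f x) = - itg f.
Proof.
move=> h; rewrite -mulN1r -itgZ//; congr itg; apply/funext => x.
by rewrite mulN1r.
Qed.

Lemma itg0 : itg (fun=> 0) = 0.
Proof. by rewrite /itg /Rintegral integral0. Qed.

Lemma itg_ge0 {f} : (forall x, 0 <= f x) -> 0 <= itg f.
Proof. by move=> f0; apply: Rintegral_ge0. Qed.

Lemma itg_le {f g} : itb f -> itb g -> (forall x, f x <= g x) -> itg f <= itg g.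
Proof. by move=> hf hg fg; apply: le_Rintegral. Qed.

Lemma itg_norm {f} : itb f -> `|itg f| <= itg (fun x => `|f x|).
Proof. exact: le_normr_Rintegral. Qed.

Lemma itg_norm_le {f g} : measurable_fun setT f -> itb g ->
  (forall x, `|f x| <= g x) -> `|itg f| <= itg g.
Proof.
move=> mf ig fg; have hf := itb_le g mf ig fg.
by apply: (le_trans (itg_norm hf)); apply: itg_le => //; exact: itb_norm.
Qed.

Lemma itb_sum {n} {f : nat -> R -> R} : (forall i, itb (f i)) ->
  itb (fun x => \sum_(i < n) f i x).
Proof.
move=> h; elim: n => [|n ih].
  by have := itb0; congr itb; apply/funext => x; rewrite big_ord0.
have := itbD ih (h n); congr itb; apply/funext => x.
by rewrite big_ord_recr.
Qed.

Lemma itg_sum {n} {f : nat -> R -> R} : (forall i, itb (f i)) ->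
  itg (fun x => \sum_(i < n) f i x) = \sum_(i < n) itg (f i).
Proof.
move=> h; elim: n => [|n ih].
  by rewrite big_ord0 -[RHS]itg0; congr itg; apply/funext => x; rewrite big_ord0.
rewrite big_ord_recr/= -ih -itgD//; last exact: itb_sum.
by congr itg; apply/funext => x; rewrite big_ord_recr.
Qed.

Lemma aeS (P Q : R -> Prop) : (forall x, P x -> Q x) ->
  {ae mu, forall x, P x} -> {ae mu, forall x, Q x}.
Proof.
by move=> PQ; apply: filterS; first exact: (ae_filter_ringOfSetsType mu).
Qed.

Lemma aeS2 (P Q S : R -> Prop) : (forall x, P x -> Q x -> S x) ->
  {ae mu, forall x, P x} -> {ae mu, forall x, Q x} -> {ae mu, forall x, S x}.
Proof.
by move=> PQ; apply: filterS2; first exact: (ae_filter_ringOfSetsType mu).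
Qed.

Lemma ae_itg f g : measurable_fun setT f -> measurable_fun setT g ->
  {ae mu, forall x, f x = g x} -> itg f = itg g.
Proof.
move=> mf mg fg; rewrite /itg /Rintegral; congr fine.
apply: ae_eq_integral => //; [exact/measurable_EFinP..|].
by apply: aeS fg => x /= -> _.
Qed.

Lemma itg_dct (F : nat -> R -> R) f g : (forall n, measurable_fun setT (F n)) ->
  measurable_fun setT f -> itb g ->
  {ae mu, forall x, F n x @[n --> \oo] --> f x} ->
  (forall n x, `|F n x| <= g x) ->
  itb f /\ (itg (F n) @[n --> \oo] --> itg f).
Proof.
move=> mF mf ig Ff Fg.
have [] := @dominated_convergence _ _ _ mu setT measurableT
   (fun n x => (F n x)%:E) (EFin \o f) (EFin \o g).
- by move=> n; apply/measurable_EFinP; exact: mF.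
- exact/measurable_EFinP.
- apply: aeS Ff => x h _; apply/fine_cvgP; split; [exact: nearW|exact: h].
- exact: ig.
- by apply: aeW => x n _ /=; rewrite lee_fin.
- move=> h1 _ h2; split=> //.
  apply/fine_cvg; rewrite /Rintegral fineK//.
  exact: integrable_fin_num.
Qed.

(** A majorant in product form yields joint integrability by Tonelli. Every later exchange of
    integrals is thereby reduced to one pointwise bound, and the majorants below are shaped as
    products for this purpose. *)
Let prod_dominated (F : R * R -> R) a b : measurable_fun setT F ->
  itb a -> itb b -> (forall x y, `|F (x, y)| <= a x * b y) ->
  [/\ forall x, itb (fun y => F (x, y)), forall y, itb (fun x => F (x, y)) &
     (mu \x mu)%E.-integrable setT (EFin \o F)].
Proof.
move=> mF ia ib Fab.
have mEF : measurable_fun setT (EFin \o F) by exact/measurable_EFinP.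
have iFx x : itb (fun y => F (x, y)).
  apply: (itb_le (fun y => a x * b y)); [|exact: itbZ|exact: Fab].
  by apply: (measurableT_comp mF); exact: pair1_measurable.
have iFy y : itb (fun x => F (x, y)).
  apply: (itb_le (fun x => b y * a x)); [|exact: itbZ|].
    by apply: (measurableT_comp mF); exact: pair2_measurable.
  by move=> x; rewrite mulrC.
split=> //.
apply: (proj2 (integrable12ltyP mu mu mEF)).
apply: (@le_lt_trans _ _ (\int[mu]_x ((itg (fun y => `|b y|)) * `|a x|)%:E)%E).
  apply: ge0_le_integral => //=.
  - by move=> x _; apply: integral_ge0.
  - apply: (@measurable_fun_fubini_tonelli_F _ _ _ _ _ mu (abse \o (EFin \o F))) => //=.
    exact: measurableT_comp.
  - apply/measurable_EFinP/measurable_funM => //.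
    by apply: measurableT_comp => //; exact: itb_meas.
  - move=> x _.
    rewrite (itgE (itb_norm (iFx x))) lee_fin mulrC.
    rewrite -itgZ; last exact: itb_norm.
    apply: itg_le; [exact: itb_norm|by apply: itbZ; exact: itb_norm|].
    move=> y; apply: (le_trans (Fab x y)).
    by rewrite -normrM ler_norm.
have := itbZ (itg (fun y => `|b y|)) (itb_norm ia).
by move=> h; rewrite (itgE h); exact: ltry.
Qed.

Lemma itb_fubini (F : R * R -> R) a b : measurable_fun setT F ->
  itb a -> itb b -> (forall x y, `|F (x, y)| <= a x * b y) ->
  itb (fun x => itg (fun y => F (x, y))).
Proof.
move=> mF ia ib Fab.
have [iFx _ iF] := prod_dominated _ _ _ mF ia ib Fab.
have := integrable_fubini_F iF; rewrite /fubini_F /itb.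
congr (mu.-integrable _ _); apply/funext => x /=.
by rewrite (itgE (iFx x)).
Qed.

Lemma itg_fubini (F : R * R -> R) a b : measurable_fun setT F ->
  itb a -> itb b -> (forall x y, `|F (x, y)| <= a x * b y) ->
  itg (fun x => itg (fun y => F (x, y))) =
  itg (fun y => itg (fun x => F (x, y))).
Proof.
move=> mF ia ib Fab.
have [iFx iFy iF] := prod_dominated _ _ _ mF ia ib Fab.
have E1 : itg (fun x => itg (fun y => F (x, y))) =
    fine (\int[mu]_x \int[mu]_y (F (x, y))%:E)%E.
  by apply: (congr1 fine); apply: eq_integral => x _; exact: esym (itgE (iFx x)).
have E2 : itg (fun y => itg (fun x => F (x, y))) =
    fine (\int[mu]_y \int[mu]_x (F (x, y))%:E)%E.
  by apply: (congr1 fine); apply: eq_integral => x _; exact: esym (itgE (iFy x)).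
by rewrite E1 E2; congr fine; exact: (Fubini iF).
Qed.

End Toolkit.

(** * Measurability of composite real expressions *)

Section Measurability.
Context d (T : measurableType d) (R : realType).
Implicit Types f g : T -> R.

Lemma mf_expR f : measurable_fun setT f -> measurable_fun setT (fun x => expR (f x)).
Proof. by move=> h; apply: (measurableT_comp (@measurable_expR R)). Qed.

Lemma mf_powR p f : measurable_fun setT f -> measurable_fun setT (fun x => f x `^ p).
Proof. by move=> h; apply: (measurableT_comp (measurable_powR p)). Qed.

Lemma mf_norm f : measurable_fun setT f -> measurable_fun setT (fun x => `|f x|).
Proof. by move=> h; apply: measurableT_comp. Qed.

Lemma mf_opp f : measurable_fun setT f -> measurable_fun setT (fun x => - f x).
Proof. exact: measurable_funN. Qed.

Lemma mf_cos f : measurable_fun setT f -> measurable_fun setT (fun x => cos (f x)).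
Proof.
move=> h; apply: (@measurableT_comp _ _ _ _ _ _ (@cos R)) => //.
by apply: continuous_measurable_fun; exact: continuous_cos.
Qed.

Lemma mf_sin f : measurable_fun setT f -> measurable_fun setT (fun x => sin (f x)).
Proof.
move=> h; apply: (@measurableT_comp _ _ _ _ _ _ (@sin R)) => //.
by apply: continuous_measurable_fun; exact: continuous_sin.
Qed.

Lemma mf_inv f : measurable_fun setT f -> (forall x, 0 < f x) ->
  measurable_fun setT (fun x => (f x)^-1).
Proof.
move=> h f0; have := mf_powR (-1) _ h; congr (measurable_fun _ _).
by apply/funext => x; rewrite powR_inv1// ltW.
Qed.

Lemma mf_if f (b : T -> bool) g : measurable_fun setT b ->
  measurable_fun setT f -> measurable_fun setT g ->
  measurable_fun setT (fun x => if b x then f x else g x).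
Proof.
move=> mb mf mg; apply: measurable_fun_ifT => //.
Qed.

Lemma mf_max0 f : measurable_fun setT f -> measurable_fun setT (fun x => Num.max (f x) 0).
Proof. by move=> h; apply: measurable_maxr. Qed.

End Measurability.

Ltac meas := repeat first
  [ assumption | exact: measurable_fst | exact: measurable_snd
  | exact: measurable_id | exact: measurable_cst
  | apply: mf_expR | apply: mf_powR | apply: mf_norm | apply: mf_cos
  | apply: mf_sin | apply: mf_max0
  | apply: measurable_funM | apply: measurable_funX
  | apply: measurable_funB | apply: measurable_funD | apply: mf_opp
  | match goal with H : measurable_fun setT ?f |- measurable_fun setT (fun x => ?f _) =>
      apply: (measurableT_comp H) end ].

(** * Interval integrals and the fundamental theorem of calculus *)

Section IntervalTools.
Context {R : realType}.
Local Notation mu := (@lebesgue_measure R).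
Implicit Types (f g h F : R -> R) (a b : R).

(** A boolean form of restriction: interval integrals become integrals over the line, and pointwise
    estimates a case analysis on membership. *)
Definition cutoff (I : interval R) f : R -> R :=
  fun x => if x \in I then f x else 0.

Lemma cutoffE (I : interval R) f : cutoff I f = f \_ [set` I].
Proof.
apply/funext => x; rewrite /cutoff patchE.
by congr (if _ then _ else _); apply/idP/idP => [?|/set_mem//]; exact/mem_set.
Qed.

Lemma mf_cutoff (I : interval R) f : measurable_fun setT f ->
  measurable_fun setT (cutoff I f).
Proof.
move=> mf; rewrite cutoffE.
by apply/(measurable_restrictT f (measurable_itv I)); exact: measurable_funTS.
Qed.

Lemma itg_cutoff (I : interval R) f : itg (cutoff I f) = Rintegral mu [set` I] f.
Proof. by rewrite cutoffE Rintegral_mkcond. Qed.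

Lemma itb_cutoffE (I : interval R) f :
  itb (cutoff I f) <-> mu.-integrable [set` I] (EFin \o f).
Proof.
rewrite cutoffE /itb -restrict_EFin.
by apply: iff_sym; apply: integrable_mkcond.
Qed.

Lemma itb_cutoff (I : interval R) f : itb f -> itb (cutoff I f).
Proof.
move=> h; apply: (itb_le (fun x => `|f x|)); [|exact: itb_norm|].
  by apply: mf_cutoff; exact: itb_meas.
by move=> x; rewrite /cutoff; case: ifP => // _; rewrite normr0.
Qed.

Lemma FTCy a (l : R) f F : (forall x, 0 <= f x) -> continuous f ->
  (forall x : R, is_derive x 1 F (f x)) -> F x @[x --> +oo] --> l ->
  itb (cutoff `[a, +oo[ f) /\ itg (cutoff `[a, +oo[ f) = l - F a.
Proof.
move=> f0 cf dF Fl.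
have cF : continuous F.
  by move=> x; apply: differentiable_continuous; apply/derivable1_diffP; case: (dF x).
have E : (\int[mu]_(x in `[a, +oo[) (f x)%:E = l%:E - (F a)%:E)%E.
  apply: ge0_continuous_FTC2y => //.
  - exact: continuous_subspaceT.
  - by apply: cvg_at_right_filter; exact: cF.
  - by move=> x _; rewrite derive1E; case: (dF x).
split; last by rewrite itg_cutoff /Rintegral E.
apply/itb_cutoffE/integrableP; split.
  by apply/measurable_EFinP/measurable_funTS; exact: continuous_measurable_fun.
under eq_integral => x _ do rewrite /= ger0_norm//.
by rewrite E ltry.
Qed.

Lemma FTCc a b f F : a < b -> continuous f -> (forall x : R, is_derive x 1 F (f x)) ->
  itb (cutoff `[a, b] f) /\ itg (cutoff `[a, b] f) = F b - F a.
Proof.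
move=> ab cf dF.
have cF : continuous F.
  by move=> x; apply: differentiable_continuous; apply/derivable1_diffP; case: (dF x).
have E : (\int[mu]_(x in `[a, b]) (f x)%:E = (F b)%:E - (F a)%:E)%E.
  apply: continuous_FTC2 => //.
  - exact: continuous_subspaceT.
  - split => //; last 2 first.
    + by apply: cvg_at_right_filter; exact: cF.
    + by apply: cvg_at_left_filter; exact: cF.
  - by move=> x _; rewrite derive1E; case: (dF x).
split; last by rewrite itg_cutoff /Rintegral E.
apply/itb_cutoffE; apply: continuous_compact_integrable.
  exact: segment_compact.
exact: continuous_subspaceT.
Qed.

End IntervalTools.

(** * Exponential majorants *)

Section PowExp.
Context {R : realType}.

Lemma cvgr_eq {T : Type} {F : set_system T} {FF : ProperFilter F} {f : T -> R} {a b : R} :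
  f @ F --> a -> f @ F --> b -> a = b.
Proof. by move=> fa fb; apply: (cvg_unique (@Rhausdorff R) fa fb). Qed.

Lemma cvg0_le {T : Type} {F : set_system T} {FF : Filter F} {f g : T -> R} :
  (forall x, `|f x| <= g x) -> g @ F --> 0 -> f @ F --> 0.
Proof.
move=> fg g0; apply: norm_cvg0.
apply: (@squeeze_cvgr _ _ _ _ (fun=> 0) g) => //; last exact: cvg_cst.
by apply: nearW => y; rewrite normr_ge0/=.
Qed.

(** A single term of the exponential series lies below its sum. This is the device by which powers
    are absorbed into a slightly worse exponential rate. *)
Lemma pow_le_exp (c y : R) m : 0 < c -> 0 <= y ->
  y ^+ m <= m`!%:R / c ^+ m * expR (c * y).
Proof.
move=> c0 y0; have cy0 : 0 <= c * y by rewrite mulr_ge0// ltW.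
have f0 : 0 < m`!%:R :> R by rewrite ltr0n fact_gt0.
have cm0 : 0 < c ^+ m by rewrite exprn_gt0.
suff : (c * y) ^+ m <= m`!%:R * expR (c * y).
  by rewrite exprMn mulrAC ler_pdivlMr// mulrC.
case: m f0 {cm0} => [|m] f0.
  by rewrite expr0 fact0 mul1r -expR0 ler_expR.
have := expR_ge1Dxn m cy0; rewrite -(ler_pM2l f0) mulrDr mulrCA divff ?gt_eqF//.
by rewrite !mulr1; apply: le_trans; rewrite lerDr ltW.
Qed.

(** The bound is uniform in [N], as dominated convergence requires when a cosine or sine series is
    integrated term by term. *)
Lemma series_coeff_le (c : nat -> R) (x : R) N : (forall n, `|c n| <= n`!%:R^-1) ->
  `|series (fun n => c n * x ^+ n) N| <= expR `|x|.
Proof.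
move=> hc; rewrite /series/=.
apply: (le_trans (ler_norm_sum _ _ _)).
apply: (@le_trans _ _ (series (exp_coeff `|x|) N)).
  rewrite /series/= ler_sum// => i _.
  by rewrite normrM normrX /exp_coeff/= mulrC ler_wpM2l// exprn_ge0.
apply: nondecreasing_cvgn_le; last exact: is_cvg_series_exp_coeff.
apply: (@nondecreasing_series _ _ xpredT 0) => n _ _.
by rewrite /exp_coeff/= mulr_ge0// ?exprn_ge0// invr_ge0.
Qed.

End PowExp.

(** * Laplace transforms of the constant and of the cosine *)

Section ExpKernels.
Context {R : realType}.

Lemma expN_cvg0 (b K : R) (g : R -> R) : 0 < b -> (forall y, `|g y| <= K) ->
  expR (- (b * y)) * g y @[y --> +oo] --> 0.
Proof.
move=> b0 gK; apply: (cvg0_le (g := fun y => expR (- (b * y)) * K)).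
  move=> y; rewrite normrM ger0_norm ?expR_ge0//.
  by rewrite ler_wpM2l ?expR_ge0.
rewrite -(mul0r K); apply: cvgM; last exact: cvg_cst.
apply: (@cvg_comp _ _ _ (fun y => b * y) (fun y => expR (- y)) _ +oo); last exact: cvgr_expR.
by apply: gt0_cvgMry => //; exact: cvg_id.
Qed.

Lemma itb_expN (b : R) : 0 < b -> itb (cutoff `[0, +oo[ (fun y => expR (- (b * y)))).
Proof.
move=> b0.
have [||||h _] := FTCy 0 0 (fun y => expR (- (b * y))) (fun y => expR (- (b * y)) * (- b^-1)).
- by move=> y; exact: expR_ge0.
- move=> y; apply: continuous_comp; last exact: continuous_expR.
  by apply: continuousN; apply: continuousM; [exact: cst_continuous|].
- move=> y; apply: is_derive_eq.
  by rewrite !scaler0 !add0r /GRing.scale/=; field; rewrite gt_eqF.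
- exact: (expN_cvg0 _ `|- b^-1|).
- exact: h.
Qed.

Lemma poisson_kernel (b u : R) : 0 < b ->
  itg (cutoff `[0, +oo[ (fun y => expR (- (b * y)) * cos (y * u))) = b / (b ^+ 2 + u ^+ 2).
Proof.
move=> b0; have d0 : 0 < b ^+ 2 + u ^+ 2 by rewrite ltr_wpDr ?sqr_ge0// exprn_gt0.
have ce : continuous (fun y : R => expR (- (b * y))).
  move=> y; apply: continuous_comp; last exact: continuous_expR.
  by apply: continuousN; apply: continuousM; [exact: cst_continuous|].
have [|||i1 e1] := FTCy 0 0 (fun y => expR (- (b * y))) (fun y => expR (- (b * y)) * (- b^-1)) _ ce.
- by move=> y; exact: expR_ge0.
- move=> y; apply: is_derive_eq.
  by rewrite !scaler0 !add0r /GRing.scale/=; field; rewrite gt_eqF.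
- exact: (expN_cvg0 _ `|- b^-1|).
(* [FTCy] asks for a nonnegative integrand, so the cosine is raised by 1 and the pure exponential is
   subtracted at the end. *)
have [||||i2 e2] := FTCy 0 0 (fun y => expR (- (b * y)) * (1 + cos (y * u)))
  (fun y => expR (- (b * y)) * (- b^-1 +
    (u * sin (y * u) - b * cos (y * u)) / (b ^+ 2 + u ^+ 2))).
- by move=> y; rewrite mulr_ge0 ?expR_ge0// -lerBlDl sub0r cos_geN1.
- move=> y; apply: cvgM; first exact: ce.
  apply: cvgD; first exact: cvg_cst.
  apply: (@cvg_comp _ _ _ (fun z : R => z * u) cos _ (nbhs (y * u))); last exact: continuous_cos.
  by apply: cvgM; [exact: cvg_id|exact: cvg_cst].
- move=> y; apply: is_derive_eq.
  rewrite !(scaler0, addr0, add0r) /GRing.scale/=.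
  by field; rewrite !gt_eqF.
- apply: (expN_cvg0 _ (b^-1 + (`|u| + b) / (b ^+ 2 + u ^+ 2))) => // y.
  apply: (le_trans (ler_normD _ _)); apply: lerD.
    by rewrite normrN ger0_norm// invr_ge0 ltW.
  have iD : 0 <= (b ^+ 2 + u ^+ 2)^-1 by rewrite invr_ge0 ltW.
  rewrite normrM (ger0_norm iD) ler_wpM2r//.
  apply: (le_trans (ler_normB _ _)); rewrite !normrM (@gtr0_norm _ b)//.
  apply: lerD; rewrite -[leRHS]mulr1 ler_wpM2l ?(ltW b0)// ler_norml.
    by rewrite sin_geN1 sin_le1.
  by rewrite cos_geN1 cos_le1.
rewrite (_ : cutoff _ _ = (fun y => cutoff `[0, +oo[ (fun y => expR (- (b * y)) * (1 + cos (y * u))) y -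
    cutoff `[0, +oo[ (fun y => expR (- (b * y))) y)); last first.
  apply/funext => y; rewrite /cutoff; case: ifP => // _; last by rewrite subr0.
  by rewrite mulrDr mulr1 addrC addKr.
rewrite itgB// e1 e2 !mulr0 !mul0r oppr0 expR0 sin0 cos0.
by field; rewrite !gt_eqF.
Qed.

End ExpKernels.

(** * Injectivity of the Laplace transform in the variable [phi] *)

Section Uniqueness.
Context {R : realType}.
Local Notation mu := (@lebesgue_measure R).
Variables (phi G : R -> R) (rho : R).
Hypotheses (mphi : measurable_fun setT phi) (mG : measurable_fun setT G).
Hypothesis rho0 : 0 < rho.
Hypothesis iG : itb (fun x => expR (rho * `|phi x|) * `|G x|).
Hypothesis laplace0 : forall t, `|t| < rho -> itg (fun x => expR (t * phi x) * G x) = 0.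

(** The gap between [r] and [rho] absorbs the power of [phi], so multiples of the one integrable
    function in [iG] dominate all moments. *)
Let dominated r j : r < rho -> exists2 K, 0 <= K &
  forall x, `|phi x| ^+ j * expR (r * `|phi x|) * `|G x| <=
            K * (expR (rho * `|phi x|) * `|G x|).
Proof.
move=> r_rho; have c0 : 0 < rho - r by rewrite subr_gt0.
exists (j`!%:R / (rho - r) ^+ j).
  by rewrite divr_ge0// exprn_ge0// ltW.
move=> x; rewrite [leRHS]mulrA ler_wpM2r//.
have h := pow_le_exp (rho - r) `|phi x| j c0 (normr_ge0 _).
apply: (le_trans (ler_wpM2r (expR_ge0 (r * `|phi x|)) h)).
by rewrite -[leLHS]mulrA -expRD -mulrDl subrK.
Qed.

Let idom r j (P : R -> R) : measurable_fun setT P ->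
  r < rho -> (forall x, `|P x| <= expR (r * `|phi x|)) ->
  itb (fun x => phi x ^+ j * P x * G x).
Proof.
move=> mP r_rho hP; have [K K0 hK] := dominated r j r_rho.
apply: (itb_le (fun x => K * (expR (rho * `|phi x|) * `|G x|))); [meas| |].
  exact: itbZ.
move=> x; apply: le_trans (hK x).
by rewrite !normrM normrX ler_wpM2r// ler_wpM2l// exprn_ge0.
Qed.

(** An integral that vanishes on an open interval of [t] has derivative 0 there, and each
    differentiation under the integral sign brings down a factor [phi]. *)
Let moments_exp j : forall t, `|t| < rho ->
  itg (fun x => phi x ^+ j * expR (t * phi x) * G x) = 0.
Proof.
elim: j => [|j ih] t tr.
  rewrite -[RHS](laplace0 t)//; congr itg.
  by apply/funext => x; rewrite expr0 mul1r.
(* There must be room on both sides of [r]: differentiation needs an interval around [t], domination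
   needs a rate below [rho]. *)
have [r tr' rrho] : exists2 r, `|t| < r & r < rho.
  by exists ((`|t| + rho) / 2); lra.
have r0 : 0 < r by apply: le_lt_trans tr'.
have bnd s x : `|s| <= r -> `|expR (s * phi x)| <= expR (r * `|phi x|).
  move=> sr; rewrite ger0_norm ?expR_ge0// ler_expR.
  by rewrite (le_trans (ler_norm _))// normrM ler_wpM2r.
have me s : measurable_fun setT (fun x => expR (s * phi x)) by meas.
have [K K0 hK] := dominated r j.+1 rrho.
pose f s x := phi x ^+ j * expR (s * phi x) * G x.
have df (s x : R) : is_derive s 1 (f^~ x) (phi x ^+ j.+1 * expR (s * phi x) * G x).
  rewrite /f; apply: is_derive_eq.
  by rewrite !scaler0 !add0r /GRing.scale/= exprS; ring.
have d1E x y : partial1of2 f x y = phi y ^+ j.+1 * expR (x * phi y) * G y.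
  by rewrite partial1of2E; case: (df x y).
have It : `]- r, r[%classic t by rewrite /= in_itv/= -ltr_norml.
have := @cvg_differentiation_under_integral R _ _ mu f setT measurableT t (- r) r It
  _ _ (fun x => K * (expR (rho * `|phi x|) * `|G x|)) _ (itbZ K iG) _.
have E0 s : `|s| < r -> (\int[mu]_x f s x) = 0.
  by move=> sr; apply: ih; apply: lt_trans rrho.
move=> H.
have {H} : (h^-1 *: ((\int[mu]_y f (h + t) y) - (\int[mu]_y f t y)) : R)
     @[h --> 0^'] --> (\int[mu]_y partial1of2 f t y : R).
  apply: H.
  - move=> s; rewrite /= in_itv/= -ltr_norml => /ltW sr; apply: (idom r j) => //.
    by move=> x; apply: bnd.
  - by move=> x y _ _; case: (df x y).
  - by move=> x; rewrite !mulr_ge0// expR_ge0.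
  - move=> s x; rewrite /= in_itv/= -ltr_norml => /ltW sr _; rewrite d1E.
    apply: le_trans (hK x); rewrite !normrM normrX ler_wpM2r// ler_wpM2l ?exprn_ge0//.
    exact: bnd.
rewrite (_ : (\int[mu]_y partial1of2 f t y) =
  itg (fun x => phi x ^+ j.+1 * expR (t * phi x) * G x)); last first.
  by apply: eq_Rintegral => x _; rewrite d1E.
move=> H; apply: (cvgr_eq H).
apply: cvg_near_cst; near=> h; rewrite !E0 ?subrr ?scaler0//.
near: h.
have : \forall h \near (0:R), `|h| < r - `|t|.
  by apply: nbhs0_lt; rewrite subr_gt0.
move=> /nbhs_dnbhs; apply: filterS => h hr.
by rewrite (le_lt_trans (ler_normD _ _))// -ltrBrDr.
Unshelve. all: by end_near. Qed.

(** Term by term, the power series of [S] only produces moments of [P] against [G], all zero by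
    hypothesis. The condition on [h] keeps the partial sums below the integrable rate [rho]. *)
Let series_step (c : nat -> R) (S P : R -> R) (h : R) :
  (forall n, `|c n| <= n`!%:R^-1) ->
  (forall x, series (fun n => c n * x ^+ n) N @[N --> \oo] --> S x) ->
  measurable_fun setT S -> measurable_fun setT P ->
  (forall x, `|P x| <= 1) -> `|h| < rho ->
  (forall j, itg (fun x => phi x ^+ j * P x * G x) = 0) ->
  forall j, itb (fun x => phi x ^+ j * (S (h * phi x) * P x) * G x) /\
            itg (fun x => phi x ^+ j * (S (h * phi x) * P x) * G x) = 0.
Proof.
move=> hc cS mS mP P1 hr Z j.
pose F N x := phi x ^+ j * (series (fun n => c n * (h * phi x) ^+ n) N * P x) * G x.
have [K K0 hK] := dominated `|h| j hr.
have iP i : itb (fun x => phi x ^+ i * P x * G x).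
  apply: (idom 0) => // x.
  by rewrite mul0r expR0.
pose t i x := c i * h ^+ i * (phi x ^+ (j + i) * P x * G x).
have it i : itb (t i) by apply: itbZ.
have FE N : F N = fun x => \sum_(i < N) t i x.
  apply/funext => x; rewrite /F /series/= big_mkord mulr_suml mulr_sumr mulr_suml.
  by apply: eq_bigr => i _; rewrite /t exprMn exprD; ring.
have [] := itg_dct F (fun x => phi x ^+ j * (S (h * phi x) * P x) * G x)
  (fun x => K * (expR (rho * `|phi x|) * `|G x|)).
- by move=> N; rewrite FE; apply: itb_meas; exact: itb_sum.
- apply: measurable_funM => //; apply: measurable_funM; first by meas.
  by apply: measurable_funM => //; apply: (measurableT_comp mS); meas.
- exact: itbZ.
- apply: aeW => x; apply: cvgM; last exact: cvg_cst.
  apply: cvgM; first exact: cvg_cst.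
  by apply: cvgM; [exact: cS|exact: cvg_cst].
- move=> N x; apply: le_trans (hK x).
  rewrite !normrM normrX ler_wpM2r// ler_wpM2l ?exprn_ge0//.
  rewrite -[leRHS]mulr1 ler_pM// (le_trans (series_coeff_le _ _ _ hc))//.
  by rewrite normrM.
move=> iS; under eq_fun do rewrite FE itg_sum//.
move=> H; split=> //; apply: (cvgr_eq H).
apply: cvg_near_cst; near=> N; apply: big1 => i _.
by rewrite /t itgZ// Z mulr0.
Unshelve. all: by end_near. Qed.

(** A substitute for analytic continuation along the imaginary axis. Vanishing of all moments at
    frequency [z] passes to [z + h] for [|h| < rho] by the addition formulas and the Taylor series
    in [h]; finitely many steps of length [|y| / M] reach [y]. The next step expands around the new
    frequency, hence all [j] are carried along. *)
Let trig_moments y : forall j,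
  itg (fun x => phi x ^+ j * cos (y * phi x) * G x) = 0 /\
  itg (fun x => phi x ^+ j * sin (y * phi x) * G x) = 0.
Proof.
have step (z h : R) : `|h| < rho ->
  (forall j, itg (fun x => phi x ^+ j * cos (z * phi x) * G x) = 0 /\
             itg (fun x => phi x ^+ j * sin (z * phi x) * G x) = 0) ->
  (forall j, itg (fun x => phi x ^+ j * cos ((z + h) * phi x) * G x) = 0 /\
             itg (fun x => phi x ^+ j * sin ((z + h) * phi x) * G x) = 0).
  move=> hr Z j.
  have mc : measurable_fun setT (fun x => cos (z * phi x)) by meas.
  have ms : measurable_fun setT (fun x => sin (z * phi x)) by meas.
  have hcc n : `|(~~ odd n)%:R * (-1) ^+ n./2 / n`!%:R : R| <= n`!%:R^-1.
    rewrite !normrM normrX normrN1 expr1n mulr1 (ger0_norm (_ : 0 <= n`!%:R^-1))//.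
    by case: odd; rewrite ?normr0 ?mul0r ?normr1 ?mul1r.
  have hcs n : `|(odd n)%:R * (-1) ^+ n.-1./2 / n`!%:R : R| <= n`!%:R^-1.
    rewrite !normrM normrX normrN1 expr1n mulr1 (ger0_norm (_ : 0 <= n`!%:R^-1))//.
    by case: odd; rewrite ?normr0 ?mul0r ?normr1 ?mul1r.
  have cc (x : R) : series (fun n => (~~ odd n)%:R * (-1) ^+ n./2 / n`!%:R * x ^+ n) N
      @[N --> \oo] --> cos x.
    by have := @is_cvg_series_cos_coeff R x; rewrite cos_coeffE cosE.
  have cs (x : R) : series (fun n => (odd n)%:R * (-1) ^+ n.-1./2 / n`!%:R * x ^+ n) N
      @[N --> \oo] --> sin x.
    by have := @is_cvg_series_sin_coeff R x; rewrite sin_coeffE sinE.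
  have mcos : measurable_fun setT (@cos R) by apply: mf_cos; meas.
  have msin : measurable_fun setT (@sin R) by apply: mf_sin; meas.
  have bc x : `|cos (z * phi x)| <= 1 by rewrite ler_norml cos_geN1 cos_le1.
  have bs x : `|sin (z * phi x)| <= 1 by rewrite ler_norml sin_geN1 sin_le1.
  have [a1 a2] := series_step _ _ _ _ hcc cc mcos mc bc hr (fun j => proj1 (Z j)) j.
  have [b1 b2] := series_step _ _ _ _ hcc cc mcos ms bs hr (fun j => proj2 (Z j)) j.
  have [c1 c2] := series_step _ _ _ _ hcs cs msin mc bc hr (fun j => proj1 (Z j)) j.
  have [d1 d2] := series_step _ _ _ _ hcs cs msin ms bs hr (fun j => proj2 (Z j)) j.
  split.
    have := itgB a1 d1; rewrite a2 d2 subr0 => <-; congr itg; apply/funext => x.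
    by rewrite mulrDl cosD; ring.
  have := itgD b1 c1; rewrite b2 c2 addr0 => <-; congr itg; apply/funext => x.
  by rewrite mulrDl sinD; ring.
pose M := (Num.truncn (`|y| / rho)).+1.
have M0 : 0 < M%:R :> R by [].
have yM : `|y / M%:R| < rho.
  rewrite normrM normfV (@ger0_norm _ M%:R)// ltr_pdivrMr// mulrC.
  by rewrite -ltr_pdivrMr// truncnS_gt.
have : y = 0 + M%:R * (y / M%:R) by rewrite add0r mulrC divfK// gt_eqF.
move: (y / M%:R) yM => h hr ->; move: M {M0} => M; elim: M => [|m ih].
  move=> j; rewrite mul0r addr0; split.
    rewrite -[RHS](moments_exp j 0) ?normr0//; congr itg; apply/funext => x.
    by rewrite !mul0r cos0 expR0.
  by rewrite -[RHS]itg0; congr itg; apply/funext => x; rewrite mul0r sin0 mulr0 mul0r.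
move=> j; rewrite (_ : 0 + m.+1%:R * h = 0 + m%:R * h + h); first exact: step.
by rewrite -natr1; ring.
Qed.

Let iG0 : itb (fun x => `|G x|).
Proof.
have := idom 0 0 (fun=> 1) (measurable_cst _) rho0.
move=> /(_ _)/itb_norm; rewrite (_ : (fun x => `|_|) = fun x => `|G x|); last first.
  by apply/funext => x; rewrite expr0 !mul1r.
by apply => x; rewrite normr1 mul0r expR0.
Qed.

(** The vanishing integrals of [cos (y * (phi x - a))] are averaged over [y > 0] with weight e^(-b
    y), which by Fubini puts the Poisson kernel in front of [G]. *)
Let poisson0 (a b : R) : 0 < b ->
  itg (fun x => b / (b ^+ 2 + (phi x - a) ^+ 2) * G x) = 0.
Proof.
move=> b0; pose E := cutoff `[0, +oo[ (fun y => expR (- (b * y))).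
have mE : measurable_fun setT E by apply: mf_cutoff; meas.
have iE : itb E by exact: itb_expN.
pose F (z : R * R) := G z.1 * (E z.2 * cos (z.2 * (phi z.1 - a))).
have E0 y : 0 <= E y by rewrite /E /cutoff; case: ifP => // _; exact: expR_ge0.
have := itg_fubini F (fun x => `|G x|) E _ iG0 iE.
have mF : measurable_fun setT F.
  apply: measurable_funM; first by apply: measurableT_comp => //.
  apply: measurable_funM; first by apply: measurableT_comp => //.
  apply: mf_cos; apply: measurable_funM => //; apply: measurable_funB => //.
  by apply: measurableT_comp => //.
move=> /(_ mF) H; have {H} : itg (fun x => itg (fun y => F (x, y))) =
  itg (fun y => itg (fun x => F (x, y))).
  apply: H => x y; rewrite /F/= !normrM ler_wpM2l// (ger0_norm (E0 y)).
  by rewrite -[leRHS]mulr1 ler_wpM2l// ler_norml cos_geN1 cos_le1.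
rewrite (_ : (fun x => itg (fun y => F (x, y))) =
    fun x => b / (b ^+ 2 + (phi x - a) ^+ 2) * G x); last first.
  apply/funext => x; rewrite -poisson_kernel// mulrC -itgZ; last first.
    apply: (itb_le E) => //.
      by apply: mf_cutoff; meas.
    move=> y; rewrite /E /cutoff; case: ifP => _; last by rewrite normr0.
    rewrite normrM ger0_norm ?expR_ge0// -[leRHS]mulr1 ler_wpM2l ?expR_ge0//.
    by rewrite ler_norml cos_geN1 cos_le1.
  congr itg; apply/funext => y; rewrite /F /E /cutoff/=.
  by case: ifP => _ //; rewrite mul0r.
move=> ->; rewrite (_ : (fun y => _) = fun=> 0) ?itg0//.
apply/funext => y.
have b1 (S : R -> R) x : S = cos \/ S = sin -> `|S (y * phi x)| <= expR (0 * `|phi x|).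
  rewrite mul0r expR0 ler_norml; case=> ->; first by rewrite cos_geN1 cos_le1.
  by rewrite sin_geN1 sin_le1.
have [tc ts] := trig_moments y 0.
have ic := idom 0 0 (fun x => cos (y * phi x)) ltac:(meas) rho0 (fun x => b1 cos x (or_introl erefl)).
have isn := idom 0 0 (fun x => sin (y * phi x)) ltac:(meas) rho0 (fun x => b1 sin x (or_intror erefl)).
have := itgD (itbZ (E y * cos (y * a)) ic) (itbZ (E y * sin (y * a)) isn).
rewrite itgZ// itgZ// tc ts !mulr0 addr0 => <-; congr itg; apply/funext => x.
by rewrite /F/= mulrBr cosB; ring.
Qed.

Hypothesis level_null : forall a, {ae mu, forall x, phi x <> a}.

(** Integrating the Poisson kernel over its centre [a] in [a1, a2] gives a difference of
    arctangents, which for [b] tending to 0 converges to pi times the indicator of a1 < phi < a2. On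
    the two end levels the limit is different; [level_null] discards them. *)
Theorem laplace_inj (a1 a2 : R) : a1 < a2 ->
  itg (fun x => if a1 < phi x < a2 then G x else 0) = 0.
Proof.
move=> a12.
have miv : measurable_fun setT (fun x => if a1 < phi x < a2 then G x else 0).
  apply: mf_if => //; apply: measurable_and; exact: measurable_fun_ltr.
pose at_ (b : R) x := atan ((a2 - phi x) / b) - atan ((a1 - phi x) / b).
have key b : 0 < b -> itg (fun x => at_ b x * G x) = 0.
  move=> b0.
  have d0 u : 0 < b ^+ 2 + u ^+ 2 by rewrite ltr_wpDr ?sqr_ge0// exprn_gt0.
  have bd u : `|b / (b ^+ 2 + u ^+ 2)| <= b^-1.
    rewrite ger0_norm; last by rewrite divr_ge0// ltW.
    rewrite ler_pdivrMr// ler_pdivlMl// -expr2.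
    by rewrite lerDl sqr_ge0.
  pose I := cutoff `[a1, a2] (fun=> 1 : R).
  have iI : itb I.
    have [|//] := FTCc a1 a2 (fun=> 1) id a12.
    by move=> x; exact: cvg_cst.
  have mI := itb_meas iI.
  pose F (z : R * R) := I z.1 * (b / (b ^+ 2 + (phi z.2 - z.1) ^+ 2)) * G z.2.
  have mF : measurable_fun setT F.
    apply: measurable_funM; last by apply: measurableT_comp => //.
    apply: measurable_funM; first by apply: measurableT_comp => //.
    apply: measurable_funM => //; apply: mf_inv => //.
    apply: measurable_funD => //; apply: measurable_funX; apply: measurable_funB => //.
    by apply: measurableT_comp => //.
  have I0 x : 0 <= I x by rewrite /I /cutoff; case: ifP.
  have := itg_fubini F (fun x => b^-1 * I x) (fun x => `|G x|) mF (itbZ _ iI) iG0.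
  have FB x y : `|F (x, y)| <= b^-1 * I x * `|G y|.
    by rewrite /F/= 2!normrM ler_wpM2r// (ger0_norm (I0 x)) mulrC ler_wpM2r.
  move=> /(_ FB); rewrite (_ : (fun x => itg (fun y => F (x, y))) = fun=> 0); last first.
    apply/funext => a; rewrite -(mulr0 (I a)) -[in RHS](poisson0 a b b0) -itgZ.
      by congr itg; apply/funext => x; rewrite /F/= mulrA.
    apply: (itb_le (fun x => b^-1 * `|G x|)); [|exact: itbZ|].
      apply: measurable_funM => //; apply: measurable_funM => //; apply: mf_inv => //.
      by apply: measurable_funD => //; apply: measurable_funX; apply: measurable_funB.
    by move=> x; rewrite normrM ler_wpM2r.
  rewrite itg0 => /esym; congr (itg _ = _); apply/funext => x.
  have [||iA eA] := FTCc a1 a2 (fun a => b / (b ^+ 2 + (phi x - a) ^+ 2))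
      (fun a => atan ((a - phi x) / b)) a12.
  - move=> a; apply: cvgM; first exact: cvg_cst.
    apply: cvgV; first by rewrite gt_eqF.
    apply: cvgD; first exact: cvg_cst.
    by apply: cvgM; (apply: cvgB; [exact: cvg_cst|exact: cvg_id]).
  - move=> a; apply: is_derive_eq.
    rewrite !(scaler0, addr0, add0r, subr0) /GRing.scale/=.
    have := d0 (phi x - a); have : 0 < 1 + ((a - phi x) / b) ^+ 2.
      by rewrite ltr_wpDr ?sqr_ge0.
    by move=> *; field; rewrite !gt_eqF.
  rewrite /at_ -eA mulrC -itgZ//; congr itg; apply/funext => a.
  by rewrite /F /I /cutoff/=; case: ifP => _; ring.
pose L x := pi * (if a1 < phi x < a2 then G x else 0).
have mat : measurable_fun setT (@atan R).
  by apply: continuous_measurable_fun => x; exact: continuous_atan.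
have b0 N : 0 < N.+1%:R^-1 :> R by rewrite invr_gt0.
have [] := itg_dct (fun N x => at_ N.+1%:R^-1 x * G x) L (fun x => pi * `|G x|).
- move=> N; apply: measurable_funM => //; apply: measurable_funB.
    by apply: (measurableT_comp mat); meas.
  by apply: (measurableT_comp mat); meas.
- exact: measurable_funM.
- exact: itbZ.
- apply: aeS2 (level_null a1) (level_null a2) => x n1 n2.
  rewrite (_ : L x = (if a1 < phi x < a2 then pi else 0) * G x); last first.
    by rewrite /L; case: ifP => _; rewrite ?mulr0 ?mul0r.
  apply: cvgM; last exact: cvg_cst.
  have cN : (N.+1%:R : R) @[N --> \oo] --> +oo.
    by have := @cvgr_idn R; rewrite -(cvg_shiftS (fun n => n%:R : R)).
  have lim_pos u : 0 < u -> atan (u / N.+1%:R^-1) @[N --> \oo] --> (pi / 2 : R).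
    move=> u0; apply: (@cvg_comp _ _ _ (fun N => u / N.+1%:R^-1) atan _ +oo); last exact: cvgy_atan.
    under eq_fun do rewrite invrK.
    apply: (@cvg_comp _ _ _ (fun N => N.+1%:R) (fun r => u * r) _ _ _ cN).
    by apply: gt0_cvgMry => //; exact: cvg_id.
  have lim_neg u : u < 0 -> atan (u / N.+1%:R^-1) @[N --> \oo] --> (- (pi / 2) : R).
    move=> u0; rewrite -(opprK u); under eq_fun do rewrite mulNr atanN.
    by apply: cvgN; apply: lim_pos; rewrite oppr_gt0.
  have [h1|h1|h1] := ltgtP a1 (phi x); last by case: n1.
    have [h2|h2|h2] := ltgtP (phi x) a2; last by case: n2.
      rewrite (_ : pi = pi / 2 - (- (pi / 2))); last by field.
      by apply: cvgB; [apply: lim_pos|apply: lim_neg]; lra.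
    rewrite (_ : 0 = - (pi / 2) - (- (pi / 2))); last by ring.
    by apply: cvgB; apply: lim_neg; lra.
  rewrite (_ : 0 = (pi / 2) - (pi / 2)); last by ring.
  by apply: cvgB; apply: lim_pos; lra.
- move=> N x; rewrite normrM ler_wpM2r// ler_norml /at_.
  have := atan_gtNpi2 ((a2 - phi x) / N.+1%:R^-1).
  have := atan_gtNpi2 ((a1 - phi x) / N.+1%:R^-1).
  have := atan_ltpi2 ((a1 - phi x) / N.+1%:R^-1).
  have := atan_ltpi2 ((a2 - phi x) / N.+1%:R^-1).
  by move=> *; apply/andP; split; lra.
move=> _; under eq_fun do rewrite key//.
move=> H; have : itg L = 0 by apply: (cvgr_eq H); exact: cvg_cst.
rewrite /L itgZ.
  by move=> /eqP; rewrite mulf_eq0 gt_eqF ?pi_gt0//= => /eqP.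
apply: (itb_le (fun x => `|G x|)) => // x.
by case: ifP => // _; rewrite normr0.
Qed.

End Uniqueness.

(** * The Gamma function and moments of exponentials of powers *)

Section GammaTheory.
Context {R : realType}.
Local Notation mu := (@lebesgue_measure R).
Implicit Types (f F : R -> R) (a b s c q t : R).

Lemma cvge_eq {u : nat -> \bar R} {x y : \bar R} :
  u @ \oo --> x -> u @ \oo --> y -> x = y.
Proof. by move=> ux uy; apply: (cvg_unique (@ereal_hausdorff R) ux uy). Qed.

Lemma powR_continuous_gt0 s t : 0 < t -> {for t, continuous (fun x : R => x `^ s)}.
Proof.
move=> t0; apply: differentiable_continuous; apply/derivable1_diffP.
by case: (is_derive1_powR s t0).
Qed.

(** The power functions are smooth only away from 0, so integration by parts and substitution are
    done on compact subintervals and the identities pass to the half-line by monotone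
    convergence. *)
Lemma ge0_cvg_itv_0y f (a b : nat -> R) : measurable_fun setT f ->
  (forall x, 0 <= f x) ->
  {homo a : m n / (m <= n)%N >-> n <= m} -> {homo b : m n / (m <= n)%N >-> m <= n} ->
  (forall n, 0 < a n) ->
  (forall x, 0 < x -> exists n, a n <= x <= b n) ->
  (\int[mu]_(x in `[a n, b n]) (f x)%:E @[n --> \oo] -->
   \int[mu]_(x in `]0%R, +oo[) (f x)%:E)%E.
Proof.
move=> mf f0 ha hb a0 hx.
rewrite (_ : `]0%R, +oo[%classic = \bigcup_n `[a n, b n]%classic); last first.
  apply/seteqP; split => x /=; rewrite in_itv/= ?andbT.
    by move=> /hx[n hn]; exists n => //=; rewrite in_itv.
  by move=> [n _] /=; rewrite !in_itv/= => /andP[h _]; apply: lt_le_trans h.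
apply: ge0_nondecreasing_set_cvg_integral => //.
- move=> m n mn; apply/subsetPset => x /=; rewrite !in_itv/= => /andP[h1 h2].
  by rewrite (le_trans (ha _ _ mn) h1) (le_trans h2)// hb.
- by move=> n; apply/measurable_EFinP/measurable_funTS.
- by move=> n x _; rewrite lee_fin.
Qed.

Definition gammaf s t : R := t `^ (s - 1) * expR (- t).

Let mgammaf s : measurable_fun setT (gammaf s).
Proof. by rewrite /gammaf; meas. Qed.

Let gammaf_ge0 s t : 0 <= gammaf s t.
Proof. by rewrite mulr_ge0 ?powR_ge0 ?expR_ge0. Qed.

Lemma powR_le1Dn s t m : 0 <= t -> 0 <= s -> s <= m%:R -> t `^ s <= 1 + t ^+ m.
Proof.
move=> t0 s0 sm; have [t1|t1] := leP t 1.
  apply: (@le_trans _ _ 1); last by rewrite lerDl exprn_ge0.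
  by have := ge0_ler_powR s0 t0 ler01 t1; rewrite powR1.
apply: (@le_trans _ _ (t ^+ m)); last by rewrite lerDr.
by rewrite -powR_mulrn// ler_powR// ltW.
Qed.

Lemma powR_le_exp s c : 0 <= s -> 0 < c -> exists2 K, 0 < K &
  forall t, 0 <= t -> t `^ s <= K * expR (c * t).
Proof.
move=> s0 c0; pose m := (Num.truncn s).+1.
exists (1 + m`!%:R / c ^+ m).
  by rewrite ltr_pwDl// divr_ge0// exprn_ge0// ltW.
move=> t t0; apply: (le_trans (powR_le1Dn _ _ m t0 s0 _)).
  by rewrite ltW// truncnS_gt.
rewrite mulrDl mul1r lerD//; last exact: pow_le_exp.
by rewrite -expR0 ler_expR mulr_ge0// ltW.
Qed.

Lemma itb_powR_expN s c : 0 <= s -> 0 < c ->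
  itb (cutoff `]0, +oo[ (fun t => t `^ s * expR (- (c * t)))).
Proof.
move=> s0 c0; have c2 : 0 < c / 2 by rewrite divr_gt0.
have [K K0 hK] := powR_le_exp s (c / 2) s0 c2.
apply: (itb_le _ _ (itbZ K (itb_expN (c / 2) c2))).
  by apply: mf_cutoff; meas.
move=> x; rewrite /cutoff !in_itv/= !andbT; case: ifPn => [x0|_].
  rewrite (ltW x0) ger0_norm; last by rewrite mulr_ge0 ?powR_ge0 ?expR_ge0.
  rewrite (_ : - (c * x) = - (c / 2 * x) - (c / 2 * x)); last by field.
  rewrite expRD mulrA ler_wpM2r ?expR_ge0//.
  by rewrite expRN ler_pdivrMr ?expR_gt0// hK// ltW.
by rewrite normr0 mulr_ge0 ?(ltW K0)//; case: ifP => // _; exact: expR_ge0.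
Qed.

Lemma FTCpos a b f F : 0 < a -> a < b ->
  (forall x : R, 0 < x -> {for x, continuous f}) ->
  (forall x : R, 0 < x -> is_derive x 1 F (f x)) ->
  mu.-integrable `[a, b] (EFin \o f) /\
  (\int[mu]_(x in `[a, b]) (f x)%:E = (F b - F a)%:E)%E.
Proof.
move=> a0 ab cf dF.
have b0 : 0 < b by apply: lt_trans ab.
have cF x : 0 < x -> {for x, continuous F}.
  by move=> x0; apply: differentiable_continuous; apply/derivable1_diffP; case: (dF x x0).
have wf : {within `[a, b], continuous f}.
  apply/continuous_within_itvP => //; split.
  - by move=> x; rewrite in_itv/= => /andP[ax _]; apply: cf; apply: lt_trans ax.
  - by apply: cvg_at_right_filter; exact: cf.
  - by apply: cvg_at_left_filter; exact: cf.
split.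
  by apply: continuous_compact_integrable => //; exact: segment_compact.
rewrite (continuous_FTC2 ab wf (F := F))//.
- split.
  + by move=> x; rewrite in_itv/= => /andP[ax _]; case: (dF x (lt_trans a0 ax)).
  + by apply: cvg_at_right_filter; exact: cF.
  + by apply: cvg_at_left_filter; exact: cF.
- by move=> x; rewrite in_itv/= => /andP[ax _]; rewrite derive1E; case: (dF x (lt_trans a0 ax)).
Qed.

(** With [n.+1] instead of [n.+2] the interval between [an] and [bn] would be the single point 1 at
    [n = 0]. *)
Let an (n : nat) : R := n.+2%:R^-1.
Let bn (n : nat) : R := n.+2%:R.

Let an_gt0 n : 0 < an n. Proof. by rewrite invr_gt0. Qed.
Let an_lt_bn n : an n < bn n.
Proof.
rewrite /an /bn (@lt_trans _ _ 1)// ?invf_lt1 ?ltr0n// ltr1n//.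
Qed.
Let an_homo : {homo an : m n / (m <= n)%N >-> n <= m}.
Proof. by move=> m n mn; rewrite /an lef_pV2 ?posrE// ler_nat. Qed.
Let bn_homo : {homo bn : m n / (m <= n)%N >-> m <= n}.
Proof. by move=> m n mn; rewrite /bn ler_nat. Qed.
Let anbn_cover x : 0 < x -> exists n, an n <= x <= bn n.
Proof.
move=> x0; exists (Num.truncn x + Num.truncn x^-1)%N; apply/andP; split.
  rewrite /an -[leRHS]invrK lef_pV2 ?posrE ?invr_gt0// ltW//.
  apply: (lt_le_trans (truncnS_gt _)); rewrite ler_nat.
  by rewrite ltnS ltnW// ltnS leq_addl.
apply: ltW; apply: (lt_le_trans (truncnS_gt _)); rewrite ler_nat.
by rewrite ltnS ltnW// ltnS leq_addr.
Qed.

Let bn_cvg : bn n @[n --> \oo] --> +oo.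
Proof.
have := @cvgr_idn R.
by rewrite -(cvg_shiftS (fun n => n%:R : R)) -(cvg_shiftS (fun n => n.+1%:R : R)).
Qed.

Let an_cvg s : 0 < s -> an n `^ s @[n --> \oo] --> 0.
Proof.
move=> s0; have := powR_cvg0 s0; move=> /cvg_at_rightP; apply; split => //.
by have := @cvg_harmonic R; rewrite -(cvg_shiftS (fun n => n.+1%:R^-1 : R)).
Qed.

Let powR_expN_cvg0 s : 0 <= s -> bn n `^ s * expR (- bn n) @[n --> \oo] --> 0.
Proof.
move=> s0; have h2 : 0 < 2^-1 :> R by rewrite invr_gt0.
have [K K0 hK] := powR_le_exp s 2^-1 s0 h2.
apply: (cvg0_le (g := fun n => expR (- (2^-1 * bn n)) * K)).
  move=> n; rewrite ger0_norm; last by rewrite mulr_ge0 ?powR_ge0 ?expR_ge0.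
  rewrite (_ : - bn n = - (2^-1 * bn n) - (2^-1 * bn n)); last by field.
  rewrite expRD mulrA mulrC ler_wpM2l ?expR_ge0//.
  by rewrite expRN ler_pdivrMr ?expR_gt0// hK.
apply: (@cvg_comp _ _ _ bn (fun y => expR (- (2^-1 * y)) * K) _ _ _ bn_cvg).
exact: (expN_cvg0 _ `|K|).
Qed.

(** Integration by parts with boundary terms that vanish at both ends. The identity is stated in the
    extended reals because for [s < 1] the left integral is not yet known to be finite: finiteness
    is proved directly at [s + 1], where the integrand is bounded near 0, and is brought back to [s]
    through the identity. *)
Let gamma_rec s : 0 < s ->
  (s%:E * \int[mu]_(t in `]0%R, +oo[) (gammaf s t)%:E =
   \int[mu]_(t in `]0%R, +oo[) (gammaf (s + 1) t)%:E)%E /\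
  (\int[mu]_(t in `]0%R, +oo[) (gammaf (s + 1) t)%:E < +oo)%E.
Proof.
move=> s0.
have lty : (\int[mu]_(t in `]0%R, +oo[) (gammaf (s + 1) t)%:E < +oo)%E.
  have /itb_cutoffE/integrableP[_] := itb_powR_expN s 1 (ltW s0) ltr01.
  apply: le_lt_trans; apply: ge0_le_integral => //.
  - by move=> x _; rewrite lee_fin.
  - by apply/measurable_EFinP/measurable_funTS => //; apply: mgammaf.
  - by apply/measurable_EFinP/measurable_funTS; meas.
  - by move=> x _; rewrite lee_fin /gammaf addrK mul1r ler_norm.
split=> //.
have c1 := ge0_cvg_itv_0y _ _ _ (mgammaf s) (gammaf_ge0 s) an_homo bn_homo an_gt0 anbn_cover.
have c2 := ge0_cvg_itv_0y _ _ _ (mgammaf (s + 1)) (gammaf_ge0 (s + 1)) an_homo bn_homo an_gt0 anbn_cover.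
have cg r x : 0 < x -> {for x, continuous (gammaf r)}.
  move=> x0; apply: cvgM; first exact: powR_continuous_gt0.
  by apply: (@cvg_comp _ _ _ (fun z : R => - z) expR _ (nbhs (- x)));
    [apply: cvgN; exact: cvg_id|exact: continuous_expR].
have ig r n : mu.-integrable `[an n, bn n] (EFin \o gammaf r).
  apply: continuous_compact_integrable; first exact: segment_compact.
  apply/continuous_within_itvP => //; split.
  - by move=> x; rewrite in_itv/= => /andP[ax _]; apply: cg; apply: lt_trans ax.
  - by apply: cvg_at_right_filter; exact: cg.
  - by apply: cvg_at_left_filter; apply: cg; apply: lt_trans (an_lt_bn n).
have E n : (s%:E * \int[mu]_(t in `[an n, bn n]) (gammaf s t)%:E =
   \int[mu]_(t in `[an n, bn n]) (gammaf (s + 1) t)%:E +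
   (bn n `^ s * expR (- bn n) - an n `^ s * expR (- an n))%:E)%E.
  have [||_ <-] := FTCpos (an n) (bn n) (fun t => s * gammaf s t - gammaf (s + 1) t)
    (fun t => t `^ s * expR (- t)) (an_gt0 n) (an_lt_bn n).
  - move=> x x0; apply: cvgB; last exact: cg.
    by apply: cvgM; [exact: cvg_cst|exact: cg].
  - move=> x x0; have := is_derive1_powR s x0 => dp.
    apply: is_derive_eq; rewrite /gammaf addrK /GRing.scale/=.
    ring.
  under [X in (_ = _ + X)%E]eq_integral => x _ do rewrite EFinB EFinM.
  have iZ : mu.-integrable `[an n, bn n] (fun x => s%:E * (gammaf s x)%:E)%E.
    by apply: integrableZl; [exact: measurable_itv|exact: ig].
  rewrite integralB//; last exact: ig.
  rewrite integralZl//; last exact: ig.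
  rewrite [RHS]addeC subeK//.
  exact: (integrable_fin_num _ (ig _ _)).
apply: (@cvge_eq (fun n => s%:E * \int[mu]_(t in `[an n, bn n]) (gammaf s t)%:E)%E).
- by apply: cvgeZl => //; exact: c1.
- under eq_fun do rewrite E.
  rewrite -(adde0 (\int[mu]_(t in `]0%R, +oo[) (gammaf (s + 1) t)%:E)%E).
  apply: cvgeD; [exact: fin_num_adde_defl|exact: c2|].
  apply/(@fine_cvgP _ _ _ _ _ (0:R)); split; first exact: nearW.
  rewrite -(subr0 0); apply: cvgB; first by apply: powR_expN_cvg0; exact: ltW.
  apply: (cvg0_le (g := fun n => an n `^ s)); last exact: an_cvg.
  move=> n; rewrite ger0_norm; last by rewrite mulr_ge0 ?powR_ge0 ?expR_ge0.
  by rewrite -[leRHS]mulr1 ler_wpM2l ?powR_ge0// expR_le1 oppr_le0 ltW.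
Qed.

Lemma integrable_gammaf s : 0 < s -> mu.-integrable `]0, +oo[ (EFin \o gammaf s).
Proof.
move=> s0; have [E lt] := gamma_rec s s0; apply/integrableP; split.
  by apply/measurable_EFinP/measurable_funTS => //; apply: mgammaf.
under eq_integral => x _ do rewrite /= ger0_norm//.
move: lt; rewrite -E; have : (0 <= \int[mu]_(x in `]0%R, +oo[) (gammaf s x)%:E)%E.
  by apply: integral_ge0 => x _; rewrite lee_fin.
case: (\int[mu]_(x in _) _)%E => [r _ _|_|//]; first exact: ltry.
by rewrite gt0_muley ?lte_fin// ltxx.
Qed.

Lemma GammaE s : 0 < s ->
  (\int[mu]_(t in `]0%R, +oo[) (gammaf s t)%:E = (Gamma s)%:E)%E.
Proof.
move=> s0; rewrite /Gamma /Rintegral fineK//.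
by apply: (integrable_fin_num _ (integrable_gammaf s s0)).
Qed.

Lemma GammaS s : 0 < s -> Gamma (s + 1) = s * Gamma s.
Proof.
move=> s0; have [E _] := gamma_rec s s0.
by apply: EFin_inj; rewrite -GammaE ?addr_gt0// -E GammaE.
Qed.

Lemma Gamma_gt0 s : 0 < s -> 0 < Gamma s.
Proof.
move=> s0; rewrite lt_neqAle; apply/andP; split; last first.
  by rewrite /Gamma Rintegral_ge0// => x _; rewrite mulr_ge0 ?powR_ge0 ?expR_ge0.
apply/negP => /eqP G0; have := GammaE s s0; rewrite -G0 => E.
(* A lower bound of the integrand on [1, 2]; the minimum covers both the increasing and the
   decreasing case of the power. *)
pose m := Num.min (1 `^ (s - 1) * expR (-2)) (2 `^ (s - 1) * expR (-2)) : R.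
have m0 : 0 < m by rewrite /m lt_min !mulr_gt0 ?powR_gt0 ?expR_gt0.
have : (m%:E * mu `[1%R, 2%R] <= \int[mu]_(t in `]0%R, +oo[) (gammaf s t)%:E)%E.
  rewrite -integral_cst//.
  apply: (@le_trans _ _ (\int[mu]_(t in `[1%R, 2%R]) (gammaf s t)%:E)%E).
    apply: ge0_le_integral => //.
    - by move=> x _; rewrite /cst/= lee_fin ltW.
    - by apply/measurable_EFinP/measurable_funTS => //; apply: mgammaf.
    - move=> x /=; rewrite in_itv/= => /andP[x1 x2]; rewrite lee_fin.
      have x0 : 0 <= x by lra.
      apply: (@le_trans _ _ (x `^ (s - 1) * expR (-2))); last first.
        by rewrite ler_wpM2l ?powR_ge0// ler_expR lerN2.
      have [s1|s1] := leP 0 (s - 1).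
        rewrite ge_min; apply/orP; left; rewrite ler_wpM2r ?expR_ge0//.
        by apply: ge0_ler_powR => //; rewrite nnegrE.
      rewrite ge_min; apply/orP; right; rewrite ler_wpM2r ?expR_ge0//.
      rewrite -(opprK (s - 1)) !(powRN _ (- (s - 1))) lef_pV2 ?posrE ?powR_gt0//; last lra.
      by apply: ge0_ler_powR => //; rewrite ?nnegrE// oppr_ge0 ltW.
  apply: ge0_subset_integral => //.
  - by apply/measurable_EFinP/measurable_funTS => //; apply: mgammaf.
  - by move=> x _; rewrite lee_fin.
  - by move=> x /=; rewrite !in_itv/= => /andP[x1 _]; rewrite andbT; lra.
rewrite E lebesgue_measure_itv/= lte_fin ltrDl ltr01 -EFinB -EFinM lee_fin.
by rewrite leNgt mulr_gt0//; lra.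
Qed.

(* The substitution t = c x^q. *)
Let moment0 c q (r : R) : 0 < c -> 0 < q -> 0 <= r ->
  (\int[mu]_(x in `]0%R, +oo[) (expR (- (c * x `^ q)) * x `^ r)%:E =
   (q^-1 * c `^ (- ((r + 1) / q)) * Gamma ((r + 1) / q))%:E)%E.
Proof.
move=> c0 q0 r0; pose s := (r + 1) / q.
have s0 : 0 < s by rewrite divr_gt0// ltr_wpDl.
pose F x : R := c * x `^ q.
have dF (x : R) : 0 < x -> is_derive x 1 F (c * (q * x `^ (q - 1))).
  by move=> x0; have := is_derive1_powR q x0 => dp; apply: is_derive_eq.
have F'E (x : R) : 0 < x -> (derive1 F) x = c * (q * x `^ (q - 1)).
  by move=> x0; rewrite derive1E; case: (dF x x0).
have cF' (x : R) : 0 < x -> {for x, continuous (derive1 F)}.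
  move=> x0; have : (fun x : R => c * (q * x `^ (q - 1))) z @[z --> x] --> (derive1 F) x.
    rewrite F'E//; apply: cvgM; first exact: cvg_cst.
    by apply: cvgM; [exact: cvg_cst|exact: powR_continuous_gt0].
  apply: cvg_trans; apply: near_eq_cvg; near=> z; rewrite F'E//; near: z.
  exact: lt_nbhsr.
have Fmono (x y : R) : 0 < x -> x < y -> F x < F y.
  move=> x0 xy; rewrite /F ltr_pM2l//; apply: gt0_ltr_powR => //; rewrite nnegrE ltW//.
  exact: lt_trans xy.
have F0 (x : R) : 0 < x -> 0 < F x by move=> x0; rewrite mulr_gt0// powR_gt0.
have b0 n : 0 < bn n by rewrite ltr0n.
have E n : (\int[mu]_(x in `[F (an n), F (bn n)]) (gammaf s x)%:E =
    \int[mu]_(x in `[an n, bn n]) ((q * c `^ s) * (expR (- (c * x `^ q)) * x `^ r))%:E)%E.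
  rewrite (integration_by_substitution_increasing (ltW (an_lt_bn n)))//.
  - apply: eq_integral => x; rewrite inE/= in_itv/= => /andP[ax xb].
    have x0 : 0 < x by apply: lt_le_trans ax.
    congr EFin; rewrite !fctE /= F'E// /gammaf /F powRM ?powR_ge0 ?(ltW c0)// -powRrM.
    rewrite (_ : x `^ r = x `^ (q * (s - 1)) * x `^ (q - 1)); last first.
      rewrite -powRD; last by rewrite (gt_eqF x0) implybT.
      rewrite (_ : q * (s - 1) + (q - 1) = r)// /s.
      by field; rewrite gt_eqF.
    have cs : c `^ s = c `^ (s - 1) * c.
      rewrite -[X in _ * X](powRr1 (ltW c0)) -powRD; last by rewrite (gt_eqF c0) implybT.
      by rewrite subrK.
    rewrite cs.
    by ring.
  - by move=> x y; rewrite !in_itv/= => /andP[ax _] _; apply: Fmono; apply: lt_le_trans ax.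
  - by move=> x; rewrite in_itv/= => /andP[ax _]; apply: cF'; apply: lt_trans ax.
  - apply/cvg_ex; exists ((derive1 F) (an n)); apply: cvg_at_right_filter; exact: cF'.
  - apply/cvg_ex; exists ((derive1 F) (bn n)); apply: cvg_at_left_filter; exact: cF'.
  - split.
    + by move=> x; rewrite in_itv/= => /andP[ax _]; case: (dF x (lt_trans (an_gt0 n) ax)).
    + apply: cvg_at_right_filter; apply: differentiable_continuous; apply/derivable1_diffP.
      by case: (dF (an n) (an_gt0 n)).
    + apply: cvg_at_left_filter; apply: differentiable_continuous; apply/derivable1_diffP.
      by case: (dF (bn n) (b0 n)).
  - have cg (x : R) : 0 < x -> {for x, continuous (gammaf s)}.
      move=> x0; apply: cvgM; first exact: powR_continuous_gt0.
      by apply: (@cvg_comp _ _ _ (fun z : R => - z) expR _ (nbhs (- x)));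
        [apply: cvgN; exact: cvg_id|exact: continuous_expR].
    apply/continuous_within_itvP; first exact: Fmono.
    split.
    + by move=> x; rewrite in_itv/= => /andP[ax _]; apply: cg; apply: lt_trans ax; exact: F0.
    + by apply: cvg_at_right_filter; apply: cg; exact: F0.
    + by apply: cvg_at_left_filter; apply: cg; exact: F0.
have k0 : 0 < q * c `^ s by rewrite mulr_gt0// powR_gt0.
have mf : measurable_fun setT (fun x : R => expR (- (c * x `^ q)) * x `^ r) by meas.
have f0 (x : R) : 0 <= expR (- (c * x `^ q)) * x `^ r by rewrite mulr_ge0 ?powR_ge0 ?expR_ge0.
have c1 := ge0_cvg_itv_0y _ (fun n => F (an n)) (fun n => F (bn n)) (mgammaf s) (gammaf_ge0 s).
have c2 := ge0_cvg_itv_0y (fun x => (q * c `^ s) * (expR (- (c * x `^ q)) * x `^ r)) _ _ _ _ an_homo bn_homo an_gt0 anbn_cover.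
have Fle (x y : R) : 0 < x -> x <= y -> F x <= F y.
  by move=> x0; rewrite le_eqVlt => /predU1P[->//|xy]; apply/ltW/Fmono.
have eqI : (\int[mu]_(x in `]0%R, +oo[) (gammaf s x)%:E =
    \int[mu]_(x in `]0%R, +oo[) ((q * c `^ s) * (expR (- (c * x `^ q)) * x `^ r))%:E)%E.
  apply: (@cvge_eq (fun n => \int[mu]_(x in `[F (an n), F (bn n)]) (gammaf s x)%:E)%E).
  - apply: c1.
    + by move=> m n mn; apply: Fle => //; exact: an_homo.
    + by move=> m n mn; apply: Fle => //; exact: bn_homo.
    + by move=> n; exact: F0.
    + move=> x x0; pose y := (x / c) `^ q^-1.
      have y0 : 0 < y by rewrite powR_gt0// divr_gt0.
      have -> : x = F y.
        rewrite /F /y -powRrM mulVf ?gt_eqF// powRr1 ?divr_ge0 ?ltW//.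
        by rewrite mulrC divfK// gt_eqF.
      have [n /andP[ny yn]] := anbn_cover y y0; exists n.
      by rewrite !Fle.
  - under eq_fun do rewrite E; apply: c2.
    + by meas.
    + by move=> x; rewrite mulr_ge0// ltW.
rewrite GammaE// in eqI.
have : (Gamma s)%:E = ((q * c `^ s)%:E * \int[mu]_(x in `]0%R, +oo[) (expR (- (c * x `^ q)) * x `^ r)%:E)%E.
  rewrite eqI; under eq_integral => x _ do rewrite EFinM.
  rewrite ge0_integralZl_EFin// ?ltW//.
  - by move=> x _; rewrite lee_fin.
  - by apply/measurable_EFinP/measurable_funTS => //; apply: mgammaf.
have : (0 <= \int[mu]_(x in `]0%R, +oo[) (expR (- (c * x `^ q)) * x `^ r)%:E)%E.
  by apply: integral_ge0 => x _; rewrite lee_fin.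
case: (\int[mu]_(x in _) _)%E => [v _|_|//]; last first.
  by rewrite gt0_muley ?lte_fin.
rewrite -EFinM => -[G]; rewrite -/s G; congr EFin.
rewrite powRN; field.
by rewrite !gt_eqF// powR_gt0.
Unshelve. all: by end_near. Qed.

Lemma powR_expN_moment_pos c q (r : R) : 0 < c -> 0 < q -> 0 <= r ->
  itb (cutoff `]0, +oo[ (fun x => expR (- (c * x `^ q)) * x `^ r)) /\
  itg (cutoff `]0, +oo[ (fun x => expR (- (c * x `^ q)) * x `^ r)) =
    q^-1 * c `^ (- ((r + 1) / q)) * Gamma ((r + 1) / q).
Proof.
move=> c0 q0 r0; have E := moment0 c q r c0 q0 r0; split; last first.
  by rewrite itg_cutoff /Rintegral E.
apply/itb_cutoffE/integrableP; split.
  by apply/measurable_EFinP/measurable_funTS; meas.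
under eq_integral => x _.
  rewrite /= ger0_norm; last by rewrite mulr_ge0 ?powR_ge0 ?expR_ge0.
  over.
by rewrite E ltry.
Qed.

Lemma powR_expN_moment c q (r : R) : 0 < c -> 0 < q -> 0 <= r ->
  itb (fun x => expR (- (c * `|x| `^ q)) * `|x| `^ r) /\
  itg (fun x => expR (- (c * `|x| `^ q)) * `|x| `^ r) =
    2 / q * c `^ (- ((r + 1) / q)) * Gamma ((r + 1) / q).
Proof.
move=> c0 q0 r0; pose f (x : R) := expR (- (c * `|x| `^ q)) * `|x| `^ r.
have f0 (x : R) : 0 <= f x by rewrite mulr_ge0 ?powR_ge0 ?expR_ge0.
have mf : measurable_fun setT f by rewrite /f; meas.
have E : (\int[mu]_x (f x)%:E = (2 / q * c `^ (- ((r + 1) / q)) * Gamma ((r + 1) / q))%:E)%E.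
  have E1 : (\int[mu]_(x in `[0%R, +oo[) (f x)%:E = \int[mu]_(x in `]0%R, +oo[) (f x)%:E)%E.
    by rewrite integral_itv_obnd_cbnd//; apply/measurable_EFinP/measurable_funTS.
  have E2 := moment0 c q r c0 q0 r0.
  have E3 : (\int[mu]_(x in `]0%R, +oo[) (f x)%:E =
      \int[mu]_(x in `]0%R, +oo[) (expR (- (c * x `^ q)) * x `^ r)%:E)%E.
    apply: eq_integral => x; rewrite inE/= in_itv/= andbT => x0.
    by rewrite /f gtr0_norm.
  rewrite -(setUv `[0%R, +oo[%classic) ge0_integral_setU//=; last 4 first.
  - exact: measurableC.
  - by rewrite setUv; apply/measurable_EFinP.
  - by move=> x _; rewrite lee_fin.
  - exact/disj_setPCl.
  rewrite setCitvr integral_itv_bndo_bndc; last by apply/measurable_EFinP/measurable_funTS => //; apply: mgammaf.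
  have -> : (\int[mu]_(x in `]-oo, 0%R]) (f x)%:E = \int[mu]_(x in `[0%R, +oo[) (f x)%:E)%E.
    rewrite (@ge0_integration_by_substitution0 _ (EFin \o f)).
    - by apply: eq_integral => x _; rewrite /f/= normrN.
    - exact/measurable_EFinP.
    - by move=> x; rewrite lee_fin.
  by rewrite E1 E3 E2 -EFinD; congr EFin; ring.
split.
  by apply: itb_ge0P => //; rewrite E ltry.
by rewrite /itg /Rintegral E.
Qed.

Lemma itb_expN_norm (c : R) : 0 < c -> itb (fun x => expR (- (c * `|x|))).
Proof.
move=> c0; have [h _] := powR_expN_moment c 1 0 c0 ltr01 (lexx 0).
move: h; congr itb; apply/funext => x.
by rewrite powRr0 mulr1 powRr1.
Qed.

(* An opaque copy of [Gamma], so that conversion never unfolds the integral. *)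
Lemma locked_Gamma : {G : R -> R | G = @Gamma R}.
Proof. by exists (@Gamma R). Qed.

Definition gam : R -> R := sval locked_Gamma.

Lemma gamE : @Gamma R = gam.
Proof. by rewrite /gam; case: locked_Gamma. Qed.

Lemma gamS s : 0 < s -> gam (s + 1) = s * gam s.
Proof. by rewrite -gamE; exact: GammaS. Qed.

Lemma gam_gt0 s : 0 < s -> 0 < gam s.
Proof. by rewrite -gamE; exact: Gamma_gt0. Qed.

End GammaTheory.

(** * Bessel functions of order at least -1/2 *)

Section Bessel.
Context {R : realType}.
Implicit Types nu x r : R.

Definition bessel_coeff nu (m : nat) : R := (-1) ^+ m / (m`!%:R * gam (nu + m%:R + 1)).

(* [bessel nu] is the entire function with
   [j_nu(z) = Gamma(nu + 1) * bessel nu ((z / 2)^2)]. *)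
Definition bessel nu x : R := limn (series (fun m => bessel_coeff nu m * x ^+ m)).

Lemma jbesselE nu z : jbessel nu z = gam (nu + 1) * bessel nu ((z / 2) ^+ 2).
Proof.
rewrite /jbessel gamE /bessel.
rewrite (_ : (fun m : nat => _) = (fun m => bessel_coeff nu m * ((z / 2) ^+ 2) ^+ m))//.
by apply/funext => m; rewrite exprM.
Qed.

(** Each step of the recursion multiplies by nu + m + 1, which is at least (m + 1) / 2 in this range
    of [nu]. *)
Lemma gam_lb nu m : - (1/2) <= nu ->
  gam (nu + 1) * m`!%:R / 2 ^+ m <= gam (nu + m%:R + 1).
Proof.
move=> nu0; elim: m => [|m ih].
  by rewrite fact0 expr0 divr1 mulr1 addr0.
have m0 : 0 <= m%:R :> R by [].
rewrite (_ : nu + m.+1%:R + 1 = (nu + m%:R + 1) + 1); last by rewrite -natr1; ring.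
rewrite (gamS (nu + m%:R + 1)); last by lra.
rewrite factS natrM exprS (_ : _ / _ = (m.+1%:R / 2) * (gam (nu + 1) * m`!%:R / 2 ^+ m)); last first.
  by field; rewrite expf_neq0.
apply: ler_pM => //.
- by rewrite !mulr_ge0// ?invr_ge0 ?exprn_ge0// ltW// gam_gt0//; lra.
- by rewrite -natr1; lra.
Qed.

Lemma bessel_coeff_le nu m : - (1/2) <= nu ->
  `|bessel_coeff nu m| <= (gam (nu + 1))^-1 * 2 ^+ m / (m`!%:R * m`!%:R).
Proof.
move=> nu0; have m0 : 0 <= m%:R :> R by [].
have g0 : 0 < gam (nu + 1) by apply: gam_gt0; lra.
have g1 : 0 < gam (nu + m%:R + 1) by apply: gam_gt0; lra.
have f0 : 0 < m`!%:R :> R by rewrite ltr0n fact_gt0.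
have p0 : 0 < 2 ^+ m :> R by rewrite exprn_gt0.
rewrite /bessel_coeff normrM normrX normrN1 expr1n mul1r ger0_norm; last first.
  by rewrite invr_ge0 mulr_ge0// ltW.
rewrite invfM [leRHS](_ : _ = m`!%:R^-1 * (gam (nu + 1) * m`!%:R / 2 ^+ m)^-1); last first.
  by field; rewrite !gt_eqF.
rewrite ler_wpM2l ?invr_ge0 ?(ltW f0)// lef_pV2 ?posrE//; first exact: gam_lb.
by rewrite divr_gt0// mulr_gt0.
Qed.

(** Of the two factorials in [bessel_coeff_le], one turns the powers of 2 Z / eta into an
    exponential and the other stays with the powers of eta y. The growth in [y] is thus below any
    chosen exponential rate, at the price of a constant depending on [Z]. *)
Lemma bessel_term_le nu m (Z y eta : R) : - (1/2) <= nu -> 0 < eta -> 0 <= Z -> 0 <= y ->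
  `|bessel_coeff nu m * (Z * y) ^+ m| <=
  (gam (nu + 1))^-1 * expR (2 * Z / eta) * ((eta * y) ^+ m / m`!%:R).
Proof.
move=> nu0 e0 Z0 y0; have g0 : 0 < gam (nu + 1) by apply: gam_gt0; lra.
have f0 : 0 < m`!%:R :> R by rewrite ltr0n fact_gt0.
rewrite normrM normrX (ger0_norm (mulr_ge0 Z0 y0)).
apply: (le_trans (ler_wpM2r _ (bessel_coeff_le _ _ nu0))).
  by rewrite exprn_ge0// mulr_ge0.
rewrite [leLHS](_ : _ = (gam (nu + 1))^-1 * ((2 * Z / eta) ^+ m / m`!%:R) * ((eta * y) ^+ m / m`!%:R)); last first.
  by rewrite !exprMn exprVn; field; rewrite !gt_eqF ?exprn_gt0.
have z0 : 0 <= 2 * Z / eta by rewrite divr_ge0 ?mulr_ge0 ?(ltW e0).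
have := pow_le_exp 1 _ m ltr01 z0; rewrite expr1n divr1 mul1r => h.
apply: ler_wpM2r; first by rewrite divr_ge0// exprn_ge0// mulr_ge0// ltW.
by rewrite ler_wpM2l ?invr_ge0 ?(ltW g0)// ler_pdivrMr// [leRHS]mulrC.
Qed.

Lemma bessel_sum_le nu (Z y eta : R) N : - (1/2) <= nu -> 0 < eta -> 0 <= Z -> 0 <= y ->
  \sum_(m < N) `|bessel_coeff nu m * (Z * y) ^+ m| <=
  (gam (nu + 1))^-1 * expR (2 * Z / eta) * expR (eta * y).
Proof.
move=> nu0 e0 Z0 y0; have g0 : 0 < gam (nu + 1) by apply: gam_gt0; lra.
apply: (le_trans (ler_sum _ (fun m _ => bessel_term_le _ _ _ _ _ nu0 e0 Z0 y0))).
rewrite -mulr_sumr ler_wpM2l ?mulr_ge0 ?invr_ge0 ?(ltW g0) ?expR_ge0//.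
have := series_coeff_le (fun n => n`!%:R^-1) (eta * y) N _.
rewrite (ger0_norm (mulr_ge0 (ltW e0) y0)) => H; apply: le_trans (H _); last first.
  by move=> n; rewrite ger0_norm.
rewrite /series/= big_mkord.
under [X in `|X|]eq_bigr => i _ do rewrite mulrC.
exact: ler_norm.
Qed.

Lemma bessel_cvg nu x : - (1/2) <= nu ->
  series (fun m => bessel_coeff nu m * x ^+ m) N @[N --> \oo] --> bessel nu x.
Proof.
move=> nu0; apply: normed_cvg.
apply: nondecreasing_is_cvgn.
  by apply: (@nondecreasing_series _ _ xpredT 0) => n _ _; exact: normr_ge0.
exists ((gam (nu + 1))^-1 * expR (2 * `|x| / 1) * expR (1 * 1)) => _ [N _ <-].
apply: le_trans (bessel_sum_le nu `|x| 1 1 N nu0 ltr01 (normr_ge0 x) ler01).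
rewrite /normed_series_of /series/= big_mkord; apply: ler_sum => m _.
by rewrite mulr1 !normrM !normrX normr_id.
Qed.

Lemma is_derive_bessel nu x : - (1/2) <= nu ->
  is_derive x 1 (bessel nu) (- bessel (nu + 1) x).
Proof.
move=> nu0.
have dE mu : pseries_diffs (bessel_coeff mu) = fun m => - bessel_coeff (mu + 1) m.
  apply/funext => m; rewrite /pseries_diffs /bessel_coeff factS natrM exprS.
  rewrite (_ : mu + m.+1%:R + 1 = mu + 1 + m%:R + 1); last by rewrite -natr1; ring.
  rewrite !invfM; set c := (gam _)^-1.
  have : m.+1%:R != 0 :> R by rewrite pnatr_eq0.
  have : m`!%:R != 0 :> R by rewrite pnatr_eq0 gtn_eqF// fact_gt0.
  by move=> *; field; apply/andP.
have c0 mu K : - (1/2) <= mu -> cvgn (pseries (bessel_coeff mu) K).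
  by move=> mu0; apply/cvg_ex; exists (bessel mu K); exact: bessel_cvg.
have cN (mu K : R) : pseries (fun m => - bessel_coeff mu m) K = - pseries (bessel_coeff mu) K.
  rewrite /pseries; apply/funext => N.
  change (\sum_(0 <= i < N) - bessel_coeff mu i * K ^+ i =
    - \sum_(0 <= i < N) bessel_coeff mu i * K ^+ i).
  rewrite -sumrN; apply: eq_bigr => i _.
  by rewrite mulNr.
have h := @pseries_snd_diffs _ (bessel_coeff nu) (`|x| + 1) x.
have {h} : is_derive x 1 (fun x => limn (pseries (bessel_coeff nu) x))
   (limn (pseries (pseries_diffs (bessel_coeff nu)) x)).
  apply: h.
  - exact: c0.
  - by rewrite dE cN; apply: is_cvgN; apply: c0; lra.
  - rewrite dE (_ : pseries_diffs _ = bessel_coeff (nu + 1 + 1)).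
      by apply: c0; lra.
    rewrite pseries_diffsN dE; apply/funext => m.
    by rewrite /= opprK.
  - by rewrite (@ger0_norm _ (`|x| + 1)) ?addr_ge0// ltrDl.
rewrite dE cN limN//; last by apply: c0; lra.
Qed.

Lemma bessel_continuous nu : - (1/2) <= nu -> continuous (bessel nu).
Proof.
move=> nu0 x; apply: differentiable_continuous; apply/derivable1_diffP.
by case: (is_derive_bessel nu x nu0).
Qed.

Lemma mf_bessel d (T : measurableType d) nu (f : T -> R) : - (1/2) <= nu ->
  measurable_fun setT f -> measurable_fun setT (fun t => bessel nu (f t)).
Proof.
move=> nu0 mf; apply: (@measurableT_comp _ _ _ _ _ _ (bessel nu)) => //.
by apply: continuous_measurable_fun; exact: bessel_continuous.
Qed.

Let coeff_rec nu m : - (1/2) <= nu ->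
  bessel_coeff (nu + 2) m - (nu + 1) * bessel_coeff (nu + 1) m.+1 + bessel_coeff nu m.+1 = 0.
Proof.
move=> nu0; have m0 : 0 <= m%:R :> R by [].
rewrite /bessel_coeff factS natrM !exprS.
rewrite (_ : nu + 2 + m%:R + 1 = nu + m%:R + 2 + 1); last by ring.
rewrite (_ : nu + 1 + m.+1%:R + 1 = nu + m%:R + 2 + 1); last by rewrite -natr1; ring.
rewrite (_ : nu + m.+1%:R + 1 = nu + m%:R + 2); last by rewrite -natr1; ring.
rewrite (gamS (nu + m%:R + 2)); last by lra.
have f0 : 0 < m`!%:R :> R by rewrite ltr0n fact_gt0.
have g0 : 0 < gam (nu + m%:R + 2) by apply: gam_gt0; lra.
have : 0 < nu + m%:R + 2 by lra.
rewrite -natr1; have : 0 < m%:R + 1 :> R by lra.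
by move=> *; field; rewrite !gt_eqF.
Qed.

Lemma bessel_rec nu x : - (1/2) <= nu ->
  x * bessel (nu + 2) x = (nu + 1) * bessel (nu + 1) x - bessel nu x.
Proof.
move=> nu0; apply/eqP; rewrite -subr_eq0; apply/eqP.
pose S mu N := series (fun m => bessel_coeff mu m * x ^+ m) N.
have cS mu : - (1/2) <= mu -> S mu N @[N --> \oo] --> bessel mu x by exact: bessel_cvg.
have SS mu N : S mu N.+1 = S mu N + bessel_coeff mu N * x ^+ N.
  by rewrite /S /series/= big_nat_recr.
(* The recurrence is exact for truncations once the two sums on the right have one term more, which
   accounts for the factor [x]. *)
have E N : x * S (nu + 2) N - ((nu + 1) * S (nu + 1) N.+1 - S nu N.+1) = 0.
  elim: N => [|N ih].
    rewrite /S /series/= big_geq// !big_nat1 /bessel_coeff !expr0 fact0 !addr0.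
    rewrite (gamS (nu + 1)); last by lra.
    have := gam_gt0 (nu + 1) ltac:(lra).
    have : 0 < nu + 1 by lra.
    by move=> *; field; rewrite !gt_eqF.
  rewrite (SS (nu + 2)) (SS (nu + 1) N.+1) (SS nu N.+1).
  rewrite -[RHS](addr0 0) -{2}ih -[in RHS](mul0r (x ^+ N.+1)) -(coeff_rec nu N nu0).
  by rewrite exprS; ring.
apply: (@cvgr_eq _ _ \oo _ (fun N => x * S (nu + 2) N - ((nu + 1) * S (nu + 1) N.+1 - S nu N.+1))).
  apply: cvgB; first by apply: cvgM; [exact: cvg_cst|apply: cS; lra].
  apply: cvgB; first apply: cvgM; first exact: cvg_cst.
    by rewrite (cvg_shiftS (S (nu + 1))); apply: cS; lra.
  by rewrite (cvg_shiftS (S nu)); exact: cS.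
by under eq_fun do rewrite E; exact: cvg_cst.
Qed.

Lemma bessel0 nu : - (1/2) <= nu -> bessel nu 0 = (gam (nu + 1))^-1.
Proof.
move=> nu0; apply: (cvgr_eq (bessel_cvg nu 0 nu0)).
rewrite -cvg_shiftS; apply: cvg_near_cst; near=> N.
rewrite /series/= big_nat_recl// big1 ?addr0.
  by rewrite /bessel_coeff !expr0 fact0 mulr1 mul1r addr0 mul1r.
by move=> i _; rewrite exprS mul0r mulr0.
Unshelve. all: by end_near. Qed.

(* The energy [J_nu^2 + x J_(nu+1)^2] is nonincreasing, its derivative
   being [-(2 nu + 1) J_(nu+1)^2]. *)
Lemma bessel_energy nu x : - (1/2) <= nu -> 0 <= x ->
  bessel nu x ^+ 2 + x * bessel (nu + 1) x ^+ 2 <= (gam (nu + 1))^-1 ^+ 2.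
Proof.
move=> nu0; rewrite le_eqVlt => /predU1P[<-|x0].
  by rewrite mul0r addr0 bessel0.
have nu1 : - (1/2) <= nu + 1 by lra.
pose E (y : R) := bessel nu y ^+ 2 + y * bessel (nu + 1) y ^+ 2.
have dE (y : R) : is_derive y 1 E (- (2 * nu + 1) * bessel (nu + 1) y ^+ 2).
  have d1 := is_derive_bessel nu y nu0.
  have d2 := is_derive_bessel (nu + 1) y nu1.
  apply: is_derive_eq; rewrite /GRing.scale/=.
  have := bessel_rec nu y nu0; rewrite (_ : nu + 1 + 1 = nu + 2); last by ring.
  move=> h.
  rewrite [LHS](_ : _ = - 2 * bessel nu y * bessel (nu + 1) y + bessel (nu + 1) y ^+ 2
     - 2 * bessel (nu + 1) y * (y * bessel (nu + 2) y)); last by ring.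
  by rewrite h; ring.
have cE : {within `[0, x], continuous E}.
  apply: continuous_subspaceT => y; apply: differentiable_continuous.
  by apply/derivable1_diffP; case: (dE y).
have [c _ h] := @MVT _ E _ 0 x x0 (fun y _ => dE y) cE.
have -> : (gam (nu + 1))^-1 ^+ 2 = E 0 by rewrite /E mul0r addr0 bessel0.
rewrite -subr_ge0 -opprB oppr_ge0 h subr0 mulr_le0_ge0 ?(ltW x0)//.
by rewrite mulr_le0_ge0 ?sqr_ge0//; lra.
Qed.

Lemma bessel_le nu x : - (1/2) <= nu -> 0 <= x -> `|bessel nu x| <= (gam (nu + 1))^-1.
Proof.
move=> nu0 x0; have g0 : 0 < gam (nu + 1) by apply: gam_gt0; lra.
rewrite -(@ler_pXn2r _ 2)// ?nnegrE ?invr_ge0 ?(ltW g0)// real_normK ?num_real//.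
apply: le_trans (bessel_energy _ _ nu0 x0).
by rewrite lerDl mulr_ge0// sqr_ge0.
Qed.

(** Raising the order by [m] gains [m] powers of decay in [r]. Orders 0 and 1 follow from
    [bessel_energy]; the three-term recurrence expresses [r ^+ 2] times order m + 2 by the two
    preceding orders, so the induction carries two consecutive bounds. *)
Lemma bessel_pow_le nu m : - (1/2) <= nu -> exists2 K, 0 <= K &
  forall r, 0 <= r -> r ^+ m * `|bessel (nu + m%:R) (r ^+ 2)| <= K.
Proof.
move=> nu0.
have g0 mu : - (1/2) <= mu -> 0 <= (gam (mu + 1))^-1.
  by move=> mu0; rewrite invr_ge0 ltW// gam_gt0//; lra.
suff : (exists2 K, 0 <= K & forall r, 0 <= r -> r ^+ m * `|bessel (nu + m%:R) (r ^+ 2)| <= K) /\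
  (exists2 K, 0 <= K & forall r, 0 <= r -> r ^+ m.+1 * `|bessel (nu + m.+1%:R) (r ^+ 2)| <= K).
  by case.
elim: m => [|m [[K1 K10 h1] [K2 K20 h2]]].
  split; exists ((gam (nu + 1))^-1); rewrite ?g0// => r r0.
    by rewrite expr0 mul1r addr0 bessel_le// sqr_ge0.
  rewrite expr1 -(@ler_pXn2r _ 2)// ?nnegrE ?g0// ?mulr_ge0//.
  rewrite exprMn real_normK ?num_real//.
  apply: le_trans (bessel_energy _ (r ^+ 2) nu0 (sqr_ge0 _)).
  by rewrite lerDr sqr_ge0.
split; first by exists K2.
have m0 : 0 <= m%:R :> R by [].
have num : - (1/2) <= nu + m%:R by lra.
exists ((nu + m%:R + 1) * (K2 + (gam (nu + m%:R + 1 + 1))^-1) + K1).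
  rewrite addr_ge0// mulr_ge0//; first by lra.
  by rewrite addr_ge0// g0//; lra.
move=> r r0; have := bessel_rec _ (r ^+ 2) num.
rewrite (_ : nu + m.+2%:R = nu + m%:R + 2); last by rewrite -!natr1; ring.
move=> E; rewrite (_ : r ^+ m.+2 * _ = r ^+ m * `|r ^+ 2 * bessel (nu + m%:R + 2) (r ^+ 2)|); last first.
  by rewrite normrM (ger0_norm (sqr_ge0 r)) mulrA -exprD addn2.
rewrite E; apply: (@le_trans _ _ (r ^+ m * ((nu + m%:R + 1) * `|bessel (nu + m%:R + 1) (r ^+ 2)| +
    `|bessel (nu + m%:R) (r ^+ 2)|))).
  rewrite ler_wpM2l ?exprn_ge0// (le_trans (ler_normB _ _))// normrM lerD2r.
  by rewrite ler_wpM2r// ger0_norm//; lra.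
rewrite mulrDr lerD ?h1// mulrCA ler_wpM2l//; first by lra.
(* The bound available for order m + 1 contains [r ^+ m.+1] while only [r ^+ m] is present: harmless
   for [r > 1], and for [r <= 1] boundedness of the Bessel function suffices. *)
have [r1|r1] := leP r 1.
  apply: (@le_trans _ _ ((gam (nu + m%:R + 1 + 1))^-1)); last by rewrite lerDr.
  rewrite -[leRHS]mul1r ler_pM ?exprn_ge0 ?exprn_ile1//.
  by rewrite bessel_le ?sqr_ge0//; lra.
have := h2 r r0; rewrite (_ : nu + m.+1%:R = nu + m%:R + 1); last by rewrite -natr1; ring.
move=> h; apply: (@le_trans _ _ K2); last by rewrite lerDl g0//; lra.
apply: le_trans h; rewrite ler_wpM2r// exprS ler_peMl ?exprn_ge0//; exact: ltW.
Qed.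

(** The Gamma factors of the moments cancel those of the Bessel coefficients and leave the
    exponential series at -Z / tau. The weight [v] and the variable [Y] are abstract because the
    lemma serves twice: for the power-exponential weight of [Om_laplace] and for the Gaussian of
    [gauss_transform]. *)
Lemma laplace_bessel nu (C tau Z eta : R) (v Y : R -> R) : - (1/2) <= nu ->
  0 < tau -> 0 < eta -> 0 <= Z -> measurable_fun setT v -> measurable_fun setT Y ->
  (forall t, 0 <= Y t) -> itb (fun t => `|v t| * expR (eta * Y t)) ->
  (forall m, itg (fun t => v t * Y t ^+ m) = C * gam (nu + m%:R + 1) / tau ^+ m) ->
  itg (fun t => v t * bessel nu (Z * Y t)) = C * expR (- (Z / tau)).
Proof.
move=> nu0 t0 e0 Z0 mv mY Y0 iv mom.
have g0 : 0 < gam (nu + 1) by apply: gam_gt0; lra.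
pose K := (gam (nu + 1))^-1 * expR (2 * Z / eta).
have K0 : 0 <= K by rewrite mulr_ge0 ?invr_ge0 ?(ltW g0) ?expR_ge0.
pose f m t := bessel_coeff nu m * Z ^+ m * (v t * Y t ^+ m).
have iY m : itb (fun t => v t * Y t ^+ m).
  apply: (itb_le _ _ (itbZ (m`!%:R / eta ^+ m) iv)); first by meas.
  move=> t; rewrite normrM normrX (ger0_norm (Y0 t)) mulrCA ler_wpM2l//.
  exact: pow_le_exp.
pose F N t := v t * series (fun m => bessel_coeff nu m * (Z * Y t) ^+ m) N.
have FE N : F N = fun t => \sum_(m < N) f m t.
  apply/funext => t; rewrite /F /series/= big_mkord mulr_sumr; apply: eq_bigr => i _.
  by rewrite /f exprMn; ring.
have if_ m : itb (f m) by apply: itbZ.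
have [] := itg_dct F (fun t => v t * bessel nu (Z * Y t)) (fun t => K * (`|v t| * expR (eta * Y t))).
- by move=> N; rewrite FE; apply: itb_meas; exact: itb_sum.
- by apply: measurable_funM => //; apply: mf_bessel => //; meas.
- exact: itbZ.
- apply: aeW => t; apply: cvgM; first exact: cvg_cst.
  exact: bessel_cvg.
- move=> N t; rewrite normrM mulrCA ler_wpM2l// /series/= big_mkord.
  apply: (le_trans (ler_norm_sum _ _ _)).
  exact: bessel_sum_le.
move=> _; under eq_fun do rewrite FE itg_sum//.
move=> H; apply: (cvgr_eq H).
have E m : itg (f m) = C * exp_coeff (- (Z / tau)) m.
  rewrite /f itgZ// mom /bessel_coeff /exp_coeff/=.
  have f0 : 0 < m`!%:R :> R by rewrite ltr0n fact_gt0.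
  have g1 : 0 < gam (nu + m%:R + 1) by have : 0 <= m%:R :> R by []; move=> ?; apply: gam_gt0; lra.
  have -> : (- (Z / tau)) ^+ m = (-1) ^+ m * Z ^+ m / tau ^+ m.
    by rewrite (exprNn (Z / tau)) expr_div_n mulrA.
  field.
  by rewrite !gt_eqF// exprn_gt0.
rewrite (_ : (fun N => _) = (fun N => C * series (exp_coeff (- (Z / tau))) N)); last first.
  apply/funext => N; rewrite /series/= big_mkord mulr_sumr.
  by apply: eq_bigr => i _; rewrite E.
apply: cvgM; first exact: cvg_cst.
exact: is_cvg_series_exp_coeff.
Qed.

End Bessel.

(** * Truncated powers and criteria for vanishing *)

Section CoreTools.
Context {R : realType}.
Local Notation mu := (@lebesgue_measure R).

Definition rpos (r : R) : R := (r + `|r|) / 2.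

Lemma rpos_ge r : 0 <= r -> rpos r = r.
Proof. by move=> r0; rewrite /rpos ger0_norm//; field. Qed.

Lemma rpos_le r : r <= 0 -> rpos r = 0.
Proof. by move=> r0; rewrite /rpos ler0_norm// subrr mul0r. Qed.

Lemma rpos_ge0 r : 0 <= rpos r.
Proof. by rewrite divr_ge0// -lerBlDl sub0r; have := ler_norm (- r); rewrite normrN. Qed.

Lemma mf_rpos d (T : measurableType d) (f : T -> R) : measurable_fun setT f ->
  measurable_fun setT (fun x => rpos (f x)).
Proof. by move=> mf; rewrite /rpos; meas. Qed.

Lemma rpos_continuous : continuous rpos.
Proof.
move=> x; apply: cvgM; last exact: cvg_cst.
by apply: cvgD; [exact: cvg_id|exact: norm_continuous].
Qed.

Lemma ae_neq (a : R) : {ae mu, forall x, x <> a}.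
Proof.
exists [set a]; split; first exact: measurable_set1.
  by rewrite lebesgue_measure_set1.
by move=> x /= /contrapT ->.
Qed.

(** The primitive of [H] is constant, and by Lebesgue differentiation its derivative is [H] almost
    everywhere. *)
Lemma interval_itg_eq0 (H : R -> R) : itb H ->
  (forall a b, a < b -> itg (fun x => if a < x < b then H x else 0) = 0) ->
  {ae mu, forall x, H x = 0}.
Proof.
move=> iH h.
have iHy (I : interval R) : mu.-integrable [set` I] (EFin \o H).
  by apply: (itb_cutoffE I H).1; exact: itb_cutoff.
have mH := itb_meas iH.
have locH : locally_integrable setT H.
  have := @integrable_locally_restrict R H setT measurableT iH.
  by congr (locally_integrable _ _); apply/funext => x; rewrite patchE in_setT.
have := @FTC1Ny R H (fun y => iHy `]-oo, y]) locH.
apply: aeS => x [dF <-].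
have FE y : (\int[mu]_(t in `]-oo, y]) H t) = (\int[mu]_(t in `]-oo, x]) H t).
  wlog xy : x y {dF} / x < y.
    by move=> W; have [/W//|/W//|->//] := ltgtP x y.
  apply/eqP; rewrite -subr_eq0; apply/eqP.
  rewrite Rintegral_itvB//; last by rewrite bnd_simp ltW.
  rewrite -[RHS](h x y xy) -Rintegral_itv_bndo_bndc//.
  by rewrite -itg_cutoff; congr itg; apply/funext => t.
rewrite (_ : (fun y => _) = cst (\int[mu]_(t in `]-oo, x]) H t)); last first.
  by apply/funext => y; rewrite FE.
by rewrite derive1_cst.
Qed.

(** Subtracting the constant term and dividing by [k] again gives a null sequence, of lower degree;
    once the higher coefficients vanish, the constant term equals the limit. *)
Lemma poly_cvg0 N (d : nat -> R) :
  \sum_(j < N) d j * k%:R ^+ j @[k --> \oo] --> 0 -> forall j, (j < N)%N -> d j = 0.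
Proof.
elim: N d => [//|N ih] d h.
have dS j : (j < N)%N -> d j.+1 = 0.
  apply: (ih (fun j => d j.+1)).
  rewrite -cvg_shiftS.
  have c1 : (k.+1%:R^-1 : R) @[k --> \oo] --> 0 by exact: cvg_harmonic.
  have c2 : (\sum_(j < N.+1) d j * k.+1%:R ^+ j - d 0%N) * k.+1%:R^-1 @[k --> \oo] --> (0 - d 0%N) * 0.
    apply: cvgM => //; apply: cvgB; last exact: cvg_cst.
    by rewrite (cvg_shiftS (fun k => \sum_(j < N.+1) d j * k%:R ^+ j)).
  have E : (fun k => (\sum_(j < N.+1) d j * k.+1%:R ^+ j - d 0%N) * k.+1%:R^-1) =
      (fun k => \sum_(j < N) d j.+1 * k.+1%:R ^+ j).
    apply/funext => k.
    rewrite big_ord_recl expr0 mulr1 addrC addKr mulr_suml; apply: eq_bigr => i _.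
    rewrite lift0 exprS; have : k.+1%:R != 0 :> R by rewrite pnatr_eq0.
    by move: (k.+1%:R : R) => c c0; field.
  by rewrite mulr0 E in c2.
case=> [_|j]; last by rewrite ltnS => /dS.
apply: (cvgr_eq _ h).
apply: cvg_near_cst; near=> k.
rewrite big_ord_recl expr0 mulr1 big1 ?addr0// => i _.
by rewrite lift0 dS ?mul0r.
Unshelve. all: by end_near. Qed.

Lemma rpos_moment (c s : R) : 0 < c -> 0 < s ->
  itb (fun t => rpos t `^ s * expR (- (c * t))) /\
  itg (fun t => rpos t `^ s * expR (- (c * t))) = c `^ (- (s + 1)) * gam (s + 1).
Proof.
move=> c0 s0; have [h1 h2] := powR_expN_moment_pos c 1 s c0 ltr01 (ltW s0).
have E : cutoff `]0, +oo[ (fun x => expR (- (c * x `^ 1)) * x `^ s) =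
  fun t => rpos t `^ s * expR (- (c * t)).
  apply/funext => t; rewrite /cutoff in_itv/= andbT; case: ltP => t0.
    by rewrite rpos_ge ?(ltW t0)// powRr1 ?(ltW t0)// mulrC.
  by rewrite rpos_le// powR0 ?mul0r// gt_eqF.
by rewrite -E; split=> //; rewrite h2 gamE !divr1 invr1 mul1r.
Qed.

(** Translation by [z] multiplies a two-sided Laplace transform by e^(c z). In this way the
    exponentials of [Z] in the transform of [g0] are traded for translates of one truncated
    power. *)
Lemma rpos_shift_moment (c z : R) P : 0 < c -> (0 < P)%N ->
  itg (fun r => rpos (r + z) ^+ P * expR (- (c * r))) = expR (c * z) * (c ^- P.+1 * gam P.+1%:R).
Proof.
move=> c0 P0; have P0' : 0 < P%:R :> R by rewrite ltr0n.
have [i1 e1] := rpos_moment c P%:R c0 P0'.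
pose G (t : R) := rpos t ^+ P * expR (- (c * t)).
have GE : G = fun t => rpos t `^ P%:R * expR (- (c * t)).
  by apply/funext => t; rewrite powR_mulrn// rpos_ge0.
have G0 t : 0 <= G t by rewrite mulr_ge0 ?exprn_ge0 ?rpos_ge0 ?expR_ge0.
have cG : continuous G.
  move=> t; apply: cvgM.
    apply: (@cvg_comp _ _ _ rpos (fun x => x ^+ P) _ (nbhs (rpos t))); last exact: exprn_continuous.
    exact: rpos_continuous.
  apply: (@cvg_comp _ _ _ (fun z : R => - (c * z)) expR _ (nbhs (- (c * t)))); last exact: continuous_expR.
  by apply: cvgN; apply: cvgM; [exact: cvg_cst|exact: cvg_id].
pose F (r : R) := r + z.
have dF (r : R) : is_derive r 1 F 1 by apply: is_derive_eq; rewrite addr0.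
have F'E : derive1 F = cst 1 by apply/funext => r; rewrite derive1E; case: (dF r).
have E : (\int[mu]_x (G x)%:E = \int[mu]_x (G (x + z))%:E)%E.
  rewrite (@increasing_ge0_integration_by_substitutionT _ F G)//.
  - by apply: eq_integral => r _; rewrite !fctE F'E/= mulr1.
  - by move=> x y xy; rewrite ltrD2r.
  - by rewrite F'E; move=> x; exact: cvg_cst.
  - by rewrite F'E; apply/cvg_ex; exists 1; exact: cvg_cst.
  - by rewrite F'E; apply/cvg_ex; exists 1; exact: cvg_cst.
  - exact: cvg_addrr_Ny.
  - exact: cvg_addrr.
rewrite (_ : (fun r => _) = (fun r => expR (c * z) * G (r + z))); last first.
  apply/funext => r; rewrite /G mulrCA -expRD; congr (_ * expR _).
  by ring.
have iG : itb G by rewrite GE.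
have iGz : itb (fun r => G (r + z)).
  apply: itb_ge0P => //.
    by apply: (measurableT_comp (itb_meas iG)); meas.
  by rewrite -E itgE// ltry.
rewrite itgZ//; congr (_ * _).
have -> : itg (fun r => G (r + z)) = itg G by rewrite /itg /Rintegral E.
rewrite GE e1; congr (_ * _); last by rewrite natr1.
by rewrite natr1 powR_invn// ltW.
Qed.

End CoreTools.

(** * From the relation [star] to the vanishing of the Laplace transform of [g0] *)

Section Core.
Context {R : realType}.
Local Notation mu := (@lebesgue_measure R).
Variables (Z g0 g1 : R -> R) (nu : R) (m : nat).
Hypotheses (nu_ge : - (1/2) <= nu) (m_gt0 : (0 < m)%N).
Hypotheses (mZ : measurable_fun setT Z) (mg0 : measurable_fun setT g0)
  (mg1 : measurable_fun setT g1).
Hypotheses (Z_ge0 : forall x, 0 <= Z x) (Z_gt0 : {ae mu, forall x, 0 < Z x}).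
Hypothesis ig0 : forall eta, 0 < eta -> itb (fun x => expR (- (eta * Z x)) * `|g0 x|).
Hypothesis ig1 : itb (fun x => (1 + Z x) ^- m * `|g1 x|).
Hypothesis star : forall tau, 0 < tau -> tau < 1 ->
  itg (fun x => g0 x * expR (- ((1 - tau) * Z x))) =
  tau `^ (- (nu + 1)) * itg (fun x => g1 x * expR (- (Z x / tau))).

(** The Bessel order is raised by [N = P + 1 = 2 m], since [bessel_pow_le] turns this into the decay
    (1 + y)^(-m) matching [ig1]; a truncated power of degree [P] has the transform P! / tau^N. *)
Let P := (2 * m).-1.
Let N := P.+1.

Let P_gt0 : (0 < P)%N. Proof. by rewrite /P; case: m m_gt0 => // k _; rewrite mulnS. Qed.

Let NE : N = (2 * m)%N. Proof. by rewrite /N /P prednK// muln_gt0. Qed.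

(** For [r > 0] the decay in [r] comes from [tau]. For [r <= 0] the kernel lives on r + z > 0, where
    e^(-z) also controls [r], so any [tau < 1] is allowed, negative ones included; [laplace_poly]
    takes [tau = - p] with [p] arbitrarily large. *)
Let kern_le (tau eps : R) : 0 < eps -> 2 * eps <= 1 -> 2 * eps <= 1 - tau ->
  exists2 K, 0 <= K & forall r z : R, 0 <= z -> (r <= 0 \/ 2 * eps <= tau) ->
  rpos (r + z) ^+ P * expR (- (tau * r)) * expR (- z) <=
  K * expR (- (eps * `|r|)) * expR (- (eps * z)).
Proof.
move=> e0 e1 e2; exists (P`!%:R / eps ^+ P).
  by rewrite divr_ge0// exprn_ge0// ltW.
move=> r z z0 hr.
have K0 : 0 <= P`!%:R / eps ^+ P by rewrite divr_ge0// exprn_ge0// ltW.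
have [t0|t0] := leP (r + z) 0.
  rewrite rpos_le// expr0n gtn_eqF// !mul0r.
  by apply: mulr_ge0; [apply: mulr_ge0|]; rewrite ?expR_ge0.
rewrite (rpos_ge _ (ltW t0)).
move: (P`!%:R / eps ^+ P) K0 (pow_le_exp eps (r + z) P e0 (ltW t0)) => K K0 q.
apply: (@le_trans _ _ (K * expR (eps * (r + z)) * expR (- (tau * r)) * expR (- z))).
  by rewrite !ler_wpM2r ?expR_ge0.
rewrite -!mulrA ler_wpM2l// -!expRD ler_expR.
have [r0|r0] := leP 0 r.
  rewrite (ger0_norm r0); case: hr => [hr|hr].
    have -> : r = 0 by apply/eqP; rewrite eq_le hr.
    have h2 : 0 <= (1 - 2 * eps) * z by rewrite mulr_ge0// subr_ge0.
    by lra.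
  have h1 : 0 <= (tau - 2 * eps) * r by rewrite mulr_ge0// subr_ge0.
  have h2 : 0 <= (1 - 2 * eps) * z by rewrite mulr_ge0// subr_ge0.
  by lra.
rewrite (ltr0_norm r0).
have [tau0|tau0] := leP 0 tau.
  have h1 : 0 <= tau * (r + z) by rewrite mulr_ge0// ltW.
  have h2 : 0 <= (1 - tau - 2 * eps) * z by rewrite mulr_ge0// subr_ge0.
  by lra.
have h1 : 0 <= tau * r by rewrite mulr_le0// ltW.
have h2 : 0 <= (1 - 2 * eps) * z by rewrite mulr_ge0// subr_ge0.
by lra.
Qed.

(** Designed so that its Laplace transform at [tau] is the left side of [star] times gam N /
    tau^N. *)
Let A (r : R) : R := itg (fun x => rpos (r + Z x) ^+ P * expR (- Z x) * g0 x).

Let A_laplace (tau : R) : 0 < tau -> tau < 1 ->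
  itb (fun r => expR (- (tau * r)) * A r) /\
  itg (fun r => expR (- (tau * r)) * A r) =
    tau ^- N * gam N%:R * itg (fun x => g0 x * expR (- ((1 - tau) * Z x))).
Proof.
move=> t0 t1.
have [eps [e0 e1 e2 e3]] : exists eps, [/\ 0 < eps, 2 * eps <= 1, 2 * eps <= 1 - tau & 2 * eps <= tau].
  have [h|h] := leP tau (1 - tau); first by exists (tau / 2); split; lra.
  by exists ((1 - tau) / 2); split; lra.
have [K K0 hK] := kern_le tau eps e0 e1 e2.
pose F (z : R * R) := expR (- (tau * z.1)) * (rpos (z.1 + Z z.2) ^+ P * expR (- Z z.2) * g0 z.2).
have mF : measurable_fun setT F by apply: measurable_funM => //; meas.
have FB r x : `|F (r, x)| <= K * expR (- (eps * `|r|)) * (expR (- (eps * Z x)) * `|g0 x|).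
  rewrite /F/= !normrM !(ger0_norm (expR_ge0 _)) normrX (ger0_norm (rpos_ge0 _)) [leRHS]mulrA.
  rewrite !mulrA ler_wpM2r// (mulrC (expR (- (tau * r)))).
  by apply: hK => //; right.
have iE := itbZ K (itb_expN_norm eps e0).
have ie := ig0 _ e0.
have E1 : (fun r => itg (fun x => F (r, x))) = fun r => expR (- (tau * r)) * A r.
  apply/funext => r; rewrite /A -itgZ//.
  apply: (itb_le (fun x => expR (tau * r) * (K * expR (- (eps * `|r|))) * (expR (- (eps * Z x)) * `|g0 x|))).
  - apply: measurable_funM => //; apply: measurable_funM; last by meas.
    by apply: measurable_funX; apply: mf_rpos; meas.
  - exact: itbZ.
  - move=> x; have := FB r x; rewrite /F/= normrM (ger0_norm (expR_ge0 _)) => h.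
    rewrite -[leRHS]mulrA -ler_pdivrMl ?expR_gt0// -expRN; exact: h.
have E2 : (fun x => itg (fun r => F (r, x))) =
   fun x => tau ^- N * gam N%:R * (g0 x * expR (- ((1 - tau) * Z x))).
  apply/funext => x.
  rewrite (_ : (fun r => F (r, x)) = fun r => expR (- Z x) * g0 x * (rpos (r + Z x) ^+ P * expR (- (tau * r)))); last first.
    by apply/funext => r; rewrite /F/=; ring.
  rewrite itgZ; last first.
    apply: (itb_le (fun r => (expR (- (eps * Z x)) * expR (Z x)) * (K * expR (- (eps * `|r|))))).
    - by apply: measurable_funM; [apply: measurable_funX; apply: mf_rpos; meas|meas].
    - exact: itbZ.
    - move=> r; rewrite ger0_norm; last by rewrite mulr_ge0 ?exprn_ge0 ?rpos_ge0 ?expR_ge0.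
      rewrite (mulrC (expR (- (eps * Z x)))) -mulrA -ler_pdivrMl ?expR_gt0// -expRN mulrC [leRHS]mulrC.
      by apply: hK => //; right.
  rewrite rpos_shift_moment// (_ : - ((1 - tau) * Z x) = - Z x + tau * Z x); last by ring.
  by rewrite expRD; ring.
split.
  by rewrite -E1; exact: (itb_fubini F _ _ mF iE ie FB).
have := itg_fubini F _ _ mF iE ie FB; rewrite E1 E2 => ->.
rewrite itgZ//.
have t1' : 0 < 1 - tau by rewrite subr_gt0.
apply: (itb_le _ _ (ig0 _ t1')); first by meas.
by move=> x; rewrite normrM mulrC (ger0_norm (expR_ge0 _)).
Qed.

Let numN : - (1/2) <= nu + N%:R.
Proof. by apply: (le_trans nu_ge); rewrite lerDl. Qed.

Let nuN_gt0 : 0 < nu + N%:R.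
Proof. have h : 1 <= N%:R :> R by rewrite ler1n. by move: nu_ge h; move: N%:R => z; lra. Qed.

Let bessel_decay : exists2 K, 0 <= K &
  forall y, 0 <= y -> `|bessel (nu + N%:R) y| <= K * (1 + y) ^- m.
Proof.
have [K1 K10 h1] := bessel_pow_le nu N nu_ge.
have K00 : 0 <= (gam (nu + N%:R + 1))^-1 by rewrite invr_ge0 ltW// gam_gt0//; have := nuN_gt0; lra.
exists (2 ^+ m * ((gam (nu + N%:R + 1))^-1 + K1)).
  by rewrite mulr_ge0 ?exprn_ge0 ?addr_ge0.
move=> y y0; have y1 : 0 < 1 + y by lra.
rewrite ler_pdivlMr ?exprn_gt0//.
have b0 := bessel_le _ _ numN y0.
have b1 : y ^+ m * `|bessel (nu + N%:R) y| <= K1.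
  have := h1 (Num.sqrt y) (sqrtr_ge0 y).
  by rewrite sqr_sqrtr// NE exprM sqr_sqrtr.
apply: (@le_trans _ _ (2 ^+ m * (1 + y ^+ m) * `|bessel (nu + N%:R) y|)).
  rewrite mulrC ler_wpM2r//.
  have [yl|yl] := leP y 1.
    apply: (@le_trans _ _ (2 ^+ m)).
      by rewrite lerXn2r ?nnegrE//; lra.
    by rewrite ler_peMr ?exprn_ge0// lerDl exprn_ge0.
  apply: (@le_trans _ _ ((2 * y) ^+ m)).
    by rewrite lerXn2r ?nnegrE//; lra.
  by rewrite exprMn ler_wpM2l ?exprn_ge0// lerDr.
rewrite -mulrA ler_wpM2l ?exprn_ge0// mulrDl mul1r.
by apply: lerD.
Qed.

(** For fixed [Z], the function r^(nu+N) bessel (nu+N) (Z r) on r > 0 is the inverse Laplace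
    transform of tau^(-(nu+N+1)) e^(-Z/tau). The right side of [star] thereby becomes the transform
    of a function carried by the positive half-line. *)
Let Om (r : R) : R := itg (fun x => rpos r `^ (nu + N%:R) * bessel (nu + N%:R) (Z x * rpos r) * g1 x).

Let Om_le0 r : r <= 0 -> Om r = 0.
Proof.
move=> r0; rewrite -[RHS]itg0; congr itg; apply/funext => x.
by rewrite rpos_le// powR0 ?mul0r// gt_eqF.
Qed.

Let Om_laplace (tau : R) : 0 < tau ->
  itb (fun r => expR (- (tau * r)) * Om r) /\
  itg (fun r => expR (- (tau * r)) * Om r) =
    tau `^ (- (nu + N%:R + 1)) * itg (fun x => g1 x * expR (- (Z x / tau))).
Proof.
move=> t0; have [K K0 hK] := bessel_decay.
have num0 : 0 < nu + m%:R.
  have h : 1 <= m%:R :> R by rewrite ler1n.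
  by move: nu_ge h; move: m%:R => z; lra.
have t4 : 0 < tau / 4 by lra.
have [K2 K20 h2] := powR_le_exp (nu + m%:R) (tau / 4) (ltW num0) t4.
pose b (r : R) := rpos r `^ (nu + m%:R) * (1 + rpos r) ^+ m * expR (- (tau * r)).
have mb : measurable_fun setT b.
  rewrite /b; apply: measurable_funM; last by meas.
  apply: measurable_funM; first by apply: mf_powR; apply: mf_rpos; meas.
  by apply: measurable_funX; apply: measurable_funD; [meas|apply: mf_rpos; meas].
have b0 r : 0 <= b r.
  by rewrite !mulr_ge0 ?powR_ge0 ?expR_ge0 ?exprn_ge0// addr_ge0// rpos_ge0.
have ib : itb b.
  have t2 : 0 < tau / 2 by lra.
  pose K3 := K2 * (m`!%:R / (tau / 4) ^+ m * expR (tau / 4)).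
  have K30 : 0 <= K3.
    by rewrite !mulr_ge0 ?(ltW K20)// ?expR_ge0 ?invr_ge0 ?exprn_ge0// ltW.
  apply: (itb_le _ mb (itbZ K3 (itb_expN (tau / 2) t2))) => r.
  rewrite ger0_norm// /b /cutoff in_itv/= andbT; have [r0|r0] := leP 0 r; last first.
    by rewrite (rpos_le _ (ltW r0)) powR0 ?gt_eqF// !mul0r mulr0.
  rewrite rpos_ge//.
  have r1 : 0 <= 1 + r by lra.
  have q1 := pow_le_exp (tau / 4) (1 + r) m t4 r1.
  apply: (@le_trans _ _ (K2 * expR (tau / 4 * r) * (m`!%:R / (tau / 4) ^+ m * expR (tau / 4 * (1 + r))) * expR (- (tau * r)))).
    by rewrite ler_wpM2r ?expR_ge0// ler_pM ?powR_ge0 ?exprn_ge0// h2.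
  rewrite (_ : tau / 4 * (1 + r) = tau / 4 + tau / 4 * r); last by ring.
  rewrite (_ : - (tau / 2 * r) = tau / 4 * r + tau / 4 * r - tau * r); last by field.
  by rewrite /K3 !expRD le_eqVlt; apply/orP; left; apply/eqP; ring.
pose F (z : R * R) := expR (- (tau * z.1)) *
  (rpos z.1 `^ (nu + N%:R) * bessel (nu + N%:R) (Z z.2 * rpos z.1) * g1 z.2).
have mr1 : measurable_fun setT (fun z : R * R => rpos z.1) by apply: mf_rpos; meas.
have mF : measurable_fun setT F.
  apply: measurable_funM; first by meas.
  apply: measurable_funM; last by meas.
  apply: measurable_funM; first by meas.
  by apply: mf_bessel => //; meas.
have FB r x : `|F (r, x)| <= (K * b r) * ((1 + Z x) ^- m * `|g1 x|).
  rewrite /F/= !normrM (ger0_norm (expR_ge0 _)) (ger0_norm (powR_ge0 _ _)).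
  have z1 : 0 < 1 + Z x by have := Z_ge0 x; lra.
  have [r0|r0] := leP r 0.
    rewrite (rpos_le _ r0) powR0 ?(gt_eqF nuN_gt0)// !mul0r mulr0.
    apply: mulr_ge0; first exact: mulr_ge0.
    by apply: mulr_ge0 => //; rewrite invr_ge0 exprn_ge0// ltW.
  rewrite /b rpos_ge ?(ltW r0)// [leRHS]mulrA 2!mulrA ler_wpM2r//.
  have rz : 0 <= Z x * r by rewrite mulr_ge0 ?Z_ge0 ?ltW.
  have z2 : 0 < 1 + Z x * r by lra.
  rewrite -[leLHS]mulrA; apply: (@le_trans _ _ (expR (- (tau * r)) * (r `^ (nu + N%:R) * (K * (1 + Z x * r) ^- m)))).
    by rewrite !ler_wpM2l ?expR_ge0 ?powR_ge0// hK.
  (* Since N = 2m, [m] powers of [r] can be spent on r / (1 + Z r) <= (1 + r) / (1 + Z), which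
     exchanges decay in Z r for decay in Z and separates the variables. *)
  have -> : r `^ (nu + N%:R) = r `^ (nu + m%:R) * r ^+ m.
    rewrite -powR_mulrn ?(ltW r0)// -powRD ?(gt_eqF r0) ?implybT//.
    by rewrite NE natrM; congr powR; ring.
  rewrite [leLHS](_ : _ = K * r `^ (nu + m%:R) * expR (- (tau * r)) * (r ^+ m * (1 + Z x * r) ^- m)); last by ring.
  rewrite [leRHS](_ : _ = K * r `^ (nu + m%:R) * expR (- (tau * r)) * ((1 + r) ^+ m * (1 + Z x) ^- m)); last by ring.
  rewrite ler_wpM2l ?mulr_ge0 ?expR_ge0 ?powR_ge0//.
  have r1 : 0 <= 1 + r by lra.
  rewrite -!exprVn -!exprMn; apply: lerXn2r; rewrite ?nnegrE.
  - by apply: divr_ge0; exact: ltW.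
  - by apply: divr_ge0 => //; exact: ltW.
  rewrite ler_pdivrMr// mulrAC ler_pdivlMr//.
  by have := Z_ge0 x; nra.
have E1 : (fun r => itg (fun x => F (r, x))) = fun r => expR (- (tau * r)) * Om r.
  apply/funext => r; rewrite /Om -itgZ//.
  apply: (itb_le (fun x => expR (tau * r) * (K * b r) * ((1 + Z x) ^- m * `|g1 x|))).
  - apply: measurable_funM => //; apply: measurable_funM => //.
    by apply: mf_bessel => //; meas.
  - exact: itbZ.
  - move=> x; have := FB r x; rewrite /F/= normrM (ger0_norm (expR_ge0 _)) => h.
    rewrite -[leRHS]mulrA -ler_pdivrMl ?expR_gt0// -expRN; exact: h.
have mrp : measurable_fun setT (@rpos R) by apply: (mf_rpos _ _ (fun x : R => x)); meas.
have E2 : (fun x => itg (fun r => F (r, x))) =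
   fun x => tau `^ (- (nu + N%:R + 1)) * (g1 x * expR (- (Z x / tau))).
  apply/funext => x.
  pose v (r : R) := rpos r `^ (nu + N%:R) * expR (- (tau * r)).
  have mv : measurable_fun setT v by rewrite /v; meas.
  have v0 r : 0 <= v r by rewrite mulr_ge0 ?powR_ge0 ?expR_ge0.
  have mom j : itb (fun t => v t * rpos t ^+ j) /\
      itg (fun t => v t * rpos t ^+ j) =
    tau `^ (- (nu + N%:R + 1)) * gam (nu + N%:R + j%:R + 1) / tau ^+ j.
    have s0 : 0 < nu + N%:R + j%:R by have : 0 <= j%:R :> R by []; have := nuN_gt0; lra.
    have [i1 e1] := rpos_moment tau _ t0 s0.
    have E : (fun t => v t * rpos t ^+ j) = fun t => rpos t `^ (nu + N%:R + j%:R) * expR (- (tau * t)).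
      apply/funext => t; rewrite /v mulrAC; congr (_ * _).
      have [tt|tt] := leP t 0.
        by rewrite (rpos_le _ tt) !powR0 ?mul0r// gt_eqF.
      rewrite (rpos_ge _ (ltW tt)) -powR_mulrn ?(ltW tt)// -powRD//.
      by rewrite (gt_eqF tt) implybT.
    rewrite E; split=> //; rewrite e1 mulrAC; congr (_ * _).
    rewrite -powR_invn ?(ltW t0)// -powRD ?(gt_eqF t0) ?implybT//.
    by congr powR; ring.
  have t2 : 0 < tau / 2 by lra.
  have iv : itb (fun t => `|v t| * expR (tau / 2 * rpos t)).
    have [i1 _] := rpos_moment (tau / 2) _ t2 nuN_gt0.
    apply: (itb_le _ _ i1); first by meas.
    move=> t; rewrite ger0_norm ?mulr_ge0 ?expR_ge0// ger0_norm// /v -[leLHS]mulrA -expRD.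
    have [tt|tt] := leP t 0.
      by rewrite (rpos_le _ tt) !powR0 ?mul0r// gt_eqF.
    by rewrite (rpos_ge _ (ltW tt)) ler_wpM2l ?powR_ge0// ler_expR; lra.
  have L := laplace_bessel _ _ _ _ _ v rpos numN t0 t2 (Z_ge0 x) mv mrp rpos_ge0 iv (fun j => proj2 (mom j)).
  rewrite (_ : (fun r => F (r, x)) = fun r => g1 x * (v r * bessel (nu + N%:R) (Z x * rpos r))); last first.
    by apply/funext => r; rewrite /F /v/=; ring.
  rewrite itgZ; first by rewrite L; ring.
  have [i0 _] := mom 0%N.
  have z1 : 0 < 1 + Z x by have := Z_ge0 x; lra.
  apply: (itb_le _ _ (itbZ (K) i0)); first by apply: measurable_funM => //; apply: mf_bessel => //; meas.
  move=> r; rewrite expr0 mulr1 normrM (ger0_norm (v0 r)) mulrC ler_wpM2r//.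
  have rz : 0 <= Z x * rpos r by rewrite mulr_ge0 ?Z_ge0 ?rpos_ge0.
  apply: (le_trans (hK _ rz)); rewrite ler_piMr// invf_le1 ?exprn_gt0//; last by lra.
  by rewrite exprn_ege1//; lra.
have iK := itbZ K ib.
split.
  by rewrite -E1; exact: (itb_fubini F _ _ mF iK ig1 FB).
have := itg_fubini F _ _ mF iK ig1 FB; rewrite E1 E2 => ->.
rewrite itgZ//.
have [K4 K40 h4] : exists2 K4, 0 <= K4 & forall z, 0 <= z -> expR (- (z / tau)) <= K4 * (1 + z) ^- m.
  exists (m`!%:R / (tau^-1) ^+ m * expR tau^-1).
    by rewrite mulr_ge0 ?expR_ge0 ?divr_ge0 ?exprn_ge0 ?invr_ge0 ?ltW.
  move=> z z0; rewrite ler_pdivlMr ?exprn_gt0//; last by lra.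
  have z1 : 0 <= 1 + z by lra.
  have ti : 0 < tau^-1 by rewrite invr_gt0.
  have := pow_le_exp (tau^-1) (1 + z) m ti z1.
  rewrite mulrDr mulr1 expRD mulrA => h; rewrite expRN mulrC ler_pdivrMr ?expR_gt0//.
  by rewrite (mulrC z).
apply: (itb_le _ _ (itbZ K4 ig1)); first by meas.
move=> x; rewrite normrM (ger0_norm (expR_ge0 _)) mulrC mulrA ler_wpM2r//.
exact: h4.
Qed.


(** By [star] the functions [A] and [gam N * Om] have the same Laplace transform on (0, 1), so they
    agree almost everywhere, and [Om] vanishes for negative [r]. *)
Lemma A_ae0 : {ae mu, forall r, r < 0 -> A r = 0}.
Proof.
pose L r := A r - gam N%:R * Om r.
have iL tau : 0 < tau -> tau < 1 -> itb (fun r => expR (- (tau * r)) * L r) /\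
    itg (fun r => expR (- (tau * r)) * L r) = 0.
  move=> t0 t1; have [a1 a2] := A_laplace tau t0 t1.
  have [b1 b2] := Om_laplace tau t0.
  have E : (fun r => expR (- (tau * r)) * L r) =
     fun r => expR (- (tau * r)) * A r - gam N%:R * (expR (- (tau * r)) * Om r).
    by apply/funext => r; rewrite /L; ring.
  rewrite E; split; first by apply: itbB => //; exact: itbZ.
  rewrite itgB//; last exact: itbZ.
  rewrite itgZ// a2 b2 (star tau t0 t1).
  have -> : tau `^ (- (nu + N%:R + 1)) = tau ^- N * tau `^ (- (nu + 1)).
    rewrite -powR_invn ?(ltW t0)// -powRD; last by rewrite (gt_eqF t0) implybT.
    by congr powR; ring.
  by ring.
(* The tilt centres the interval (0, 1) at 0, as [laplace_inj] requires. With [rho = 1/4] the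
   majorant consists of the integrands at the rates 1/4 and 3/4, one for each sign of [r]. *)
pose G r := expR (- (1/2 * r)) * L r.
have [i1 _] := iL (1/4) ltac:(lra) ltac:(lra).
have [iG _] := iL (1/2) ltac:(lra) ltac:(lra).
have [i3 _] := iL (3/4) ltac:(lra) ltac:(lra).
have G0 a b : a < b -> itg (fun x => if a < x < b then G x else 0) = 0.
  move=> ab; apply: (laplace_inj (fun x => x) G (1/4)) => //.
  - exact: itb_meas iG.
  - apply: (itb_le _ _ (itbD (itb_norm i1) (itb_norm i3))).
      by have := itb_meas iG => mG; meas.
    move=> r; rewrite normrM normr_id (ger0_norm (expR_ge0 _)) /G !normrM !(ger0_norm (expR_ge0 _)).
    rewrite mulrA -expRD; have [r0|r0] := leP 0 r.
      rewrite (ger0_norm r0) (_ : 1/4 * r - 1/2 * r = - (1/4 * r)); last by field.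
      by rewrite lerDl mulr_ge0 ?expR_ge0.
    rewrite (ltr0_norm r0) (_ : 1/4 * - r - 1/2 * r = - (3/4 * r)); last by field.
    by rewrite lerDr mulr_ge0 ?expR_ge0.
  - move=> t; rewrite ltr_norml => /andP[ta tb].
    have [_ <-] := iL (1/2 - t) ltac:(lra) ltac:(lra).
    congr itg; apply/funext => x; rewrite /G mulrA -expRD; congr (expR _ * _).
    by ring.
  - by move=> c; exact: ae_neq.
have := interval_itg_eq0 G iG G0; apply: aeS => r Gr r0.
move: Gr; rewrite /G /L (Om_le0 _ (ltW r0)) mulr0 subr0 => /eqP.
by rewrite mulf_eq0 expR_eq0/= => /eqP.
Qed.

Lemma is_derive_powD (z r : R) j :
  is_derive r 1 (fun y : R => (z + y) ^+ j) (j%:R * (z + r) ^+ j.-1).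
Proof.
elim: j => [|j ih].
  rewrite mul0r (_ : (fun y => _) = cst 1); last by apply/funext => y; rewrite expr0.
  exact: is_derive_cst.
pose V (y : R) := (z + y) ^+ j.
have dV : is_derive r 1 V (j%:R * (z + r) ^+ j.-1) by exact: ih.
rewrite (_ : (fun y => _) = (fun y => (z + y) * V y)); last first.
  by apply/funext => y; rewrite exprS.
apply: is_derive_eq; rewrite ?(scaler0, add0r, addr0) /GRing.scale/= /V -natr1.
by case: j {ih V dV} => [|j]; rewrite /= ?exprS ?expr0; ring.
Qed.

(** The sum is the Taylor polynomial of e^(-p(z+r)), so differentiating the product telescopes and
    only the term of top degree survives. *)
Lemma is_derive_exp_taylor (p z : R) k (r : R) : is_derive r 1
  (fun r => expR (p * r) * \sum_(j < k.+1) (- p * (z + r)) ^+ j / j`!%:R)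
  (- ((- p) ^+ k.+1 * (z + r) ^+ k / k`!%:R * expR (p * r))).
Proof.
elim: k => [|k ih].
  rewrite (_ : (fun r => _) = (fun r => expR (p * r))); last first.
    by apply/funext => y; rewrite big_ord1 expr0 fact0 divr1 mulr1.
  apply: is_derive_eq; rewrite ?(scaler0, addr0, add0r) /GRing.scale/= fact0 expr0 expr1.
  by field.
pose T (y : R) := expR (p * y) * \sum_(j < k.+1) (- p * (z + y)) ^+ j / j`!%:R.
have dT : is_derive r 1 T (- ((- p) ^+ k.+1 * (z + r) ^+ k / k`!%:R * expR (p * r))) by exact: ih.
pose V (y : R) := (z + y) ^+ k.+1.
have dV : is_derive r 1 V (k.+1%:R * (z + r) ^+ k) by exact: is_derive_powD.
rewrite (_ : (fun r => _) = (fun r => T r + expR (p * r) * ((- p) ^+ k.+1 / k.+1`!%:R * V r))); last first.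
  apply/funext => y; rewrite big_ord_recr/= mulrDr; congr (_ + _ * _).
  by rewrite exprMn /V; ring.
have f0 : k`!%:R != 0 :> R by rewrite pnatr_eq0 gtn_eqF// fact_gt0.
have k0 : k.+1%:R != 0 :> R by rewrite pnatr_eq0.
apply: is_derive_eq.
rewrite ?(scaler0, add0r, addr0) /GRing.scale/= factS natrM /V !exprS.
move: k0; move: (k.+1%:R : R) => c c0.
by field; rewrite f0 c0.
Qed.

(** Taylor's formula with integral remainder for e^(-p z): the truncated power restricted to
    [r <= 0] is precisely the remainder kernel. *)
Lemma exp_taylor_itg (p z : R) : 0 <= z ->
  itg (fun r => (if r <= 0 then 1 else 0) * (expR (p * r) * rpos (r + z) ^+ P)) *
    ((- p) ^+ N / P`!%:R) =
  expR (- (p * z)) - \sum_(j < N) (- p * z) ^+ j / j`!%:R.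
Proof.
move=> z0.
have s0 : \sum_(j < N) (- p * 0) ^+ j / j`!%:R = 1 :> R.
  rewrite big_ord_recl expr0 fact0 divr1 big1 ?addr0// => i _.
  by rewrite lift0 mulr0 exprS !mul0r.
have [->|zn0] := eqVneq z 0.
  rewrite s0 mulr0 oppr0 expR0 subrr (_ : (fun r => _) = fun=> 0) ?itg0 ?mul0r//.
  apply/funext => r; case: ifPn => r0; last by rewrite mul0r.
  by rewrite addr0 (rpos_le _ r0) expr0n gtn_eqF// !mulr0.
have zp : 0 < z by rewrite lt_neqAle eq_sym zn0.
pose f (r : R) := - ((- p) ^+ N * (z + r) ^+ P / P`!%:R * expR (p * r)).
have [|i e] := FTCc (- z) 0 f _ ltac:(by rewrite oppr_lt0) _ (is_derive_exp_taylor p z P).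
  move=> y; apply: cvgN; apply: cvgM; last first.
    apply: (@cvg_comp _ _ _ (fun t : R => p * t) expR _ (nbhs (p * y))); last exact: continuous_expR.
    by apply: cvgM; [exact: cvg_cst|exact: cvg_id].
  apply: cvgM; last exact: cvg_cst.
  apply: cvgM; first exact: cvg_cst.
  apply: (@cvg_comp _ _ _ (fun t : R => z + t) (fun t => t ^+ P) _ (nbhs (z + y))); last exact: exprn_continuous.
  by apply: cvgD; [exact: cvg_cst|exact: cvg_id].
have {e} := e; rewrite mulr0 expR0 mul1r addr0 subrr s0 mulr1 mulrN => e.
rewrite -[RHS]opprB -e mulrC -itgZ.
  rewrite -itgN//; congr itg; apply/funext => r; rewrite /cutoff in_itv/=.
  have [r0|r0] := leP r 0; last by rewrite andbF mul0r mulr0 oppr0.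
  rewrite andbT mul1r; have [rz|rz] := leP (- z) r.
    have rz' : 0 <= r + z by lra.
    by rewrite /f (rpos_ge _ rz') opprK (addrC z); ring.
  have rz' : r + z <= 0 by lra.
  by rewrite (rpos_le _ rz') expr0n gtn_eqF// !mulr0 oppr0.
pose K := z ^+ P * expR (`|p| * z).
have iI : itb (cutoff `[- z, 0] (fun=> K)).
  have [||//] := FTCc (- z) 0 (fun=> K) (fun y => K * y) ltac:(by rewrite oppr_lt0).
    by move=> y; exact: cvg_cst.
  by move=> y; apply: is_derive_eq; rewrite ?(scaler0, add0r, addr0) /GRing.scale/= ?mulr1.
apply: (itb_le _ _ iI).
  apply: measurable_funM.
    by apply: mf_if => //; apply: measurable_fun_ler => //; meas.
  by apply: measurable_funM; [meas|apply: measurable_funX; apply: mf_rpos; meas].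
move=> r; rewrite /cutoff in_itv/=; have [r0|r0] := leP r 0; last first.
  by rewrite mul0r normr0 andbF.
rewrite mul1r andbT normrM (ger0_norm (expR_ge0 _)) normrX (ger0_norm (rpos_ge0 _)).
have [rz|rz] := leP (- z) r; last first.
  have rz' : r + z <= 0 by lra.
  by rewrite (rpos_le _ rz') expr0n gtn_eqF// mulr0.
have rz' : 0 <= r + z by lra.
rewrite (rpos_ge _ rz') /K mulrC ler_pM ?exprn_ge0 ?expR_ge0//.
  by rewrite lerXn2r ?nnegrE//; lra.
rewrite ler_expR (le_trans (ler_norm _))// normrM ler_wpM2l// ler0_norm//; lra.
Qed.

Lemma ig0_pow j eta : 0 < eta -> itb (fun x => Z x ^+ j * expR (- (eta * Z x)) * g0 x).
Proof.
move=> e0; have e2 : 0 < eta / 2 by lra.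
apply: (itb_le _ _ (itbZ (j`!%:R / (eta / 2) ^+ j) (ig0 _ e2))); first by meas.
move=> x; rewrite !normrM normrX (ger0_norm (Z_ge0 x)) (ger0_norm (expR_ge0 _)).
rewrite [leRHS]mulrA ler_wpM2r//.
have h := pow_le_exp (eta / 2) (Z x) j e2 (Z_ge0 x).
apply: (le_trans (ler_wpM2r (expR_ge0 _) h)); rewrite -[leLHS]mulrA -expRD.
by rewrite (_ : eta / 2 * Z x - eta * Z x = - (eta / 2 * Z x))//; field.
Qed.

(** [A r] times e^(p r) integrates to 0 over r <= 0 by [A_ae0]. Exchanging the integrals turns this
    into the statement that the Taylor remainder of e^(-p Z) integrates to 0. While [star] concerns
    only rates in (0, 1), all rates 1 + p > 0 are reached here. *)
Lemma laplace_poly p : - 1 < p ->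
  itg (fun x => g0 x * expR (- ((1 + p) * Z x))) =
  \sum_(j < N) (- p) ^+ j / j`!%:R * itg (fun x => Z x ^+ j * expR (- (1 * Z x)) * g0 x).
Proof.
move=> p1.
have [eps [e0 e1 e2]] : exists eps, [/\ 0 < eps, 2 * eps <= 1 & 2 * eps <= 1 - - p].
  have [h|h] := leP 0 p; first by exists (1 / 2); split; lra.
  by exists ((1 + p) / 2); split; lra.
have [K K0 hK] := kern_le (- p) eps e0 e1 e2.
pose I (r : R) : R := if r <= 0 then 1 else 0.
have mI : measurable_fun setT I.
  by apply: mf_if => //; apply: measurable_fun_ler => //; meas.
have I01 r : 0 <= I r by rewrite /I; case: ifP.
pose F (z : R * R) := I z.1 * expR (p * z.1) * (rpos (z.1 + Z z.2) ^+ P * expR (- Z z.2) * g0 z.2).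
have mF : measurable_fun setT F by apply: measurable_funM => //; meas.
have FB r x : `|F (r, x)| <= K * expR (- (eps * `|r|)) * (expR (- (eps * Z x)) * `|g0 x|).
  rewrite /F/= /I; have [r0|r0] := leP r 0; last first.
    rewrite !mul0r normr0; apply: mulr_ge0; first by rewrite mulr_ge0 ?expR_ge0.
    by rewrite mulr_ge0 ?expR_ge0.
  rewrite mul1r !normrM !(ger0_norm (expR_ge0 _)) normrX (ger0_norm (rpos_ge0 _)) [leRHS]mulrA.
  rewrite !mulrA ler_wpM2r// (mulrC (expR (p * r))).
  have := hK r (Z x) (Z_ge0 x) (or_introl r0).
  by rewrite mulNr opprK.
have iE := itbZ K (itb_expN_norm eps e0).
have ie := ig0 _ e0.
have E1 : itg (fun r => itg (fun x => F (r, x))) = 0.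
  rewrite -[RHS]itg0; apply: ae_itg => //.
    exact: (itb_meas (itb_fubini F _ _ mF iE ie FB)).
  apply: aeS2 A_ae0 (ae_neq 0) => r Ar rn0.
  have [r0|r0] := leP r 0; last first.
    rewrite -[RHS]itg0; congr itg; apply/funext => x.
    by rewrite /F/= /I leNgt r0 !mul0r.
  have {}r0 : r < 0 by rewrite lt_neqAle r0 andbT; apply/eqP.
  rewrite /F/= itgZ; first by rewrite -/(A r) Ar// mulr0.
  have tau1 : 0 < 1/4 :> R by lra.
  have [K' K0' hK'] := kern_le (1/2) (1/4) tau1 ltac:(lra) ltac:(lra).
  apply: (itb_le _ _ (itbZ (expR (1/2 * r) * (K' * expR (- (1/4 * `|r|)))) (ig0 _ tau1))).
    apply: measurable_funM => //; apply: measurable_funM; last by meas.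
    by apply: measurable_funX; apply: mf_rpos; meas.
  move=> x; rewrite !normrM normrX (ger0_norm (rpos_ge0 _)) (ger0_norm (expR_ge0 _)).
  rewrite [leRHS]mulrA ler_wpM2r//.
  have := hK' r (Z x) (Z_ge0 x) (or_introl (ltW r0)).
  rewrite (mulrAC (rpos _ ^+ _)) => h.
  have -> : rpos (r + Z x) ^+ P * expR (- Z x) =
      (rpos (r + Z x) ^+ P * expR (- Z x) * expR (- (1/2 * r))) * expR (1/2 * r).
    by rewrite -[RHS]mulrA -expRD addNr expR0 mulr1.
  rewrite [leRHS](_ : _ = (K' * expR (- (1/4 * `|r|)) * expR (- (1/4 * Z x))) * expR (1/2 * r)); last by ring.
  by rewrite ler_wpM2r ?expR_ge0.
have E2 : (fun x => itg (fun r => F (r, x)) * ((- p) ^+ N / P`!%:R)) =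
   fun x => g0 x * expR (- ((1 + p) * Z x)) -
     \sum_(j < N) (- p) ^+ j / j`!%:R * (Z x ^+ j * expR (- (1 * Z x)) * g0 x).
  apply/funext => x.
  (* Integrability of the slice in [r] is obtained from the bound on [F] by dividing by this factor,
     so its zeros are treated apart. *)
  have [nz|nz] := eqVneq (expR (- Z x) * g0 x) 0.
    have g00 : g0 x = 0.
      by move/eqP: nz; rewrite mulf_eq0 expR_eq0/= => /eqP.
    rewrite (_ : (fun r => F (r, x)) = fun=> 0); last first.
      by apply/funext => r; rewrite /F/= g00 !mulr0.
    by rewrite itg0 !mul0r g00 mul0r sub0r big1 ?oppr0// => i _; rewrite !mulr0.
  rewrite (_ : (fun r => F (r, x)) = fun r => expR (- Z x) * g0 x * (I r * (expR (p * r) * rpos (r + Z x) ^+ P))); last first.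
    by apply/funext => r; rewrite /F/=; ring.
  rewrite itgZ.
    rewrite -mulrA exp_taylor_itg// mulrBr; congr (_ - _).
      by rewrite mulrAC -expRD mulrC; congr (_ * expR _); ring.
    rewrite mulr_sumr; apply: eq_bigr => j _.
    by rewrite exprMn mul1r; ring.
  have nz' : 0 < `|expR (- Z x) * g0 x| by rewrite normr_gt0.
  apply: (itb_le _ _ (itbZ (`|expR (- Z x) * g0 x|^-1 * (expR (- (eps * Z x)) * `|g0 x|)) iE)).
    apply: measurable_funM => //; apply: measurable_funM; first by meas.
    by apply: measurable_funX; apply: mf_rpos; meas.
  move=> r; rewrite -[leRHS]mulrA ler_pdivlMl// -normrM.
  have := FB r x; rewrite mulrC; congr (`|_| <= _); rewrite /F/=; ring.
have := itg_fubini F _ _ mF iE ie FB; rewrite E1 => /esym E3.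
have i2 := itb_meas (itb_fubini F _ _ mF iE ie FB).
have iFx : itb (fun x => itg (fun r => F (r, x))).
  have mFs : measurable_fun setT (fun z : R * R => F (z.2, z.1)).
    by apply: (measurableT_comp mF); apply: measurable_fun_pair; meas.
  apply: (itb_fubini (fun z : R * R => F (z.2, z.1)) _ _ mFs ie iE) => x y /=.
  by rewrite mulrC.
have := itgZ ((- p) ^+ N / P`!%:R) iFx; rewrite E3 mulr0.
rewrite (_ : (fun x => _ * _) = (fun x => itg (fun r => F (r, x)) * ((- p) ^+ N / P`!%:R))); last first.
  by apply/funext => x; rewrite mulrC.
rewrite E2 itgB.
- move=> /eqP; rewrite subr_eq0 => /eqP ->.
  rewrite (itg_sum (f := fun j x => (- p) ^+ j / j`!%:R * (Z x ^+ j * expR (- (1 * Z x)) * g0 x))).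
    by apply: eq_bigr => j _; rewrite itgZ//; exact: ig0_pow.
  by move=> j; apply: itbZ; exact: ig0_pow.
- have p1' : 0 < 1 + p by lra.
  by have := ig0_pow 0 _ p1'; congr itb; apply/funext => x; rewrite expr0 mul1r mulrC.
- apply: (itb_sum (f := fun j x => (- p) ^+ j / j`!%:R * (Z x ^+ j * expR (- (1 * Z x)) * g0 x))).
  by move=> j; apply: itbZ; exact: ig0_pow.
Qed.

(* The Laplace transform of [g0] is a polynomial tending to [0] at infinity. *)
Lemma laplace_eq0 eta : 0 < eta -> itg (fun x => g0 x * expR (- (eta * Z x))) = 0.
Proof.
move=> e0; pose d j := (-1) ^+ j / j`!%:R * itg (fun x => Z x ^+ j * expR (- (1 * Z x)) * g0 x).
have polyE p : -1 < p -> itg (fun x => g0 x * expR (- ((1 + p) * Z x))) = \sum_(j < N) d j * p ^+ j.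
  move=> p1; rewrite laplace_poly//; apply: eq_bigr => j _.
  by rewrite /d (exprNn p); ring.
have d0 : forall j, (j < N)%N -> d j = 0.
  apply: poly_cvg0.
  have E k : \sum_(j < N) d j * k%:R ^+ j = itg (fun x => g0 x * expR (- ((1 + k%:R) * Z x))).
    by rewrite polyE//; have : 0 <= k%:R :> R by []; lra.
  under eq_fun do rewrite E.
  have [] := itg_dct (fun k x => g0 x * expR (- ((1 + k%:R) * Z x))) (fun=> 0)
    (fun x => expR (- (1 * Z x)) * `|g0 x|).
  - by move=> k; meas.
  - by meas.
  - exact: ig0.
  - apply: aeS Z_gt0 => x Zx; rewrite -[X in _ --> X](mulr0 (g0 x)).
    apply: cvgM; first exact: cvg_cst.
    have h : expR (- (Z x * y)) * expR (- Z x) @[y --> +oo] --> 0.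
      exact: (expN_cvg0 _ `|expR (- Z x)|).
    rewrite (_ : (fun k : nat => expR (- ((1 + k%:R) * Z x))) =
      (fun k : nat => expR (- (Z x * k%:R)) * expR (- Z x))); last first.
      by apply/funext => k; rewrite -expRD; congr expR; ring.
    exact: (@cvg_comp _ _ _ (fun k : nat => k%:R : R)
      (fun y => expR (- (Z x * y)) * expR (- Z x)) _ _ _ (@cvgr_idn R) h).
  - move=> k x; rewrite normrM (ger0_norm (expR_ge0 _)) mulrC ler_wpM2r// ler_expR.
    rewrite lerN2 ler_wpM2r// lerDl.
    by [].
  - by rewrite itg0.
have := polyE (eta - 1) ltac:(lra); rewrite addrCA subrr addr0 => ->.
by rewrite big1// => j _; rewrite d0// mul0r.
Qed.

End Core.

(** * Reflection of the line and parity *)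

Section Reflection.
Context {R : realType}.
Local Notation mu := (@lebesgue_measure R).

Lemma itg_opp (f : R -> R) : itb f -> itb (fun x => f (- x)) -> itg (fun x => f (- x)) = itg f.
Proof.
move=> hf hN; rewrite /itg /Rintegral; congr fine.
have mN : measurable_fun setT (-%R : measurableTypeR R -> measurableTypeR R).
  exact: oppr_measurable.
have mEf : measurable_fun setT (EFin \o f : measurableTypeR R -> \bar R).
  by apply/measurable_EFinP; exact: itb_meas.
transitivity (\int[pushforward mu (-%R : measurableTypeR R -> measurableTypeR R)]_y (EFin \o f) y)%E.
  by rewrite (@integral_pushforward _ _ _ _ _ _ mN mu setT _ mEf hN measurableT).
by apply: eq_measure_integral => A mA _; exact: lebesgue_measureN.
Qed.

Lemma itg_odd (f : R -> R) : itb f -> (forall x, f (- x) = - f x) -> itg f = 0.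
Proof.
move=> hf fN; have E : (fun x => f (- x)) = fun x => - f x by apply/funext => x.
have := itg_opp f hf; rewrite E => /(_ (itbN hf)); rewrite itgN// => h.
by lra.
Qed.

End Reflection.

Section Reflection2.
Context {R : realType}.
Local Notation mu := (@lebesgue_measure R).

Lemma ae_opp (P : R -> Prop) : {ae mu, forall x, P x} -> {ae mu, forall x, P (- x)}.
Proof.
move=> [A [mA A0 PA]]; exists (-%R @^-1` A); split.
- rewrite -[X in measurable X]setTI.
  have mN : measurable_fun setT (-%R : measurableTypeR R -> measurableTypeR R).
    exact: oppr_measurable.
  exact: mN.
- by rewrite -A0; exact: lebesgue_measureN.
- by move=> x /= nP; apply: PA.
Qed.

Lemma itb_opp (f : R -> R) : itb f -> itb (fun x => f (- x)).
Proof.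
move=> hf; have mf := itb_meas hf; have [_ fin] := integrableP _ _ _ hf.
have mN : measurable_fun setT (-%R : measurableTypeR R -> measurableTypeR R).
  exact: oppr_measurable.
apply/integrableP; split; first by apply/measurable_EFinP; exact: (measurableT_comp mf mN).
apply: le_lt_trans fin.
have mEf : measurable_fun setT (fun y : measurableTypeR R => `|(f y)%:E|%E).
  by apply: measurableT_comp => //; apply/measurable_EFinP.
have -> : (\int[mu]_x `|(f x)%:E| =
    \int[pushforward mu (-%R : measurableTypeR R -> measurableTypeR R)]_y `|(f y)%:E|)%E.
  by apply: eq_measure_integral => A mA _; apply/esym; exact: lebesgue_measureN.
by rewrite (@ge0_integral_pushforward _ _ _ _ _ _ mN mu setT _ measurableT mEf).
Qed.

Lemma itb_cauchy : itb (fun x : R => (1 + x ^+ 2)^-1).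
Proof.
have p0 (x : R) : 0 < 1 + x ^+ 2 by rewrite ltr_wpDr ?sqr_ge0.
have f0 (x : R) : 0 <= (1 + x ^+ 2)^-1 by rewrite invr_ge0 ltW.
have cf : continuous (fun x : R => (1 + x ^+ 2)^-1).
  move=> x; apply: cvgV; first by rewrite gt_eqF.
  by apply: cvgD; [exact: cvg_cst|exact: exprn_continuous].
have [i _] := FTCy 0 (pi / 2) _ atan f0 cf (fun x => is_derive1_atan x) (@cvgy_atan R).
apply: (itb_le _ _ (itbD i (itb_opp _ i))).
  by apply: mf_inv => //; meas.
move=> x; rewrite (ger0_norm (f0 x)) /cutoff sqrrN !in_itv /= !andbT.
have [x0|x0] := leP 0 x; first by rewrite lerDl; case: ifP.
by rewrite oppr_ge0 (ltW x0) add0r.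
Qed.

End Reflection2.

(** * Pairings in a weighted L2 space *)

Section WeightedL2.
Context {R : realType}.
Local Notation mu := (@lebesgue_measure R).
Variable w : R -> R.
Hypotheses (mw : measurable_fun setT w) (w_ge0 : forall x, 0 <= w x).
Implicit Types F g : R -> R.

Definition L2w F : Prop := measurable_fun setT F /\ itb (fun x => F x ^+ 2 * w x).

(** The weighted arithmetic-geometric mean does the work of Cauchy-Schwarz; the free parameter [c]
    decides which of the two norms has to be small. *)
Lemma L2w_amgm F g (c : R) x : 0 < c ->
  `|F x * g x * w x| <= c^-1 * (F x ^+ 2 * w x) + c * (g x ^+ 2 * w x).
Proof.
move=> c0; rewrite normrM (ger0_norm (w_ge0 x)) !(mulrA _ _ (w x)) -mulrDl ler_wpM2r// normrM.
rewrite -(real_normK (num_real (F x))) -(real_normK (num_real (g x))).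
have a0 := normr_ge0 (F x); have b0 := normr_ge0 (g x).
move: `|F x| `|g x| a0 b0 => a b a0 b0.
have h : 0 <= (a - c * b) ^+ 2 by exact: sqr_ge0.
rewrite -(ler_pM2l c0) mulrDr !mulrA divff ?gt_eqF// mul1r.
have := mulr_ge0 (ltW c0) (mulr_ge0 a0 b0); nra.
Qed.

Lemma L2w_itb F g : L2w F -> L2w g -> itb (fun x => F x * g x * w x).
Proof.
move=> [mF iF] [mg ig]; apply: (itb_le _ _ (itbD (itbZ 1^-1 iF) (itbZ 1 ig))); first by meas.
by move=> x; exact: L2w_amgm.
Qed.

Lemma L2w_est F g (c : R) : 0 < c -> L2w F -> L2w g ->
  `|itg (fun x => F x * g x * w x)| <=
  c^-1 * itg (fun x => F x ^+ 2 * w x) + c * itg (fun x => g x ^+ 2 * w x).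
Proof.
move=> c0 [mF iF] [mg ig]; rewrite -!itgZ// -itgD; [|exact: itbZ..].
apply: itg_norm_le; first by meas.
  by apply: itbD; exact: itbZ.
by move=> x; exact: L2w_amgm.
Qed.

Lemma L2wZ (c : R) F : L2w F -> L2w (fun x => c * F x).
Proof.
move=> [mF iF]; split; first by meas.
by have := itbZ (c ^+ 2) iF; congr itb; apply/funext => x; rewrite exprMn mulrA.
Qed.

Lemma L2wD F g : L2w F -> L2w g -> L2w (fun x => F x + g x).
Proof.
move=> [mF iF] [mg ig]; split; first by meas.
apply: (itb_le _ _ (itbD (itbZ 2 iF) (itbZ 2 ig))); first by meas.
move=> x; rewrite ger0_norm; last by rewrite mulr_ge0// sqr_ge0.
rewrite !(mulrA 2 _ (w x)) -mulrDl ler_wpM2r//.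
have := sqr_ge0 (F x - g x); nra.
Qed.

Lemma L2w_cvg (Fm : nat -> R -> R) F g (D : nat -> \bar R) :
  (forall m, measurable_fun setT (Fm m)) -> L2w F -> L2w g ->
  (forall m, (\int[mu]_x ((Fm m x - F x) ^+ 2 * w x)%:E <= D m)%E) ->
  D @ \oo --> 0%E ->
  itg (fun x => Fm m x * g x * w x) @[m --> \oo] --> itg (fun x => F x * g x * w x).
Proof.
move=> mFm lF lg FD D0; have [mF iF] := lF; have [mg ig] := lg.
apply/cvgrPdist_le => eps eps0.
pose G2 := itg (fun x => g x ^+ 2 * w x).
have G20 : 0 <= G2 by apply: itg_ge0 => x; rewrite mulr_ge0// sqr_ge0.
(* Makes [c * G2] at most eps / 2; the added 1 covers [G2 = 0]. *)
pose c := eps / (2 * (G2 + 1)).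
have c0 : 0 < c by rewrite divr_gt0// mulr_gt0//; lra.
have dpos : 0 < c * (eps / 2) by rewrite mulr_gt0// divr_gt0.
have /fine_cvgP[fD /cvgr0_norm_lt/(_ _ dpos) cD] : D m @[m --> \oo] --> (0 : R)%:E.
  exact: D0.
apply: filterS2 fD cD => m fDm /= cDm.
have Dm : (D m < (c * (eps / 2))%:E)%E.
  by rewrite -(fineK fDm) lte_fin (le_lt_trans (ler_norm _)).
have lt : (\int[mu]_x ((Fm m x - F x) ^+ 2 * w x)%:E < (c * (eps / 2))%:E)%E.
  exact: le_lt_trans Dm.
have lB : L2w (fun x => Fm m x - F x).
  split; first by apply: measurable_funB.
  apply: itb_ge0P; first by have := mFm m => ?; meas.
    by move=> x; rewrite mulr_ge0// sqr_ge0.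
  by apply: (lt_trans lt); exact: ltry.
have ltr : itg (fun x => (Fm m x - F x) ^+ 2 * w x) < c * (eps / 2).
  by rewrite -lte_fin -itgE//; case: lB.
have iFg := L2w_itb F g lF lg; have iBg := L2w_itb _ g lB lg.
have E : itg (fun x => Fm m x * g x * w x) =
    itg (fun x => (Fm m x - F x) * g x * w x) + itg (fun x => F x * g x * w x).
  by rewrite -itgD//; congr itg; apply/funext => x; ring.
rewrite E opprD addrCA subrr addr0 normrN.
apply: (le_trans (L2w_est _ _ c c0 lB lg)); rewrite -/G2.
have h1 : c^-1 * itg (fun x => (Fm m x - F x) ^+ 2 * w x) <= eps / 2.
  by rewrite ler_pdivrMl// ltW.
have h2 : c * G2 <= eps / 2.
  rewrite /c mulrAC ler_pdivrMr; last by rewrite mulr_gt0//; lra.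
  by rewrite (_ : eps / 2 * (2 * (G2 + 1)) = eps * G2 + eps); [lra|field].
by lra.
Qed.

End WeightedL2.

(** * The two parity kernels and their action on Gaussians *)

Section Kernel.
Context {R : realType}.
Local Notation mu := (@lebesgue_measure R).
Variables (n : nat) (k : R).
Hypotheses (n_gt0 : (0 < n)%N) (k_ge : (n%:R - 1) / (2 * n%:R) <= k)
  (gm_gt0 : 0 < 2 * k + 2 / n%:R - 2).
Implicit Types (e c : bool) (s x l : R).

Definition Yf x : R := `|x| `^ (2 / n%:R).
Definition nuf e : R := alpha n k + (e * n)%:R.
Definition phi e s x : R := x ^+ e * expR (- (n%:R * s * Yf x)).
Definition Psi e s x : R := (2 * s) `^ (- (nuf e + 1)) * phi e (4 * s)^-1 x.
(** The even or odd part of the kernel without the unit (-i)^n. In the odd part the Gamma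
    normalization of j_(alpha+n) has cancelled Gamma(alpha+n+1). *)
Definition Bker e x l : R :=
  (n%:R / 2) ^+ (e * n) * gam (alpha n k + 1) * (l * x) ^+ e *
  bessel (nuf e) (n%:R ^+ 2 / 4 * Yf x * Yf l).

Let gm := 2 * k + 2 / n%:R - 2.
Let w := weight n k.
Let cw := (2 * gam (alpha n k + 1))^-1 * (n%:R / 2) `^ (alpha n k).

Lemma n0 : 0 < n%:R :> R. Proof. by rewrite ltr0n. Qed.

Lemma q0 : 0 < 2 / n%:R :> R. Proof. by rewrite divr_gt0// n0. Qed.

(** The lower bound on [k] is this inequality rewritten; it puts both orders [nuf e] in the range of
    the Bessel estimates. *)
Lemma alpha_ge : - (1/2) <= alpha n k.
Proof.
have h := ler_wpM2r (ltW n0) k_ge; rewrite /alpha.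
have -> : k * n%:R - n%:R / 2 = k * n%:R - (n%:R - 1) / (2 * n%:R) * n%:R - 1/2.
  by field; rewrite gt_eqF ?n0.
by move: h; move: (_ / _ * _) => z; move: (k * _) => y; lra.
Qed.

Lemma nuf_ge e : - (1/2) <= nuf e.
Proof. by apply: (le_trans alpha_ge); rewrite lerDl. Qed.

Lemma Yf_ge0 x : 0 <= Yf x. Proof. exact: powR_ge0. Qed.

Lemma mf_Yf d (T : measurableType d) (f : T -> R) : measurable_fun setT f ->
  measurable_fun setT (fun t => Yf (f t)).
Proof. by move=> mf; rewrite /Yf; meas. Qed.

Lemma Yf_opp x : Yf (- x) = Yf x. Proof. by rewrite /Yf normrN. Qed.

Lemma weightE x : w x = cw * `|x| `^ gm.
Proof. by rewrite /w /weight gamE. Qed.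

Lemma w_ge0 x : 0 <= w x.
Proof.
rewrite weightE mulr_ge0 ?powR_ge0// /cw mulr_ge0 ?powR_ge0// invr_ge0.
by rewrite mulr_ge0// ltW// gam_gt0//; have := alpha_ge; lra.
Qed.

Lemma w_opp x : w (- x) = w x. Proof. by rewrite !weightE normrN. Qed.

Lemma w_gt0 x : x != 0 -> 0 < w x.
Proof.
move=> x0; rewrite weightE mulr_gt0 ?powR_gt0 ?normr_gt0// /cw mulr_gt0//.
  by rewrite invr_gt0 mulr_gt0// gam_gt0//; have := alpha_ge; lra.
by rewrite powR_gt0// divr_gt0// n0.
Qed.

Lemma mf_w : measurable_fun setT w.
Proof.
rewrite (_ : w = fun x => cw * `|x| `^ gm); last by apply/funext => x; exact: weightE.
by meas.
Qed.

Lemma mf_phi e s : measurable_fun setT (phi e s).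
Proof.
rewrite /phi; apply: measurable_funM; first by meas.
apply: mf_expR; apply: mf_opp; apply: measurable_funM => //.
by apply: mf_Yf; meas.
Qed.

Lemma pow_weight e j x :
  (x ^+ e) ^+ 2 * Yf x ^+ j * `|x| `^ gm = `|x| `^ (2 * e%:R + 2 / n%:R * j%:R + gm).
Proof.
have p0 : 0 <= 2 * e%:R + 2 / n%:R * j%:R :> R.
  by rewrite addr_ge0// ?mulr_ge0// ltW// q0.
(* Exponents need not add up at base 0, where the zeroth power is 1; both sides vanish there because
   [gm > 0]. *)
have [->|x0] := eqVneq x 0.
  rewrite normr0 !powR0 ?mulr0// gt_eqF//.
  by rewrite ltr_wpDl.
have nx : 0 < `|x| by rewrite normr_gt0.
have D a b : `|x| `^ (a + b) = `|x| `^ a * `|x| `^ b.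
  by rewrite powRD// (gt_eqF nx) implybT.
rewrite !D; congr (_ * _ * _).
  rewrite -exprM mulnC (_ : 2 * e%:R = (2 * e)%:R); last by rewrite natrM.
  rewrite powR_mulrn// -normrX ger0_norm// exprM; exact: exprn_ge0 (sqr_ge0 _).
by rewrite /Yf (powRrM _ (2 / n%:R) j%:R) powR_mulrn ?powR_ge0.
Qed.

Lemma gauss_moment e j (c : R) : 0 < c ->
  itb (fun x => (x ^+ e) ^+ 2 * Yf x ^+ j * expR (- (c * Yf x)) * w x) /\
  itg (fun x => (x ^+ e) ^+ 2 * Yf x ^+ j * expR (- (c * Yf x)) * w x) =
    cw * n%:R * c `^ (- (nuf e + 1)) * gam (nuf e + j%:R + 1) / c ^+ j.
Proof.
move=> c0.
have p0 : 0 <= 2 * e%:R + 2 / n%:R * j%:R + gm.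
  apply: addr_ge0; last exact: ltW.
  by apply: addr_ge0; rewrite mulr_ge0// ltW// q0.
have [h1 h2] := powR_expN_moment c _ _ c0 q0 p0.
have E : (fun x => (x ^+ e) ^+ 2 * Yf x ^+ j * expR (- (c * Yf x)) * w x) =
   fun x => cw * (expR (- (c * `|x| `^ (2 / n%:R))) * `|x| `^ (2 * e%:R + 2 / n%:R * j%:R + gm)).
  by apply/funext => x; rewrite -pow_weight weightE /Yf; ring.
rewrite E; split; first exact: itbZ.
have exE : (2 * e%:R + 2 / n%:R * j%:R + gm + 1) / (2 / n%:R) = nuf e + j%:R + 1.
  by rewrite /gm /nuf /alpha natrM; field; rewrite gt_eqF ?n0.
rewrite itgZ// h2 exE gamE.
rewrite (_ : 2 / (2 / n%:R) = n%:R); last by field; rewrite gt_eqF ?n0.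
have -> : c `^ (- (nuf e + j%:R + 1)) = c `^ (- (nuf e + 1)) / c ^+ j.
  rewrite -powR_invn ?(ltW c0)// -powRD ?(gt_eqF c0) ?implybT//.
  by congr powR; ring.
by ring.
Qed.

Lemma L2w_phi e j s : 0 < s -> L2w w (fun x => Yf x ^+ j * phi e s x).
Proof.
move=> s0; split.
  by apply: measurable_funM; [apply: measurable_funX; apply: mf_Yf; meas|exact: mf_phi].
have c0 : 0 < 2 * (n%:R * s) by rewrite !mulr_gt0// n0.
have [h _] := gauss_moment e (j * 2) _ c0; move: h; congr itb; apply/funext => x.
rewrite /phi exprMn -(exprM _ j 2) exprMn -(expRM_natl 2).
rewrite (_ : 2%:R * - (n%:R * s * Yf x) = - (2 * (n%:R * s) * Yf x)); last by ring.
by ring.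
Qed.

Lemma L2w_phi0 e s : 0 < s -> L2w w (phi e s).
Proof.
move=> s0; have := L2w_phi e 0 s s0; congr (L2w w _); apply/funext => x.
by rewrite expr0 mul1r.
Qed.

Lemma L2w_Psi e s : 0 < s -> L2w w (Psi e s).
Proof.
by move=> s0; apply: L2wZ; apply: L2w_phi0; rewrite invr_gt0 mulr_gt0.
Qed.

Lemma itb_phi e s : 0 < s -> itb (fun x => phi e s x * w x).
Proof.
move=> s0; have c0 : 0 < n%:R * s by rewrite mulr_gt0// n0.
have [h0 _] := gauss_moment false 0 _ c0.
have [h1 _] := gauss_moment true 0 _ c0.
apply: (itb_le _ _ (itbD h0 h1)).
  by have := mf_w; have := mf_phi e s => *; meas.
move=> x; rewrite normrM (ger0_norm (w_ge0 x)) /phi normrM (ger0_norm (expR_ge0 _)) normrX.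
rewrite -[leLHS]mulrA [leRHS](_ : _ = (1 + x ^+ 2) * (expR (- (n%:R * s * Yf x)) * w x)); last by ring.
apply: ler_wpM2r; first by apply: mulr_ge0; [exact: expR_ge0|exact: w_ge0].
have hx1 : `|x| <= 1 + x ^+ 2.
  rewrite -(real_normK (num_real x)); have := normr_ge0 x; move: `|x| => y y0.
  by have := sqr_ge0 (y - 1); nra.
case: (e); first by rewrite expr1.
by rewrite expr0 lerDl sqr_ge0.
Qed.

(** Gaussians are reproduced by the Hankel transform: their moments in [Yf] have the form required
    by [laplace_bessel] with rate n s, and the remaining constants combine to a power of 2 s. *)
Lemma gauss_transform e s x : 0 < s ->
  itg (fun l => phi e s l * Bker e x l * w l) = Psi e s x.
Proof.
move=> s0; have ns0 : 0 < n%:R * s by rewrite mulr_gt0// n0.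
have ns2 : 0 < n%:R * s / 2 by rewrite divr_gt0.
pose v l := (l ^+ e) ^+ 2 * expR (- (n%:R * s * Yf l)) * w l.
have Y0 : measurable_fun setT Yf by apply: mf_Yf; meas.
have mw := mf_w.
have mv : measurable_fun setT v by rewrite /v; meas.
have v0 l : 0 <= v l.
  by apply: mulr_ge0; [apply: mulr_ge0|exact: w_ge0]; rewrite ?sqr_ge0 ?expR_ge0.
have mom j : itg (fun t => v t * Yf t ^+ j) =
    cw * n%:R * (n%:R * s) `^ (- (nuf e + 1)) * gam (nuf e + j%:R + 1) / (n%:R * s) ^+ j.
  have [_ <-] := gauss_moment e j _ ns0; congr itg; apply/funext => t.
  by rewrite /v; ring.
have iv : itb (fun t => `|v t| * expR (n%:R * s / 2 * Yf t)).
  have [h _] := gauss_moment e 0 _ ns2; move: h; congr itb; apply/funext => t.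
  rewrite (ger0_norm (v0 t)) /v expr0 mulr1.
  rewrite (_ : - (n%:R * s / 2 * Yf t) = - (n%:R * s * Yf t) + n%:R * s / 2 * Yf t); last by field.
  by rewrite expRD; ring.
have Z0 : 0 <= n%:R ^+ 2 / 4 * Yf x by rewrite !mulr_ge0 ?Yf_ge0// invr_ge0.
have L := laplace_bessel (nuf e) _ _ _ _ v Yf (nuf_ge e) ns0 ns2 Z0 mv Y0 Yf_ge0 iv mom.
have ga : 0 < gam (alpha n k + 1) by apply: gam_gt0; have := alpha_ge; lra.
have n2 : 0 < n%:R / 2 :> R by rewrite divr_gt0// n0.
have [x0|x0] := eqVneq (x ^+ e) 0.
  rewrite /Psi /phi x0 mul0r mulr0 -[RHS]itg0; congr itg; apply/funext => l.
  by rewrite /Bker (exprMn e) x0 !(mulr0, mul0r).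
rewrite (_ : (fun l => _) = fun l => (n%:R / 2) ^+ (e * n) * gam (alpha n k + 1) * x ^+ e *
   (v l * bessel (nuf e) (n%:R ^+ 2 / 4 * Yf x * Yf l))); last first.
  by apply/funext => l; rewrite /Bker /v /phi (exprMn e); ring.
rewrite itgZ; last first.
  apply: (itb_le _ _ (itbZ ((gam (nuf e + 1))^-1) (proj1 (gauss_moment e 0 _ ns0)))).
    apply: measurable_funM => //; apply: mf_bessel; first exact: nuf_ge.
    by meas.
  move=> l; rewrite normrM (ger0_norm (v0 l)) expr0 mulr1 mulrC ler_wpM2r//.
  by apply: bessel_le; [exact: nuf_ge|rewrite mulr_ge0// Yf_ge0].
rewrite L /Psi /phi.
have -> : n%:R ^+ 2 / 4 * Yf x / (n%:R * s) = n%:R * (4 * s)^-1 * Yf x.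
  by field; rewrite !gt_eqF ?n0.
suff C : (n%:R / 2) ^+ (e * n) * gam (alpha n k + 1) * (cw * n%:R * (n%:R * s) `^ (- (nuf e + 1))) =
    (2 * s) `^ (- (nuf e + 1)).
  by rewrite -C; ring.
rewrite /cw [LHS](_ : _ = ((n%:R / 2) ^+ (e * n) * (n%:R / 2) `^ (alpha n k) * (n%:R / 2)) * (n%:R * s) `^ (- (nuf e + 1))); last first.
  by field; rewrite gt_eqF.
have -> : (n%:R / 2) ^+ (e * n) * (n%:R / 2) `^ (alpha n k) * (n%:R / 2) = (n%:R / 2) `^ (nuf e + 1) :> R.
  rewrite -powR_mulrn ?(ltW n2)// -powRD ?(gt_eqF n2) ?implybT//.
  rewrite -[X in _ * X](powRr1 (ltW n2)) -powRD ?(gt_eqF n2) ?implybT//.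
  by congr powR; rewrite /nuf; ring.
have -> : n%:R * s = n%:R / 2 * (2 * s) by field.
rewrite (@powRM _ (n%:R / 2) (2 * s)) ?mulr_ge0 ?(ltW n2) ?(ltW s0)// [LHS]mulrA -powRD ?(gt_eqF n2) ?implybT//.
by rewrite subrr powRr0 mul1r.
Qed.

Lemma kernel_arg x l : (`|l * x| `^ n%:R^-1) ^+ 2 = Yf x * Yf l.
Proof.
rewrite -(powR_mulrn 2 (powR_ge0 _ _)) -powRrM (mulrC n%:R^-1) normrM powRM//.
exact: mulrC.
Qed.

(** In the odd part the growing factor [l * x] is, up to a constant, the n-th power of the Bessel
    variable [r], and [bessel_pow_le] at order alpha + n pays for exactly that power. *)
Lemma Bker_le : exists2 K, 0 <= K & forall e x l, `|Bker e x l| <= K.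
Proof.
have [K K0 hK] := bessel_pow_le (alpha n k) n alpha_ge.
have ga : 0 < gam (alpha n k + 1) by apply: gam_gt0; have := alpha_ge; lra.
exists (gam (alpha n k + 1) * K + 1); first by rewrite addr_ge0// mulr_ge0// ltW.
move=> e x l; rewrite /Bker; case: e => /=.
  rewrite /nuf mul1n expr1.
  pose r : R := n%:R / 2 * `|l * x| `^ (n%:R^-1).
  have r0 : 0 <= r by rewrite mulr_ge0 ?powR_ge0// divr_ge0.
  have -> : n%:R ^+ 2 / 4 * Yf x * Yf l = r ^+ 2.
    by rewrite /r exprMn kernel_arg; field.
  have rn : r ^+ n = (n%:R / 2) ^+ n * `|l * x|.
    rewrite /r exprMn -(powR_mulrn n (powR_ge0 _ _)) -powRrM mulVf ?gt_eqF ?n0//.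
    by rewrite powRr1.
  have := hK r r0; rewrite rn => h.
  apply: (@le_trans _ _ (gam (alpha n k + 1) * K)); last by rewrite lerDl.
  rewrite !normrM (ger0_norm (ltW ga)) (@ger0_norm _ ((n%:R / 2) ^+ n)); last first.
    by rewrite exprn_ge0// divr_ge0.
  rewrite [leLHS](_ : _ = gam (alpha n k + 1) * ((n%:R / 2) ^+ n * `|l * x| * `|bessel (alpha n k + n%:R) (r ^+ 2)|)).
    by rewrite ler_wpM2l// ltW.
  by rewrite normrM; ring.
rewrite mul0n expr0 expr0 mul1r mulr1 /nuf mul0n addr0 normrM (ger0_norm (ltW ga)).
apply: (@le_trans _ _ 1); last by rewrite lerDr mulr_ge0// ltW.
rewrite -ler_pdivlMl// mulr1; apply: bessel_le; first exact: alpha_ge.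
by rewrite !mulr_ge0 ?Yf_ge0// invr_ge0.
Qed.

Lemma mf_Bker d (T : measurableType d) e (f g : T -> R) :
  measurable_fun setT f -> measurable_fun setT g ->
  measurable_fun setT (fun z => Bker e (f z) (g z)).
Proof.
move=> mf mg; rewrite /Bker; apply: measurable_funM; first by meas.
apply: mf_bessel; first exact: nuf_ge.
have := mf_Yf _ _ _ mf; have := mf_Yf _ _ _ mg => *.
by apply: measurable_funM => //; apply: measurable_funM.
Qed.

(** * Real transforms with one parity kernel, and their duality *)

Definition Pker e (f : R -> R) l : R := itg (fun x => f x * Bker e x l * w x).

Let pk_dom e (f g : R -> R) : measurable_fun setT f -> itb (fun x => f x * w x) -> itb g ->
  exists2 K, 0 <= K & measurable_fun setT (fun z : R * R => g z.1 * (f z.2 * Bker e z.2 z.1 * w z.2)) /\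
   forall l x, `|g l * (f x * Bker e x l * w x)| <= (K * `|g l|) * `|f x * w x|.
Proof.
move=> mf ifw ig; have [K K0 hK] := Bker_le; exists K => //; split.
  have mg := itb_meas ig; have mw := mf_w.
  apply: measurable_funM; first by meas.
  apply: measurable_funM; last by meas.
  by apply: measurable_funM; [meas|apply: mf_Bker; meas].
move=> l x; rewrite [leLHS](_ : _ = `|Bker e x l| * (`|g l| * `|f x * w x|)).
  by rewrite -mulrA ler_wpM2r ?mulr_ge0.
by rewrite !normrM; ring.
Qed.

Lemma itb_Pker_in e (f : R -> R) l : measurable_fun setT f -> itb (fun x => f x * w x) ->
  itb (fun x => f x * Bker e x l * w x).
Proof.
move=> mf ifw; have [K K0 hK] := Bker_le; have mw := mf_w.
apply: (itb_le _ _ (itbZ K (itb_norm ifw))).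
  by apply: measurable_funM => //; apply: measurable_funM => //; apply: mf_Bker; meas.
move=> x; rewrite mulrAC normrM mulrC ler_wpM2r//.
Qed.

(** The transform is bounded but need not be integrable, so the Fubini lemma is applied after
    multiplication by e^(-|l|), which is then divided out. *)
Lemma mf_Pker e (f : R -> R) : measurable_fun setT f -> itb (fun x => f x * w x) ->
  measurable_fun setT (Pker e f).
Proof.
move=> mf ifw; pose g (l : R) := expR (- (1 * `|l|)).
have ig : itb g by exact: itb_expN_norm.
have [K K0 [mF FB]] := pk_dom e f g mf ifw ig.
have h := itb_meas (itb_fubini _ _ _ mF (itbZ K (itb_norm ig)) (itb_norm ifw) FB).
have E : Pker e f = fun l => expR (1 * `|l|) * itg (fun x => g l * (f x * Bker e x l * w x)).
  apply/funext => l; rewrite itgZ; last exact: itb_Pker_in.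
  by rewrite mulrA -expRD subrr expR0 mul1r.
by rewrite E; apply: measurable_funM => //; meas.
Qed.

(** Fubini moves the kernel onto the Gaussian. Equal parities give [gauss_transform]; for opposite
    parities the inner integrand is odd in [l]. *)
Lemma duality e e' s (f : R -> R) : 0 < s -> measurable_fun setT f -> itb (fun x => f x * w x) ->
  itb (fun l => Pker e' f l * phi e s l * w l) /\
  itg (fun l => Pker e' f l * phi e s l * w l) =
    if e == e' then itg (fun x => f x * Psi e s x * w x) else 0.
Proof.
move=> s0 mf ifw; pose g l := phi e s l * w l.
have ig : itb g by exact: itb_phi.
have [K K0 [mF FB]] := pk_dom e' f g mf ifw ig.
have E1 : (fun l => itg (fun x => g l * (f x * Bker e' x l * w x))) =
    fun l => Pker e' f l * phi e s l * w l.
  apply/funext => l; rewrite itgZ; last exact: itb_Pker_in.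
  by rewrite /g /Pker; ring.
have iE := itbZ K (itb_norm ig); have iN := itb_norm ifw.
split; first by rewrite -E1; exact: (itb_fubini _ _ _ mF iE iN FB).
have igB x : itb (fun l => phi e s l * Bker e' x l * w l).
  have [K' K0' hK'] := Bker_le; have mw := mf_w; have mp := mf_phi e s.
  apply: (itb_le _ _ (itbZ K' (itb_norm ig))).
    by apply: measurable_funM => //; apply: measurable_funM => //; apply: mf_Bker; meas.
  by move=> l; rewrite mulrAC normrM mulrC ler_wpM2r.
have E2 : (fun x => itg (fun l => g l * (f x * Bker e' x l * w x))) =
   fun x => f x * w x * itg (fun l => phi e s l * Bker e' x l * w l).
  apply/funext => x; rewrite -(itgZ (f x * w x) (igB x)); congr itg; apply/funext => l.
  by rewrite /g; ring.
rewrite -E1; apply: (etrans (itg_fubini _ _ _ mF iE iN FB)).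
rewrite -[LHS]/(itg (fun x => itg (fun l => g l * (f x * Bker e' x l * w x)))).
rewrite E2; case: eqP => [<-|ee'].
  by congr itg; apply/funext => x; rewrite gauss_transform//; ring.
rewrite -[RHS]itg0; congr itg; apply/funext => x.
rewrite (itg_odd _ (igB x)) ?mulr0// => l.
rewrite /phi /Bker Yf_opp w_opp mulNr.
have [-> ->] : (- l) ^+ e = (-1) ^+ e * l ^+ e /\ (- (l * x)) ^+ e' = (-1) ^+ e' * (l * x) ^+ e'.
  by rewrite (exprNn l) (exprNn (l * x)).
have h : (-1) ^+ e * (-1) ^+ e' = -1 :> R.
  by case: e e' ee' {E1 E2 igB ig mF FB g iE} => -[]// _; rewrite ?expr0 ?expr1 ?mulr1 ?mul1r.
rewrite [RHS](_ : _ = ((-1) ^+ e * (-1) ^+ e') * (l ^+ e * expR (- (n%:R * s * Yf l)) *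
  ((n%:R / 2) ^+ (e' * n) * gam (alpha n k + 1) * (l * x) ^+ e' *
  bessel (nuf e') (n%:R ^+ 2 / 4 * Yf x * Yf l)) * w l)); last by rewrite h; ring.
by ring.
Qed.

(** * Real and imaginary components, and Gaussian pairings of the L2 transform *)

Definition cmp (c : bool) (z : R[i]) : R := if c then complex.Im z else complex.Re z.

Lemma normcE (z : R[i]) :
  Normc.normc z = (complex.Re z ^+ 2 + complex.Im z ^+ 2) `^ 2^-1.
Proof. by case: z => a b /=; rewrite powR12_sqrt// addr_ge0// sqr_ge0. Qed.

Lemma normc_sqr (z : R[i]) :
  Normc.normc z ^+ 2 = complex.Re z ^+ 2 + complex.Im z ^+ 2.
Proof. by case: z => a b /=; rewrite sqr_sqrtr// addr_ge0// sqr_ge0. Qed.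

Lemma normc_ge0 (z : R[i]) : 0 <= Normc.normc z.
Proof. by rewrite normcE powR_ge0. Qed.

Lemma cmp_sqr_le c (z : R[i]) : cmp c z ^+ 2 <= Normc.normc z ^+ 2.
Proof. by rewrite normc_sqr; case: c => /=; rewrite ?lerDl ?lerDr sqr_ge0. Qed.

Lemma cmp_le c (z : R[i]) : `|cmp c z| <= Normc.normc z.
Proof.
rewrite -(@ler_pXn2r _ 2)// ?nnegrE ?normc_ge0// real_normK ?num_real//.
exact: cmp_sqr_le.
Qed.

Lemma mf_cmp c (f : R -> R[i]) : cmeasurable f -> measurable_fun setT (fun x => cmp c (f x)).
Proof. by case: c => -[]. Qed.

Lemma mf_normc (f : R -> R[i]) : cmeasurable f -> measurable_fun setT (fun x => Normc.normc (f x)).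
Proof.
move=> mf; have m0 := mf_cmp false _ mf; have m1 := mf_cmp true _ mf.
rewrite (_ : (fun x => _) = fun x => (cmp false (f x) ^+ 2 + cmp true (f x) ^+ 2) `^ 2^-1).
  by meas.
by apply/funext => x; rewrite normcE.
Qed.

Lemma Lp1_itb c (f : R -> R[i]) : Lpkn n k 1 f -> itb (fun x => cmp c (f x) * w x).
Proof.
move=> [mf lt]; have mw := mf_w; have mc := mf_cmp c _ mf; have mn := mf_normc _ mf.
have h : itb (fun x => Normc.normc (f x) `^ 1 * w x).
  apply: itb_ge0P => //; first by meas.
  by move=> x; apply: mulr_ge0; [exact: powR_ge0|exact: w_ge0].
apply: (itb_le _ _ h); first by meas.
move=> x; rewrite normrM (ger0_norm (w_ge0 x)) ler_wpM2r ?w_ge0// powRr1 ?normc_ge0//.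
exact: cmp_le.
Qed.

Lemma Lp2_L2w c (f : R -> R[i]) : Lpkn n k 2 f -> L2w w (fun x => cmp c (f x)).
Proof.
move=> [mf lt]; have mw := mf_w; have mc := mf_cmp c _ mf; have mn := mf_normc _ mf.
have h : itb (fun x => Normc.normc (f x) `^ 2 * w x).
  apply: itb_ge0P => //; first by meas.
  by move=> x; apply: mulr_ge0; [exact: powR_ge0|exact: w_ge0].
split=> //; apply: (itb_le _ _ h); first by meas.
move=> x; rewrite normrM (ger0_norm (w_ge0 x)) ler_wpM2r ?w_ge0//.
rewrite (powR_mulrn 2 (normc_ge0 _)) ger0_norm ?sqr_ge0//.
exact: cmp_sqr_le.
Qed.

Lemma dist2_cmp c (f g : R -> R[i]) : cmeasurable f -> cmeasurable g ->
  (\int[mu]_x ((cmp c (f x) - cmp c (g x)) ^+ 2 * w x)%:E <= dist2 n k f g)%E.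
Proof.
move=> mf mg; have mw := mf_w; have m1 := mf_cmp c _ mf; have m2 := mf_cmp c _ mg.
have mfg : cmeasurable (fun x => f x - g x).
  have mf0 := mf_cmp false _ mf; have mg0 := mf_cmp false _ mg.
  have mf1 := mf_cmp true _ mf; have mg1 := mf_cmp true _ mg.
  split.
    rewrite (_ : (fun x => _) = fun x => cmp false (f x) - cmp false (g x)); first by meas.
    by apply/funext => x /=; case: (f x) (g x) => ? ? [].
  rewrite (_ : (fun x => _) = fun x => cmp true (f x) - cmp true (g x)); first by meas.
  by apply/funext => x /=; case: (f x) (g x) => ? ? [].
have mn := mf_normc _ mfg.
rewrite /dist2; apply: ge0_le_integral => //.
- by move=> x _; rewrite lee_fin; apply: mulr_ge0; [exact: sqr_ge0|exact: w_ge0].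
- by apply/measurable_EFinP; meas.
- by apply/measurable_EFinP; meas.
- move=> x _; rewrite lee_fin ler_wpM2r ?w_ge0//.
  rewrite (_ : cmp c (f x) - cmp c (g x) = cmp c (f x - g x)); first exact: cmp_sqr_le.
  by case: c {m1 m2} => /=; case: (f x) (g x) => ? ? [].
Qed.

(** Only the modulus of this unit matters later, so it is kept as an abstract point of the circle
    instead of being split by the residue of [m] modulo 4. *)
Lemma expNi m : exists a b : R, a ^+ 2 + b ^+ 2 = 1 /\ (- 'i : R[i])%C ^+ m = (a +i* b)%C.
Proof.
elim: m => [|m [a [b [ab E]]]].
  by exists 1, 0; split; [rewrite expr1n expr0n addr0|rewrite expr0].
exists b, (- a); split; first by rewrite sqrrN addrC.
rewrite exprS E; apply/eqP; rewrite eq_complex /=.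
by apply/andP; split; apply/eqP; ring.
Qed.

Lemma BknE (a b x l : R) : (- 'i : R[i])%C ^+ n = (a +i* b)%C ->
  Bkn n k x l = ((Bker false x l + a * Bker true x l) +i* (b * Bker true x l))%C.
Proof.
move=> E; rewrite /Bkn E !jbesselE gamE.
have ga : 0 < gam (alpha n k + n%:R + 1).
  by apply: gam_gt0; have := alpha_ge; have : 0 <= n%:R :> R by []; lra.
have -> : (n%:R * `|l * x| `^ n%:R^-1 / 2) ^+ 2 = n%:R ^+ 2 / 4 * Yf x * Yf l.
  by rewrite -mulrA mulrCA exprMn mulrC; rewrite -[RHS]mulrA -kernel_arg; field.
rewrite /Bker /nuf mul0n mul1n !expr0 expr1 addr0.
apply/eqP; rewrite eq_complex /=; apply/andP; split; apply/eqP.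
  by field; rewrite gt_eqF.
by field; rewrite gt_eqF.
Qed.

Lemma FknE (a b l : R) (f : R -> R[i]) : (- 'i : R[i])%C ^+ n = (a +i* b)%C ->
  Lpkn n k 1 f ->
  let P e c := Pker e (fun x => cmp c (f x)) l in
  cmp false (Fkn n k f l) = P false false + a * P true false - b * P true true /\
  cmp true (Fkn n k f l) = P false true + a * P true true + b * P true false.
Proof.
move=> E Lf P; have [mf _] := Lf.
have i e c := itb_Pker_in e _ l (mf_cmp c _ mf) (Lp1_itb c _ Lf).
rewrite /cmp /Fkn /cint_mu /=; split.
  rewrite -[LHS]/(itg (fun x => complex.Re (f x * Bkn n k x l) * w x)).
  rewrite /P /Pker -!itgZ// -itgD//; last exact: itbZ.
  rewrite -itgB; [|by apply: itbD => //; exact: itbZ|exact: itbZ].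
  congr itg; apply/funext => x; rewrite (BknE a b)//.
  by case: (f x) => f1 f2 /=; ring.
rewrite -[LHS]/(itg (fun x => complex.Im (f x * Bkn n k x l) * w x)).
rewrite /P /Pker -!itgZ// -itgD//; last exact: itbZ.
rewrite -itgD; [|by apply: itbD => //; exact: itbZ|exact: itbZ].
congr itg; apply/funext => x; rewrite (BknE a b)//.
by case: (f x) => f1 f2 /=; ring.
Qed.

Lemma Fkn_cmeasurable (f : R -> R[i]) : Lpkn n k 1 f -> cmeasurable (Fkn n k f).
Proof.
move=> Lf; have [a [b [_ E]]] := expNi n; have [mf _] := Lf.
have mP e c : measurable_fun setT (Pker e (fun x => cmp c (f x))).
  by apply: mf_Pker; [exact: mf_cmp|exact: Lp1_itb].
have m00 := mP false false; have m01 := mP false true.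
have m10 := mP true false; have m11 := mP true true.
split.
  rewrite (_ : (fun x => _) = fun l => Pker false (fun x => cmp false (f x)) l +
    a * Pker true (fun x => cmp false (f x)) l - b * Pker true (fun x => cmp true (f x)) l).
    exact: (measurable_funB (measurable_funD m00 (measurable_funM (measurable_cst a) m10))
      (measurable_funM (measurable_cst b) m11)).
  by apply/funext => l; have [<- _] := FknE a b l f E Lf.
rewrite (_ : (fun x => _) = fun l => Pker false (fun x => cmp true (f x)) l +
    a * Pker true (fun x => cmp true (f x)) l + b * Pker true (fun x => cmp false (f x)) l).
  exact: (measurable_funD (measurable_funD m01 (measurable_funM (measurable_cst a) m11))
    (measurable_funM (measurable_cst b) m10)).
by apply/funext => l; have [_ <-] := FknE a b l f E Lf.
Qed.

Lemma Fkn_pairing (a b : R) (f : R -> R[i]) e s : (- 'i : R[i])%C ^+ n = (a +i* b)%C ->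
  Lpkn n k 1 f -> 0 < s ->
  let ae := if e then a else 1 in let be := if e then b else 0 in
  let U c := itg (fun x => cmp c (f x) * Psi e s x * w x) in
  itg (fun l => cmp false (Fkn n k f l) * phi e s l * w l) = ae * U false - be * U true /\
  itg (fun l => cmp true (Fkn n k f l) * phi e s l * w l) = ae * U true + be * U false.
Proof.
move=> E Lf s0 ae be U; have [mf _] := Lf.
have D e' c := duality e e' s _ s0 (mf_cmp c _ mf) (Lp1_itb c _ Lf).
have i e' c := proj1 (D e' c); have v e' c := proj2 (D e' c).
split.
  rewrite (_ : (fun l => _) = fun l =>
    (Pker false (fun x => cmp false (f x)) l * phi e s l * w l +
    a * (Pker true (fun x => cmp false (f x)) l * phi e s l * w l)) -
    b * (Pker true (fun x => cmp true (f x)) l * phi e s l * w l)); last first.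
    apply/funext => l; have [-> _] := FknE a b l f E Lf.
    by move: (Pker _ _ l) (Pker _ _ l) (Pker _ _ l) (phi e s l) (w l) => p1 p2 p3 p4 p5; ring.
  rewrite itgB; [|by apply: itbD => //; exact: itbZ|exact: itbZ].
  rewrite itgD//; last exact: itbZ.
  have h1 := etrans (itgZ a (i true false)) (f_equal ( *%R a) (v true false)).
  have h2 := etrans (itgZ b (i true true)) (f_equal ( *%R b) (v true true)).
  apply: (etrans (f_equal2 (fun y z => y - z) (f_equal2 +%R (v false false) h1) h2)).
  rewrite /ae /be /U {h1 h2}.
  by move: (itg _) (itg _) => u1 u2; case: (e) => /=; ring.
rewrite (_ : (fun l => _) = fun l =>
    (Pker false (fun x => cmp true (f x)) l * phi e s l * w l +
    a * (Pker true (fun x => cmp true (f x)) l * phi e s l * w l)) +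
    b * (Pker true (fun x => cmp false (f x)) l * phi e s l * w l)); last first.
  apply/funext => l; have [_ ->] := FknE a b l f E Lf.
  by move: (Pker _ _ l) (Pker _ _ l) (Pker _ _ l) (phi e s l) (w l) => p1 p2 p3 p4 p5; ring.
rewrite itgD; [|by apply: itbD => //; exact: itbZ|exact: itbZ].
rewrite itgD//; last exact: itbZ.
have h1 := etrans (itgZ a (i true true)) (f_equal ( *%R a) (v true true)).
have h2 := etrans (itgZ b (i true false)) (f_equal ( *%R b) (v true false)).
apply: (etrans (f_equal2 +%R (f_equal2 +%R (v false true) h1) h2)).
rewrite /ae /be /U {h1 h2}.
by move: (itg _) (itg _) => u1 u2; case: (e) => /=; ring.
Qed.

(** Both sides are continuous in L2, so [Fkn_pairing] extends from the approximating sequence to its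
    limit. *)
Lemma FT_pairing (a b : R) (f h : R -> R[i]) e s : (- 'i : R[i])%C ^+ n = (a +i* b)%C ->
  FT_L2 n k f h -> 0 < s ->
  let ae := if e then a else 1 in let be := if e then b else 0 in
  let U c := itg (fun x => cmp c (f x) * Psi e s x * w x) in
  itg (fun l => cmp false (h l) * phi e s l * w l) = ae * U false - be * U true /\
  itg (fun l => cmp true (h l) * phi e s l * w l) = ae * U true + be * U false.
Proof.
move=> E [Lf [Lh [fm [Lfm [fmf Ffm]]]]] s0 ae be U.
have mw := mf_w; have wge := w_ge0.
have [mf _] := Lf; have [mh _] := Lh.
have cU c : itg (fun x => cmp c (fm m x) * Psi e s x * w x) @[m --> \oo] --> U c.
  apply: (L2w_cvg w mw wge (fun m x => cmp c (fm m x)) _ _ (fun m => dist2 n k (fm m) f)).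
  - by move=> m; apply: mf_cmp; case: (Lfm m) => -[].
  - exact: Lp2_L2w.
  - exact: L2w_Psi.
  - by move=> m; apply: dist2_cmp => //; case: (Lfm m) => -[].
  - exact: fmf.
have cH c : itg (fun l => cmp c (Fkn n k (fm m) l) * phi e s l * w l) @[m --> \oo] -->
    itg (fun l => cmp c (h l) * phi e s l * w l).
  apply: (L2w_cvg w mw wge (fun m x => cmp c (Fkn n k (fm m) x)) _ _ (fun m => dist2 n k (Fkn n k (fm m)) h)).
  - by move=> m; apply: mf_cmp; apply: Fkn_cmeasurable; case: (Lfm m).
  - exact: Lp2_L2w.
  - exact: L2w_phi0.
  - by move=> m; apply: dist2_cmp => //; apply: Fkn_cmeasurable; case: (Lfm m).
  - exact: Ffm.
split.
  apply: (cvgr_eq (cH false)).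
  rewrite (_ : (fun m => _) = fun m => ae * itg (fun x => cmp false (fm m x) * Psi e s x * w x) -
     be * itg (fun x => cmp true (fm m x) * Psi e s x * w x)).
    by apply: cvgB; apply: cvgM; try exact: cvg_cst; exact: cU.
  by apply/funext => m; have [-> _] := Fkn_pairing a b (fm m) e s E (proj1 (Lfm m)) s0.
apply: (cvgr_eq (cH true)).
rewrite (_ : (fun m => _) = fun m => ae * itg (fun x => cmp true (fm m x) * Psi e s x * w x) +
     be * itg (fun x => cmp false (fm m x) * Psi e s x * w x)).
  by apply: cvgD; apply: cvgM; try exact: cvg_cst; exact: cU.
by apply/funext => m; have [_ ->] := Fkn_pairing a b (fm m) e s E (proj1 (Lfm m)) s0.
Qed.

(** One real function [h] expresses both pairings, the operator appearing as multiplication by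
    [- Yf] under the integral. As [Yf] is also what d/ds brings down from [phi e s], up to the
    factor -n, the operator turns into a derivative in [s]. *)
Lemma DkOp_pairing (f g : R -> R[i]) c e : DkOp n k f g -> exists2 h, L2w w h &
  forall s, 0 < s ->
  itg (fun x => cmp c (f x) * Psi e s x * w x) = itg (fun x => h x * phi e s x * w x) /\
  itg (fun x => cmp c (g x) * Psi e s x * w x) =
    - itg (fun x => h x * (Yf x ^+ 1 * phi e s x) * w x).
Proof.
move=> [Lf [Lg [Ff [Fg [Hf [Hg FgE]]]]]].
have [a [b [ab E]]] := expNi n.
pose ae := if e then a else 1; pose be := if e then b else 0.
have abe : ae ^+ 2 + be ^+ 2 = 1 by rewrite /ae /be; case: (e) => //; rewrite expr1n expr0n addr0.
have [_ [LFf _]] := Hf; have [_ [LFg _]] := Hg.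
have L2F c' := Lp2_L2w c' _ LFf; have L2G c' := Lp2_L2w c' _ LFg.
(* The component [c] of [Ff] multiplied by the conjugate of the unit [ae + i be], which undoes the
   rotation in [FT_pairing]. *)
pose h x := ae * cmp c (Ff x) + (if c then - be else be) * cmp (~~ c) (Ff x).
have mw := mf_w; have wge := w_ge0.
have La : L2w w (fun x => ae * cmp c (Ff x)) by apply: L2wZ => //; exact: L2F.
have Lb : L2w w (fun x => (if c then - be else be) * cmp (~~ c) (Ff x)).
  by apply: L2wZ => //; exact: L2F.
exists h; first exact: (L2wD w mw wge _ _ La Lb).
move=> s s0; have Lp := L2w_phi0 e s s0; have LY := L2w_phi e 1 s s0.
have iF c' := L2w_itb w mw wge _ _ (L2F c') Lp.
have iFY c' := L2w_itb w mw wge _ _ (L2F c') LY.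
have [e1 e2] := FT_pairing a b f Ff e s E Hf s0.
have [e3 e4] := FT_pairing a b g Fg e s E Hg s0.
have G c' : itg (fun l => cmp c' (Fg l) * phi e s l * w l) =
   - itg (fun x => cmp c' (Ff x) * (Yf x ^+ 1 * phi e s x) * w x).
  rewrite -itgN//; apply: ae_itg.
  - exact: (itb_meas (L2w_itb w mw wge _ _ (L2G c') Lp)).
  - exact: (itb_meas (itbN (iFY c'))).
  - apply: aeS FgE => x ->; rewrite expr1 /Yf.
    by case: c' => /=; case: (Ff x) => ? ? /=; ring.
have hp : itg (fun x => h x * phi e s x * w x) =
   ae * itg (fun x => cmp c (Ff x) * phi e s x * w x) +
   (if c then - be else be) * itg (fun x => cmp (~~ c) (Ff x) * phi e s x * w x).
  rewrite -!itgZ// -itgD; [|exact: itbZ..].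
  by congr itg; apply/funext => x; rewrite /h; ring.
have hY : itg (fun x => h x * (Yf x ^+ 1 * phi e s x) * w x) =
   ae * itg (fun x => cmp c (Ff x) * (Yf x ^+ 1 * phi e s x) * w x) +
   (if c then - be else be) * itg (fun x => cmp (~~ c) (Ff x) * (Yf x ^+ 1 * phi e s x) * w x).
  rewrite -!itgZ// -itgD; [|exact: itbZ..].
  by congr itg; apply/funext => x; rewrite /h; ring.
have inv2 (U0 U1 H0 H1 : R) : H0 = ae * U0 - be * U1 -> H1 = ae * U1 + be * U0 ->
    U0 = ae * H0 + be * H1 /\ U1 = ae * H1 + - be * H0.
  by move=> -> ->; split; rewrite -[LHS]mul1r -abe; ring.
rewrite !G in e3 e4.
have [f0 f1] := inv2 _ _ _ _ e1 e2; have [g0 g1] := inv2 _ _ _ _ e3 e4.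
have N2 (a1 a2 b1 b2 : R) : a1 * - a2 + b1 * - b2 = - (a1 * a2 + b1 * b2) by ring.
rewrite hp hY; case: c {hp hY h La Lb} => /=; split.
- exact: f1.
- exact: etrans g1 (N2 _ _ _ _).
- exact: f0.
- exact: etrans g0 (N2 _ _ _ _).
Qed.

(** * Conservation of Gaussian pairings along the heat flow *)

Lemma expR_err1 (v : R) : `|expR v - 1| <= `|v| * expR `|v|.
Proof.
have h1 := expR_ge1Dx v; have h2 := expR_ge1Dx (- v).
have e0 := expR_gt0 v.
have h3 : expR v - 1 <= v * expR v.
  have := ler_wpM2r (ltW e0) h2; rewrite expRN mulVf ?gt_eqF// mulrDl mul1r mulNr.
  by move: (v * expR v) => z; lra.
have [v0|v0] := leP 0 v.
  rewrite ger0_norm; last by lra.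
  by rewrite (ger0_norm v0).
rewrite ltr0_norm; last by rewrite subr_lt0 expR_lt1.
rewrite opprB (ltr0_norm v0); apply: (@le_trans _ _ (- v)); first by lra.
by rewrite ler_peMr//; [lra|rewrite -expR0 ler_expR; lra].
Qed.

Lemma expR_err2 (v : R) : `|expR v - 1 - v| <= v ^+ 2 * expR `|v|.
Proof.
have h1 := expR_ge1Dx v; have h2 := expR_ge1Dx (- v).
have e0 := expR_gt0 v.
have h3 : expR v - 1 <= v * expR v.
  have := ler_wpM2r (ltW e0) h2; rewrite expRN mulVf ?gt_eqF// mulrDl mul1r mulNr.
  by move: (v * expR v) => z; lra.
rewrite ger0_norm; last by lra.
apply: (@le_trans _ _ (v * (expR v - 1))); first by rewrite mulrBr mulr1; lra.
apply: (le_trans (ler_norm _)); rewrite normrM -(real_normK (num_real v)) expr2 -mulrA.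
by rewrite ler_wpM2l// expR_err1.
Qed.

Let phi_shift e (s d : R) x : phi e (s + d) x = phi e s x * expR (- (n%:R * d * Yf x)).
Proof. by rewrite /phi -[RHS]mulrA -expRD; congr (_ * expR _); ring. Qed.

(** The exponential in the Taylor error is absorbed by giving up half of the Gaussian rate, so the
    majorant no longer depends on [d]. *)
Let phi_half e (s d : R) x : `|d| <= s / 2 ->
  `|phi e s x| * expR `|- (n%:R * d * Yf x)| <= `|phi e (s / 2) x|.
Proof.
move=> ds; rewrite /phi !(normrM (x ^+ e)) !(ger0_norm (expR_ge0 _)) -[leLHS]mulrA ler_wpM2l// -expRD ler_expR.
rewrite normrN !normrM (ger0_norm (Yf_ge0 x)) (ger0_norm (ltW n0)).
have : 0 <= n%:R * (s / 2 - `|d|) * Yf x.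
  by rewrite mulr_ge0 ?Yf_ge0// mulr_ge0 ?(ltW n0)// subr_ge0.
rewrite (_ : - (n%:R * s * Yf x) + n%:R * `|d| * Yf x =
   - (n%:R * (s / 2) * Yf x) - n%:R * (s / 2 - `|d|) * Yf x); last by field.
by move: (n%:R * (s / 2 - `|d|) * Yf x) (n%:R * (s / 2) * Yf x) => A B; lra.
Qed.

Lemma phi_lipschitz e (h : R -> R) s : 0 < s -> L2w w h -> exists2 K, 0 <= K &
  forall d, `|d| <= s / 2 ->
  `|itg (fun x => h x * phi e (s + d) x * w x) - itg (fun x => h x * phi e s x * w x)| <= K * `|d|.
Proof.
move=> s0 Lh; have s2 : 0 < s / 2 by lra.
have mw := mf_w; have wge := w_ge0.
have LY := L2w_phi e 1 _ s2.
have iY := itb_norm (L2w_itb w mw wge _ _ Lh LY).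
exists (n%:R * itg (fun x => `|h x * (Yf x ^+ 1 * phi e (s / 2) x) * w x|)).
  by rewrite mulr_ge0 ?(ltW n0)//; exact: itg_ge0.
move=> d ds; have sd : 0 < s + d by have := ler_norm (- d); rewrite normrN; lra.
have i1 := L2w_itb w mw wge _ _ Lh (L2w_phi0 e _ sd).
have i2 := L2w_itb w mw wge _ _ Lh (L2w_phi0 e _ s0).
rewrite -itgB// mulrAC -itgZ//.
apply: itg_norm_le; [exact: itb_meas (itbB i1 i2)|exact: itbZ|].
move=> x; rewrite phi_shift.
rewrite [X in `|X|](_ : _ = h x * phi e s x * w x * (expR (- (n%:R * d * Yf x)) - 1)); last by ring.
rewrite normrM; apply: (le_trans (ler_wpM2l (normr_ge0 _) (expR_err1 _))).
have := phi_half e s d x ds => H.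
rewrite [leLHS](_ : _ = (n%:R * `|d| * (`|h x| * Yf x * w x)) * (`|phi e s x| * expR `|- (n%:R * d * Yf x)|)); last first.
  rewrite normrM (normrM (h x)) (ger0_norm (wge x)) normrN !normrM (ger0_norm (Yf_ge0 x)) (ger0_norm (ltW n0)).
  by ring.
rewrite [leRHS](_ : _ = (n%:R * `|d| * (`|h x| * Yf x * w x)) * `|phi e (s / 2) x|); last first.
  rewrite normrM (normrM (h x)) (ger0_norm (wge x)) (normrM (Yf x ^+ 1)) expr1 (ger0_norm (Yf_ge0 x)).
  by ring.
apply: ler_wpM2l => //; apply: mulr_ge0; first by rewrite mulr_ge0// ltW// n0.
by apply: mulr_ge0 => //; rewrite mulr_ge0// Yf_ge0.
Qed.

(** Differentiability in [s] with an explicit quadratic remainder, the derivative being -n times the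
    pairing with [Yf] times the Gaussian. *)
Lemma phi_derive e (h : R -> R) s : 0 < s -> L2w w h -> exists2 K, 0 <= K &
  forall d, `|d| <= s / 2 ->
  `|itg (fun x => h x * phi e (s + d) x * w x) - itg (fun x => h x * phi e s x * w x) +
    d * n%:R * itg (fun x => h x * (Yf x ^+ 1 * phi e s x) * w x)| <= K * `|d| ^+ 2.
Proof.
move=> s0 Lh; have s2 : 0 < s / 2 by lra.
have mw := mf_w; have wge := w_ge0.
have LY := L2w_phi e 2 _ s2.
have iY := itb_norm (L2w_itb w mw wge _ _ Lh LY).
exists (n%:R ^+ 2 * itg (fun x => `|h x * (Yf x ^+ 2 * phi e (s / 2) x) * w x|)).
  by rewrite mulr_ge0 ?sqr_ge0//; exact: itg_ge0.
move=> d ds; have sd : 0 < s + d by have := ler_norm (- d); rewrite normrN; lra.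
have i1 := L2w_itb w mw wge _ _ Lh (L2w_phi0 e _ sd).
have i2 := L2w_itb w mw wge _ _ Lh (L2w_phi0 e _ s0).
have i3 := L2w_itb w mw wge _ _ Lh (L2w_phi e 1 _ s0).
rewrite -itgB// -itgZ// -itgD; [|exact: itbB|exact: itbZ].
rewrite mulrAC -itgZ//.
apply: itg_norm_le; [exact: itb_meas (itbD (itbB i1 i2) (itbZ _ i3))|exact: itbZ|].
move=> x; rewrite phi_shift.
rewrite [X in `|X|](_ : _ = h x * phi e s x * w x * (expR (- (n%:R * d * Yf x)) - 1 - - (n%:R * d * Yf x))); last by ring.
rewrite normrM; apply: (le_trans (ler_wpM2l (normr_ge0 _) (expR_err2 _))).
have := phi_half e s d x ds => H.
rewrite [leLHS](_ : _ = (n%:R ^+ 2 * `|d| ^+ 2 * (`|h x| * Yf x ^+ 2 * w x)) * (`|phi e s x| * expR `|- (n%:R * d * Yf x)|)); last first.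
  rewrite normrM (normrM (h x)) (ger0_norm (wge x)) sqrrN !exprMn (real_normK (num_real d)).
  by ring.
rewrite [leRHS](_ : _ = (n%:R ^+ 2 * `|d| ^+ 2 * (`|h x| * Yf x ^+ 2 * w x)) * `|phi e (s / 2) x|); last first.
  rewrite normrM (normrM (h x)) (ger0_norm (wge x)) (normrM (Yf x ^+ 2)) (ger0_norm (sqr_ge0 (Yf x))).
  by ring.
apply: ler_wpM2l => //; apply: mulr_ge0; first by rewrite mulr_ge0// sqr_ge0.
by apply: mulr_ge0 => //; rewrite mulr_ge0// sqr_ge0.
Qed.

Lemma Psi_bound e s : 0 < s -> exists2 K, 0 <= K & forall s', s / 2 <= s' -> s' <= 3 / 2 * s ->
  itg (fun x => Psi e s' x ^+ 2 * w x) <= K.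
Proof.
move=> s0; have mw := mf_w; have wge := w_ge0.
have s6 : 0 < (6 * s)^-1 by rewrite invr_gt0 mulr_gt0.
(* The worst cases are taken separately: the prefactor is largest at [s' = s / 2], the Gaussian
   widest at [s' = 3 / 2 * s]. *)
pose G x := s `^ (- (nuf e + 1)) * phi e ((6 * s)^-1) x.
have LG : L2w w G by apply: L2wZ => //; exact: L2w_phi0.
exists (itg (fun x => G x ^+ 2 * w x)).
  by apply: itg_ge0 => x; apply: mulr_ge0 => //; exact: sqr_ge0.
move=> s' h1 h2; have s'0 : 0 < s' by lra.
apply: itg_le; [by case: (L2w_Psi e s' s'0)|by case: LG|].
move=> x; rewrite ler_wpM2r//.
rewrite -(real_normK (num_real (Psi e s' x))) -(real_normK (num_real (G x))).
rewrite lerXn2r ?nnegrE// /Psi /G !normrM !(ger0_norm (powR_ge0 _ _)).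
have nu1 : 0 <= nuf e + 1 by have := nuf_ge e; lra.
apply: ler_pM; rewrite ?powR_ge0//.
  rewrite !powRN lef_pV2 ?posrE ?powR_gt0 ?mulr_gt0//.
  apply: ge0_ler_powR => //; rewrite ?nnegrE; lra.
rewrite /phi ?normrM !(ger0_norm (expR_ge0 _)) ler_wpM2l// ler_expR lerN2.
rewrite ler_wpM2r ?Yf_ge0// ler_wpM2l ?(ltW n0)// lef_pV2 ?posrE ?mulr_gt0//.
by lra.
Qed.

(** Composing with the clamp [p] onto [a, b], which is 1-Lipschitz, gives a function with derivative
    0 on the whole line, so one-sided derivatives at the end points do not arise. *)
Lemma flat_const (chi : R -> R) (a b : R) : a <= b ->
  (forall t, a <= t <= b -> forall eps, 0 < eps -> exists2 d, 0 < d &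
     forall s, a <= s <= b -> `|s - t| < d -> `|chi s - chi t| <= eps * `|s - t|) ->
  chi a = chi b.
Proof.
move=> ab H.
pose p (x : R) := if x <= a then a else if x <= b then x else b.
have pab x : a <= p x <= b.
  by rewrite /p; case: (leP x a) => ?; case: (leP x b) => ?; apply/andP; split; lra.
have plip x y : `|p x - p y| <= `|x - y|.
  have n1 := ler_norm (x - y); have n2 := ler_norm (- (x - y)); rewrite normrN in n2.
  rewrite ler_norml /p; case: (leP x a) => ?; case: (leP x b) => ?;
    case: (leP y a) => ?; case: (leP y b) => ?; apply/andP; split; lra.
pose f x := chi (p x).
suff df (x : R) : is_derive x 1 f 0.
  have := is_derive_0_is_cst a b df; rewrite /f.
  have -> : p a = a by rewrite /p lexx.
  have -> : p b = b by rewrite /p lexx; case: (leP b a) => // ba; apply/le_anti; rewrite ab ba.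
  by [].
have C : h^-1 *: ((f \o shift x) (h *: (1 : R)) - f x) @[h --> 0^'] --> (0 : R).
  apply/cvgr0Pnorm_le => eps eps0.
  have [d d0 hd] := H (p x) (pab x) eps eps0.
  have N1 : \forall h \near (0 : R)^', `|h| < d.
    exact: dnbhs0_lt.
  have N2 : \forall h \near (0 : R)^', h != 0 by exact: nbhs_dnbhs_neq.
  apply: filterS2 N1 N2 => h hd' h0.
  rewrite /= [_ *: 1]mulr1 normrZ normfV ler_pdivrMl ?normr_gt0// mulrC.
  have l1 : `|p (h + x) - p x| <= `|h| by rewrite (le_trans (plip _ _))// addrK.
  apply: (le_trans (hd _ (pab _) (le_lt_trans l1 hd'))).
  by rewrite ler_wpM2l// ltW.
split; last exact/cvg_lim.
by apply/cvg_ex; exists 0; exact: C.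
Qed.

Let near_half (s d : R) : 0 < s -> `|d| <= s / 2 ->
  [/\ s / 2 <= s + d, s + d <= 3 / 2 * s & 0 < s + d].
Proof.
move=> s0 ds; have := ler_norm d; have := ler_norm (- d); rewrite normrN => h1 h2.
by split; lra.
Qed.

Let third (eps K : R) : 0 < eps -> 0 <= K -> eps / (3 * (K + 1)) * K <= eps / 3.
Proof.
move=> e0 K0; have K1 : 0 < 3 * (K + 1) by lra.
rewrite mulrAC ler_pdivrMr//.
by rewrite (_ : eps / 3 * (3 * (K + 1)) = eps * K + eps); [lra|field].
Qed.

Let dq_telescope (d X X0 I1 I2 I5 m : R) : d != 0 ->
  X - X0 = d * ((d^-1 * (X - I1) - I2) + (I2 - - (m * I5))) + (I1 - X0 + - d * m * I5).
Proof. by move=> d0; field. Qed.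

Let collect (eps a K1 K2 : R) : 0 <= a -> (K1 + K2) * a <= eps / 3 ->
  a * ((eps / 3 + eps / 3) + K1 * a) + K2 * a ^+ 2 <= eps * a.
Proof.
move=> a0 h; have -> : a * ((eps / 3 + eps / 3) + K1 * a) + K2 * a ^+ 2 =
  (eps / 3 + eps / 3 + (K1 + K2) * a) * a by ring.
by rewrite ler_wpM2r//; lra.
Qed.

(** The derivative of [chi] has two parts. The equation and [DkOp_pairing] give -n times the pairing
    of [h] with [Yf] times the Gaussian; the decrease of the parameter q - r gives the opposite
    value. *)
Lemma transport (u : R -> R -> R[i]) (T q t : R) c e : heat_solution n k T u ->
  0 <= t <= T -> t < q ->
  itg (fun x => cmp c (u t x) * Psi e (q - t) x * w x) =
  itg (fun x => cmp c (u 0 x) * Psi e q x * w x).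
Proof.
move=> [du [Au [[Adu [DD CC]] heat]]] /andP[t0 tT] tq.
pose chi r := itg (fun x => cmp c (u r x) * Psi e (q - r) x * w x).
suff : chi 0 = chi t by rewrite /chi subr0.
apply: flat_const => // r /andP[r0 rt] eps eps0.
have rT : 0 <= r <= T by rewrite r0 (le_trans rt).
pose s := q - r; have s0 : 0 < s by rewrite /s subr_gt0 (le_lt_trans rt).
have mw := mf_w; have wge := w_ge0.
have [D1 D2] := DD r rT.
have [h Lh hE] := DkOp_pairing _ _ c e D1.
have [hd Lhd hdE] := DkOp_pairing _ _ c e D2.
have [K1 K10 L1] := phi_lipschitz e hd s s0 Lhd.
have [K2 K20 L2] := phi_derive e h s s0 Lh.
have [K3 K30 L3] := Psi_bound e s s0.
have Lu r' : 0 <= r' <= T -> L2w w (fun x => cmp c (u r' x)).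
  by move=> hr; have [[Lu _] _] := DD r' hr; exact: Lp2_L2w.
have Ldu : L2w w (fun x => cmp c (du r x)) by have [Ld _] := D2; exact: Lp2_L2w.
have LAu : L2w w (fun x => cmp c (Au r x)) by have [_ [La _]] := D1; exact: Lp2_L2w.
(* The parameter of [L2w_est]: its second term becomes at most [cc * K3 <= eps / 3], and the
   distance tolerance [cc * (eps / 3)] makes the first term at most eps / 3. *)
pose cc := eps / (3 * (K3 + 1)).
have cc0 : 0 < cc by rewrite divr_gt0// mulr_gt0// ltr_wpDl.
have e30 : 0 < cc * (eps / 3) by rewrite mulr_gt0// divr_gt0.
have [d1 d10 hd1] := CC r rT _ e30.
pose d2 := eps / (3 * (K1 + K2 + 1)).
have d20 : 0 < d2 by rewrite divr_gt0// mulr_gt0// ltr_wpDl// addr_ge0.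
exists (Num.min d1 (Num.min d2 (s / 2))).
  by rewrite !lt_min d10 d20/= divr_gt0.
move=> r' /andP[r'0 r't]; rewrite !lt_min => /andP[rd1 /andP[rd2 rd3]].
have [->|rr'] := eqVneq r' r; first by rewrite !subrr normr0 mulr0.
have r'T : 0 <= r' <= T by rewrite r'0 (le_trans r't).
have [dq _] := hd1 r' r'T rr' rd1.
(* The Gaussian parameter q - r decreases as time increases, hence the sign. *)
pose dl := - (r' - r).
have dlE : `|dl| = `|r' - r| by rewrite normrN.
have sE : q - r' = s + dl by rewrite /s /dl; ring.
have dl2 : `|dl| <= s / 2 by rewrite dlE ltW.
have [s'lo s'hi s'0] := near_half s dl s0 dl2.
have LP := L2w_Psi e (s + dl) s'0.
pose Dq x := (cmp c (u r' x) - cmp c (u r x)) / (r' - r).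
have LDq : L2w w Dq.
  have -> : Dq = fun x => (r' - r)^-1 * (cmp c (u r' x) + -1 * cmp c (u r x)).
    by apply/funext => x; rewrite /Dq; ring.
  by apply: L2wZ => //; apply: L2wD => //; [exact: Lu|apply: L2wZ => //; exact: Lu].
have LB : L2w w (fun x => Dq x - cmp c (du r x)).
  have -> : (fun x => Dq x - cmp c (du r x)) = fun x => Dq x + -1 * cmp c (du r x).
    by apply/funext => x; ring.
  by apply: L2wD => //; apply: L2wZ.
have lt1 : itg (fun x => (Dq x - cmp c (du r x)) ^+ 2 * w x) < cc * (eps / 3).
  rewrite -lte_fin -itgE; last by case: LB.
  apply: le_lt_trans dq.
  have mcu r'' : 0 <= r'' <= T -> cmeasurable (u r'').
    by move=> hr; have [[[mu' _] _] _] := DD r'' hr.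
  have mdu : cmeasurable (du r) by have [[mu' _] _] := D2.
  have mdq : cmeasurable (dquot u r r').
    have a0 := mf_cmp false _ (mcu _ r'T); have a1 := mf_cmp true _ (mcu _ r'T).
    have b0 := mf_cmp false _ (mcu _ rT); have b1 := mf_cmp true _ (mcu _ rT).
    split.
      rewrite (_ : (fun x => _) = fun x => (cmp false (u r' x) - cmp false (u r x)) / (r' - r)).
        by meas.
      apply/funext => x; rewrite /dquot -fmorphV.
      by case: (u r' x) (u r x) => ? ? [? ?] /=; ring.
    rewrite (_ : (fun x => _) = fun x => (cmp true (u r' x) - cmp true (u r x)) / (r' - r)).
      by meas.
    apply/funext => x; rewrite /dquot -fmorphV.
    by case: (u r' x) (u r x) => ? ? [? ?] /=; ring.
  apply: le_trans (dist2_cmp c _ _ mdq mdu).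
  rewrite le_eqVlt; apply/orP; left; apply/eqP; apply: eq_integral => x _.
  congr ((_ - _) ^+ 2 * _)%:E; rewrite /Dq /dquot -fmorphV.
  by case: (c) => /=; case: (u r' x) (u r x) => ? ? [? ?] /=; ring.
have B1 := L2w_est w mw wge _ _ cc cc0 LB LP.
have B2 := L1 dl dl2; have B3 := L2 dl dl2; have B4 := L3 _ s'lo s'hi.
have rn0 : r' - r != 0 by rewrite subr_eq0.
(* Three errors: the difference quotient against [du], the shift of the Gaussian paired with [du]
   ([phi_lipschitz]), and the second-order remainder for the Gaussian paired with [u r]
   ([phi_derive]). The first-order terms cancel by the equation. *)
have main : chi r' - chi r =
   (r' - r) * (itg (fun x => (Dq x - cmp c (du r x)) * Psi e (s + dl) x * w x) +
      (itg (fun x => hd x * phi e (s + dl) x * w x) - itg (fun x => hd x * phi e s x * w x))) +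
   (itg (fun x => h x * phi e (s + dl) x * w x) - itg (fun x => h x * phi e s x * w x) +
    dl * n%:R * itg (fun x => h x * (Yf x ^+ 1 * phi e s x) * w x)).
  rewrite -(proj1 (hdE s s0)) -(proj1 (hdE _ s'0)) -(proj1 (hE s s0)) -(proj1 (hE _ s'0)).
  have duE : itg (fun x => cmp c (du r x) * Psi e s x * w x) =
      - (n%:R * itg (fun x => h x * (Yf x ^+ 1 * phi e s x) * w x)).
    have [_ E2] := hE s s0; rewrite -mulrN -E2 -itgZ; last exact: L2w_itb (L2w_Psi e s s0).
    apply: ae_itg.
    - exact: itb_meas (L2w_itb w mw wge _ _ Ldu (L2w_Psi e s s0)).
    - exact: itb_meas (itbZ _ (L2w_itb w mw wge _ _ LAu (L2w_Psi e s s0))).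
    - apply: aeS (heat r rT) => x /eqP; rewrite subr_eq0 => /eqP <-.
      by case: (c) => /=; case: (Au r x) => ? ? /=; ring.
  rewrite duE {duE}.
  have -> : itg (fun x => (Dq x - cmp c (du r x)) * Psi e (s + dl) x * w x) =
     (r' - r)^-1 * (chi r' - itg (fun x => cmp c (u r x) * Psi e (s + dl) x * w x)) -
     itg (fun x => cmp c (du r x) * Psi e (s + dl) x * w x).
    rewrite /chi sE.
    have j1 := L2w_itb w mw wge _ _ (Lu _ r'T) LP; have j2 := L2w_itb w mw wge _ _ (Lu _ rT) LP.
    have j3 := L2w_itb w mw wge _ _ Ldu LP.
    rewrite -itgB// -itgZ; last exact: itbB.
    rewrite -itgB//; last by apply: itbZ; exact: itbB.
    by congr itg; apply/funext => x; rewrite /Dq; ring.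
  exact: dq_telescope.
rewrite main; apply: (le_trans (ler_normD _ _)); rewrite normrM.
have b1 : `|itg (fun x => (Dq x - cmp c (du r x)) * Psi e (s + dl) x * w x)| <= eps / 3 + eps / 3.
  apply: (le_trans B1); apply: lerD; first by rewrite ler_pdivrMl// ltW.
  apply: (@le_trans _ _ (cc * K3)); first by rewrite ler_wpM2l// ltW.
  exact: third.
have b2 : (K1 + K2) * `|r' - r| <= eps / 3.
  apply: (@le_trans _ _ ((K1 + K2) * d2)); first by rewrite ler_wpM2l ?addr_ge0// ltW.
  by rewrite mulrC; apply: third => //; exact: addr_ge0.
rewrite dlE in B2 B3.
have a0 := normr_ge0 (r' - r).
apply: (@le_trans _ _ (`|r' - r| * ((eps / 3 + eps / 3) + K1 * `|r' - r|) + K2 * `|r' - r| ^+ 2)).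
  apply: lerD => //; rewrite ler_wpM2l// (le_trans (ler_normD _ _))//.
  exact: lerD.
exact: collect.
Qed.

(** * Vanishing of the Gaussian pairings and of the solution *)

Lemma Yf_root x : Yf x `^ (n%:R / 2) = `|x|.
Proof.
rewrite /Yf -powRrM (_ : 2 / n%:R * (n%:R / 2) = 1) ?powRr1//.
by field; rewrite gt_eqF ?n0.
Qed.

Lemma phi_le e s : 0 < s -> exists2 K, 0 <= K & forall x, `|phi e s x| <= K.
Proof.
move=> s0; have ns : 0 < n%:R * s by rewrite mulr_gt0// n0.
have n2 : 0 <= n%:R / 2 :> R by rewrite divr_ge0.
have [K K0 hK] := powR_le_exp (n%:R / 2) _ n2 ns.
exists (1 + K); first by rewrite addr_ge0// ltW.
move=> x; rewrite /phi normrM (ger0_norm (expR_ge0 _)) expRN normrX ler_pdivrMr ?expR_gt0//.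
have e1 : 1 <= expR (n%:R * s * Yf x) by rewrite -[leLHS]expR0 ler_expR mulr_ge0 ?Yf_ge0// ltW.
have := hK _ (Yf_ge0 x); rewrite Yf_root => h; rewrite mulrDl mul1r; case: (e).
  by rewrite expr1; apply: (le_trans h); rewrite lerDr expR_ge0.
by rewrite expr0; apply: (le_trans e1); rewrite lerDl mulr_ge0 ?expR_ge0// ltW.
Qed.

Lemma itb_poly_weight e (c0 : R) : 0 < c0 ->
  exists2 m, (0 < m)%N & itb (fun x => (1 + c0 * Yf x) ^- m * (`|x| ^+ e * w x)).
Proof.
move=> c00; have ge0 : 0 <= gm + e%:R by rewrite addr_ge0// ltW.
have [M hM] : exists M : nat, gm + e%:R <= M%:R.
  by exists (Num.bound (gm + e%:R)); apply/ltW/archi_boundP.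
(* Since [Yf x ^+ n] is the square of [x], the n M factors dominate the power of [|x|] in the
   weight, and the further [n] leave the integrable 1 / (1 + x^2). *)
exists (n + n * M)%N; first by rewrite addn_gt0 n_gt0.
have cw0 : 0 <= cw.
  rewrite /cw mulr_ge0 ?powR_ge0// invr_ge0 mulr_ge0// ltW// gam_gt0//.
  by have := alpha_ge; lra.
pose K := 1 + c0^-1; have K0 : 0 <= K by rewrite addr_ge0// invr_ge0 ltW.
have Zp x : 0 < 1 + c0 * Yf x by rewrite ltr_wpDr// mulr_ge0 ?Yf_ge0// ltW.
have mw := mf_w; have mY : measurable_fun setT Yf by apply: mf_Yf; meas.
have mD : measurable_fun setT (fun x => (1 + c0 * Yf x) ^+ (n + n * M)) by meas.
apply: (itb_le _ _ (itbZ (cw * (6 * K ^+ (n + n * M))) itb_cauchy)).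
  apply: measurable_funM; last by meas.
  by apply: mf_inv => // x; rewrite exprn_gt0.
move=> x; rewrite ger0_norm; last first.
  apply: mulr_ge0; first by rewrite invr_ge0 exprn_ge0// ltW.
  by apply: mulr_ge0; [exact: exprn_ge0|exact: w_ge0].
have Y0 := Yf_ge0 x.
have Yn : Yf x ^+ n = `|x| ^+ 2.
  rewrite -powR_mulrn// /Yf -powRrM (_ : 2 / n%:R * n%:R = 2%:R) ?powR_mulrn//.
  by field; rewrite gt_eqF ?n0.
have ge1 j : 1 <= (1 + Yf x) ^+ j by rewrite exprn_ege1// lerDl.
have pw j : 1 + Yf x ^+ j <= 2 * (1 + Yf x) ^+ j.
  have h2 : Yf x ^+ j <= (1 + Yf x) ^+ j by rewrite lerXn2r ?nnegrE ?addr_ge0// lerDr.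
  by have := ge1 j; lra.
have xw : `|x| ^+ e * w x <= cw * (3 * (1 + Yf x) ^+ (n * M)).
  rewrite weightE mulrCA; apply: ler_wpM2l => //.
  have -> : `|x| ^+ e * `|x| `^ gm = `|x| `^ (gm + e%:R).
    have [->|x0] := eqVneq x 0.
      by rewrite normr0 !powR0 ?mulr0// gt_eqF// ltr_wpDr.
    by rewrite (@powRD _ _ gm) ?normr_eq0 ?x0 ?implybT// powR_mulrn// mulrC.
  apply: (le_trans (powR_le1Dn _ _ _ (normr_ge0 x) ge0 hM)).
  have YM : Yf x ^+ (n * M) = (`|x| ^+ M) ^+ 2 by rewrite exprM Yn -!exprM mulnC.
  have := pw (n * M)%N; have := ge1 (n * M)%N; rewrite YM.
  move: (`|x| ^+ M) ((1 + Yf x) ^+ (n * M)) => a b h1 h2.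
  by have := sqr_ge0 (a - 1/2); nra.
have xx : 1 + x ^+ 2 <= 2 * (1 + Yf x) ^+ n.
  by have := pw n; rewrite Yn real_normK ?num_real.
have KY : (1 + Yf x) ^+ (n + n * M) <= K ^+ (n + n * M) * (1 + c0 * Yf x) ^+ (n + n * M).
  rewrite -exprMn; apply: lerXn2r.
  - by rewrite nnegrE addr_ge0.
  - by rewrite nnegrE mulr_ge0// ltW.
  - rewrite /K (_ : (1 + c0^-1) * (1 + c0 * Yf x) = 1 + Yf x + (c0^-1 + c0 * Yf x)).
      by rewrite lerDl addr_ge0// ?invr_ge0 ?mulr_ge0// ltW.
    by field; rewrite gt_eqF.
rewrite ler_pdivrMl ?exprn_gt0// [leRHS]mulrA ler_pdivlMr; last by rewrite ltr_wpDr ?sqr_ge0.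
apply: (@le_trans _ _ ((cw * (3 * (1 + Yf x) ^+ (n * M))) * (2 * (1 + Yf x) ^+ n))).
  apply: ler_pM => //; last by rewrite addr_ge0 ?sqr_ge0.
  by apply: mulr_ge0; [exact: exprn_ge0|exact: w_ge0].
rewrite [leLHS](_ : _ = cw * 6 * (1 + Yf x) ^+ (n + n * M)); last by rewrite exprD; ring.
rewrite [leRHS](_ : _ = cw * 6 * (K ^+ (n + n * M) * (1 + c0 * Yf x) ^+ (n + n * M))).
  by apply: ler_wpM2l => //; rewrite mulr_ge0.
by ring.
Qed.

Lemma L2w_heat (u : R -> R -> R[i]) (T t : R) c : heat_solution n k T u -> 0 <= t <= T ->
  L2w w (fun x => cmp c (u t x)).
Proof.
move=> [du [Au [[Adu [DD _]] _]]] /DD[[Lu _] _]; exact: Lp2_L2w.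
Qed.

(** An instance of the argument for [star], one for each component and parity, with order
    [nuf e]. *)
Lemma initial_pairing_eq0 (u : R -> R -> R[i]) (T C delta : R) c e : 0 < T ->
  heat_solution n k T u -> Lpkn n k 1 (u 0) -> 0 < C ->
  (forall x, Normc.normc (u T x) <= C * expR (- (n%:R * delta * Yf x))) ->
  (4 * T)^-1 <= delta -> forall p, 0 < p ->
  itg (fun x => cmp c (u 0 x) * phi e p x * w x) = 0.
Proof.
move=> T0 hu L1 C0 uT dT p p0.
pose c0 : R := n%:R / (4 * T).
have c00 : 0 < c0 by rewrite divr_gt0 ?n0// mulr_gt0.
have [m m0 im] := itb_poly_weight e c0 c00.
pose Z x := c0 * Yf x.
pose g0 x := x ^+ e * (cmp c (u 0 x) * w x).
pose g1 x := x ^+ e * (cmp c (u T x) * expR (Z x) * w x).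
have mw := mf_w; have wge := w_ge0; have mY : measurable_fun setT Yf by apply: mf_Yf; meas.
have mZ : measurable_fun setT Z by rewrite /Z; meas.
have TT : 0 <= T <= T by rewrite (ltW T0) lexx.
have LuT := L2w_heat u T T c hu TT.
have L00 : (0 : R) <= 0 <= T by rewrite lexx ltW.
have Lu0 := L2w_heat u T 0 c hu L00.
have [mu0 _] := Lu0; have [muT _] := LuT.
have mg0 : measurable_fun setT g0 by rewrite /g0; meas.
have mg1 : measurable_fun setT g1 by rewrite /g1; meas.
have Z0 x : 0 <= Z x by rewrite mulr_ge0 ?Yf_ge0// ltW.
have Zgt0 : {ae mu, forall x, 0 < Z x}.
  apply: aeS (ae_neq 0) => x /eqP x0.
  by rewrite mulr_gt0// powR_gt0// normr_gt0.
have ig0 eta : 0 < eta -> itb (fun x => expR (- (eta * Z x)) * `|g0 x|).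
  move=> eta0; pose s := eta / (4 * T).
  have s0 : 0 < s by rewrite divr_gt0// mulr_gt0.
  have [K K0 hK] := phi_le e s s0.
  apply: (itb_le _ _ (itbZ K (itb_norm (Lp1_itb c _ L1)))); first by meas.
  move=> x; have -> : eta * Z x = n%:R * s * Yf x.
    by rewrite /Z /c0 /s; field; rewrite gt_eqF.
  rewrite [leLHS](_ : _ = `|phi e s x| * `|cmp c (u 0 x) * w x|).
    by apply: ler_wpM2r => //; exact: hK.
  rewrite normrM normr_id (ger0_norm (expR_ge0 _)) /g0 (normrM (x ^+ e)) /phi.
  by rewrite (normrM (x ^+ e)) (ger0_norm (expR_ge0 _)) mulrCA mulrA.
have ig1 : itb (fun x => (1 + Z x) ^- m * `|g1 x|).
  have Zp x : 0 < (1 + Z x) ^+ m by rewrite exprn_gt0// ltr_wpDr.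
  apply: (itb_le _ _ (itbZ C im)).
    apply: measurable_funM; last by meas.
    by apply: mf_inv => //; meas.
  move=> x; rewrite normrM normr_id (ger0_norm (ltW _)) ?invr_gt0//.
  rewrite [leRHS]mulrCA; apply: ler_wpM2l; first by rewrite invr_ge0 ltW.
  rewrite /g1 (normrM (x ^+ e)) normrX [leRHS]mulrCA; apply: ler_wpM2l => //.
  rewrite (normrM (_ * expR _)) (ger0_norm (wge x)); apply: ler_wpM2r => //.
  rewrite normrM (ger0_norm (expR_ge0 _)).
  apply: (@le_trans _ _ (C * expR (- (n%:R * delta * Yf x)) * expR (Z x))).
    by rewrite ler_wpM2r ?expR_ge0// (le_trans (cmp_le _ _)).
  (* The threshold on [delta] enters here: the Gaussian bound at time [T] outweighs the growth e^Z,
     with equality of exponents when delta = 1 / (4 T). *)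
  rewrite -mulrA -expRD -[leRHS]mulr1 ler_wpM2l ?(ltW C0)// -[leRHS]expR0 ler_expR.
  rewrite addrC subr_le0 /Z; apply: ler_wpM2r; first exact: Yf_ge0.
  by rewrite /c0; apply: ler_wpM2l.
have star tau : 0 < tau -> tau < 1 -> itg (fun x => g0 x * expR (- ((1 - tau) * Z x))) =
    tau `^ (- (nuf e + 1)) * itg (fun x => g1 x * expR (- (Z x / tau))).
  move=> t0 t1; have t10 : 0 < 1 - tau by rewrite subr_gt0.
  (* Chosen so that q - T = s. The transformed Gaussian at time 0 then has exponent -(1 - tau) Z and
     the one at time T has Z - Z / tau, whose first term is the factor e^Z inside [g1]. *)
  pose s := T * tau / (1 - tau); pose q := T / (1 - tau).
  have s0 : 0 < s by rewrite divr_gt0// mulr_gt0.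
  have q0' : 0 < q by rewrite divr_gt0.
  have sq : q - T = s by rewrite /q /s; field; rewrite gt_eqF.
  have Tq : T < q by rewrite -subr_gt0 sq.
  have s4 : 0 < (4 * s)^-1 by rewrite invr_gt0 mulr_gt0.
  have q4 : 0 < (4 * q)^-1 by rewrite invr_gt0 mulr_gt0.
  have i1 := L2w_itb w mw wge _ _ LuT (L2w_phi0 e _ s4).
  have i0 := L2w_itb w mw wge _ _ Lu0 (L2w_phi0 e _ q4).
  have -> : (fun x => g1 x * expR (- (Z x / tau))) =
      fun x => cmp c (u T x) * phi e (4 * s)^-1 x * w x.
    apply/funext => x; rewrite /g1 /phi.
    have -> : - (n%:R * (4 * s)^-1 * Yf x) = Z x + - (Z x / tau).
      by rewrite /Z /c0 /s; field; rewrite !gt_eqF.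
    by rewrite expRD; ring.
  have -> : (fun x => g0 x * expR (- ((1 - tau) * Z x))) =
      fun x => cmp c (u 0 x) * phi e (4 * q)^-1 x * w x.
    apply/funext => x; rewrite /g0 /phi.
    have -> : n%:R * (4 * q)^-1 * Yf x = (1 - tau) * Z x.
      by rewrite /Z /c0 /q; field; rewrite !gt_eqF.
    by ring.
  have H := transport u T q T c e hu TT Tq; rewrite sq in H.
  have A : itg (fun x => cmp c (u T x) * Psi e s x * w x) =
      (2 * s) `^ (- (nuf e + 1)) * itg (fun x => cmp c (u T x) * phi e (4 * s)^-1 x * w x).
    by rewrite -(itgZ _ i1); congr itg; apply/funext => x; rewrite /Psi; ring.
  have B : itg (fun x => cmp c (u 0 x) * Psi e q x * w x) =
      (2 * q) `^ (- (nuf e + 1)) * itg (fun x => cmp c (u 0 x) * phi e (4 * q)^-1 x * w x).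
    by rewrite -(itgZ _ i0); congr itg; apply/funext => x; rewrite /Psi; ring.
  have E : (2 * s) `^ (- (nuf e + 1)) = tau `^ (- (nuf e + 1)) * (2 * q) `^ (- (nuf e + 1)).
    rewrite -powRM; [|exact: ltW|by rewrite mulr_ge0// ltW].
    by congr powR; rewrite /s /q; ring.
  have Q0 : 0 < (2 * q) `^ (- (nuf e + 1)) by rewrite powR_gt0// mulr_gt0.
  rewrite A B E in H; move: H Q0; clear; move: (itg _) (itg _) => I1 I2.
  move: (tau `^ _) ((2 * q) `^ _) => a b H b0.
  by apply: (mulfI (lt0r_neq0 b0)); rewrite -H; ring.
have eta0 : 0 < 4 * T * p by rewrite !mulr_gt0.
have := laplace_eq0 Z g0 g1 (nuf e) m (nuf_ge e) m0 mZ mg0 mg1 Z0 Zgt0 ig0 ig1 star _ eta0.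
congr (_ = 0); congr itg; apply/funext => x; rewrite /g0 /phi.
have -> : 4 * T * p * Z x = n%:R * p * Yf x by rewrite /Z /c0; field; rewrite gt_eqF.
by ring.
Qed.

Lemma solution_pairing_eq0 (u : R -> R -> R[i]) (T t : R) c e : 0 < T ->
  heat_solution n k T u -> 0 <= t <= T ->
  (forall p, 0 < p -> itg (fun x => cmp c (u 0 x) * phi e p x * w x) = 0) ->
  forall p, 0 < p -> itg (fun x => cmp c (u t x) * phi e p x * w x) = 0.
Proof.
move=> T0 hu tT h0 p p0; have /andP[t0 _] := tT.
(* With this [s], [Psi e s] is a multiple of [phi e p], so transporting back to time 0 from q = t +
   s tests [u t] against the prescribed Gaussian. *)
pose s := (4 * p)^-1; have s0 : 0 < s by rewrite invr_gt0 mulr_gt0.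
pose q := t + s; have tq : t < q by rewrite ltrDl.
have q0' : 0 < q by rewrite (le_lt_trans t0).
have q4 : 0 < (4 * q)^-1 by rewrite invr_gt0 mulr_gt0.
have mw := mf_w; have wge := w_ge0.
have L00 : (0 : R) <= 0 <= T by rewrite lexx ltW.
have i1 := L2w_itb w mw wge _ _ (L2w_heat u T t c hu tT) (L2w_phi0 e _ p0).
have i0 := L2w_itb w mw wge _ _ (L2w_heat u T 0 c hu L00) (L2w_phi0 e _ q4).
have H := transport u T q t c e hu tT tq.
have B : itg (fun x => cmp c (u 0 x) * Psi e q x * w x) =
    (2 * q) `^ (- (nuf e + 1)) * itg (fun x => cmp c (u 0 x) * phi e (4 * q)^-1 x * w x).
  by rewrite -(itgZ _ i0); congr itg; apply/funext => x; rewrite /Psi; ring.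
have A : itg (fun x => cmp c (u t x) * Psi e (q - t) x * w x) =
    (2 * s) `^ (- (nuf e + 1)) * itg (fun x => cmp c (u t x) * phi e p x * w x).
  rewrite -(itgZ _ i1); congr itg; apply/funext => x; rewrite /Psi.
  have -> : q - t = s by rewrite /q; ring.
  have -> : (4 * s)^-1 = p by rewrite /s; field; rewrite gt_eqF.
  by ring.
rewrite A B h0// mulr0 in H.
by move/eqP: H; rewrite mulf_eq0 gt_eqF ?powR_gt0 ?mulr_gt0//= => /eqP.
Qed.

Lemma powR_ltE (r a b : R) : 0 < r -> 0 <= a -> 0 <= b -> (a `^ r < b `^ r) = (a < b).
Proof.
move=> r0 a0 b0; have mono (q x y : R) : 0 <= q -> 0 <= x -> 0 <= y -> x <= y -> x `^ q <= y `^ q.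
  by move=> q0' x0 y0 xy; apply: ge0_ler_powR => //; rewrite nnegrE.
rewrite !ltNge; congr (~~ _); apply/idP/idP => h; last exact: (mono _ _ _ (ltW r0)).
have r1 : 0 <= r^-1 by rewrite invr_ge0 ltW.
have := mono _ _ _ r1 (powR_ge0 b r) (powR_ge0 a r) h.
by rewrite -!powRrM divff ?gt_eqF// !powRr1.
Qed.

(* Testing against phi false p and phi true p sees only the even and the odd
   part of v; each is recovered from its integrals over shells. *)
Lemma gauss_pairing_inj (v : R -> R) : L2w w v ->
  (forall e p, 0 < p -> itg (fun x => v x * phi e p x * w x) = 0) ->
  {ae mu, forall x, v x = 0}.
Proof.
move=> Lv H; have mw := mf_w; have wge := w_ge0; have [mv _] := Lv.
have mY : measurable_fun setT Yf by apply: mf_Yf; meas.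
(* The rate 1 is a base point: varying [p] around it gives the exponentials of [t * Yf x] in a
   neighbourhood of [t = 0] required by [laplace_inj]. *)
pose G e x := v x * phi e 1 x * w x.
have iG e : itb (G e) by exact: (L2w_itb w mw wge _ _ Lv (L2w_phi0 e _ ltr01)).
have n20 : 0 < n%:R / 2 :> R by rewrite divr_gt0// n0.
have iG2 e : itb (fun x => expR (n%:R / 2 * `|Yf x|) * `|G e x|).
  have h20 : 0 < 2^-1 :> R by rewrite invr_gt0.
  have := itb_norm (L2w_itb w mw wge _ _ Lv (L2w_phi0 e _ h20)).
  congr itb; apply/funext => x; rewrite (ger0_norm (Yf_ge0 x)).
  rewrite -[X in _ = X * _](ger0_norm (expR_ge0 _)) -normrM; congr (Num.norm _); rewrite /G /phi.
  have -> : - (n%:R * 2^-1 * Yf x) = n%:R / 2 * Yf x + - (n%:R * 1 * Yf x) by field.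
  by rewrite expRD; ring.
have lap e t : `|t| < n%:R / 2 -> itg (fun x => expR (t * Yf x) * G e x) = 0.
  move=> tn; have p0 : 0 < 1 - t / n%:R.
    rewrite subr_gt0 ltr_pdivrMr ?n0// mul1r; have := ler_norm t; have := n0; lra.
  have := H e _ p0; congr (_ = 0); congr itg; apply/funext => x; rewrite /G /phi.
  have -> : - (n%:R * (1 - t / n%:R) * Yf x) = t * Yf x + - (n%:R * 1 * Yf x).
    by field; rewrite gt_eqF ?n0.
  by rewrite expRD; ring.
have lev a : {ae mu, forall x, Yf x <> a}.
  pose b := a `^ (n%:R / 2).
  apply: aeS2 (ae_neq b) (ae_neq (- b)) => x h1 h2 ya.
  have : `|x| = b by rewrite /b -ya Yf_root.
  by case: (ger0P x) => _ xb; [exact: h1|apply: h2; rewrite -xb opprK].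
have mG e := itb_meas (iG e).
have mab (b1 b2 : R) : measurable_fun setT (fun x : R => b1 < `|x| < b2).
  by apply: measurable_and; apply: measurable_fun_ltr; meas.
have mpos : measurable_fun setT (fun x : R => 0 < x) by apply: measurable_fun_ltr; meas.
pose S e b1 b2 x := if b1 < `|x| < b2 then G e x else 0.
have shell e b1 b2 : 0 <= b1 -> b1 < b2 -> itg (S e b1 b2) = 0.
  move=> b10 b12; have b20 := le_trans b10 (ltW b12).
  have lt12 : b1 `^ (2 / n%:R) < b2 `^ (2 / n%:R) by rewrite powR_ltE ?q0.
  have := laplace_inj Yf (G e) _ mY (mG e) n20 (iG2 e) (lap e) lev _ _ lt12.
  congr (_ = 0); congr itg; apply/funext => x.
  by rewrite /S /Yf !powR_ltE ?q0.
have iS e b1 b2 : itb (S e b1 b2).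
  apply: (itb_le _ _ (itb_norm (iG e))).
    by apply: mf_if; [exact: mab|exact: mG|meas].
  by move=> x; rewrite /S; case: ifP => // _; rewrite normr0.
have ihalf (f : R -> R) : itb f -> itb (fun x => if 0 < x then f x else 0).
  move=> hf; apply: (itb_le _ _ (itb_norm hf)).
    by apply: mf_if => //; exact: itb_meas.
  by move=> x; case: ifP => // _; rewrite normr0.
(* A shell consists of two opposite intervals; folding it onto the positive half-line turns shell
   integrals into interval integrals, to which [interval_itg_eq0] applies. *)
pose Hf e x := if 0 < x then G e x + G e (- x) else 0.
have iH e : itb (Hf e).
  by apply: (ihalf (fun x => G e x + G e (- x))); apply: itbD => //; exact: itb_opp.
have H0 e : {ae mu, forall x, Hf e x = 0}.
  apply: interval_itg_eq0 => // a b ab.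
  have [b0|b0] := leP b 0.
    rewrite -[RHS]itg0; congr itg; apply/funext => x; case: ifP => // /andP[_ xb].
    by rewrite /Hf ltNge (ltW (lt_le_trans xb b0)).
  pose a' := Num.max a 0; have a'0 : 0 <= a' by rewrite le_max lexx orbT.
  have a'b : a' < b by rewrite gt_max ab b0.
  pose S1 x := if 0 < x then S e a' b x else 0.
  pose S2 x := if 0 < x then S e a' b (- x) else 0.
  have i1 : itb S1 by apply: ihalf.
  have i2 : itb S2 by apply: ihalf; exact: itb_opp.
  have i2N := itb_opp _ i2.
  rewrite (_ : (fun x => _) = fun x => S1 x + S2 x); last first.
    apply/funext => x; rewrite /Hf /S1 /S2 /S normrN.
    have [x0|x0] := ltP 0 x; last by rewrite addr0 if_same.
    rewrite (gtr0_norm x0) gt_max x0 andbT.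
    by case: ifP => // _; rewrite addr0.
  rewrite itgD// -(itg_opp _ i2 i2N) -itgD//.
  rewrite (_ : (fun x => _) = S e a' b); first exact: shell.
  apply/funext => x; rewrite /S1 /S2 opprK oppr_gt0.
  have [x0|x0|->] := ltgtP x 0; rewrite ?add0r ?addr0//.
  by rewrite /S normr0 ltNge a'0.
have P : {ae mu, forall x, 0 < x -> v x = 0 /\ v (- x) = 0}.
  apply: aeS2 (H0 false) (H0 true) => x; rewrite /Hf => h1 h2 x0; move: h1 h2.
  rewrite x0 /G /phi Yf_opp w_opp !expr0 !expr1 !mul1r.
  have e0 := expR_gt0 (- (n%:R * 1 * Yf x)); have wx := w_gt0 x (lt0r_neq0 x0).
  move: (expR _) (w x) (v x) (v (- x)) e0 wx => E W V1 V2 E0 W0 h1 h2.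
  have EW : E * W != 0 by rewrite mulf_neq0 ?gt_eqF.
  have s1 : V1 + V2 = 0.
    by apply: (mulIf EW); rewrite mul0r -h1; ring.
  have s2 : V1 - V2 = 0.
    have xEW : x * (E * W) != 0 by rewrite mulf_neq0// gt_eqF.
    by apply: (mulIf xEW); rewrite mul0r -h2; ring.
  by split; lra.
have Q : {ae mu, forall x, x <> 0 -> v x = 0}.
  apply: aeS2 P (ae_opp _ P) => x h1 h2 /eqP; rewrite neq_lt => /orP[x0|x0].
    have [_] : v (- x) = 0 /\ v (- - x) = 0 by apply: h2; rewrite oppr_gt0.
    by rewrite opprK.
  by have [] := h1 x0.
by apply: aeS2 Q (ae_neq 0) => x h; exact: h.
Qed.

Lemma heat_cmp_eq0 (u : R -> R -> R[i]) (T C delta : R) c t : 0 < T ->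
  heat_solution n k T u -> Lpkn n k 1 (u 0) -> 0 < C ->
  (forall x, Normc.normc (u T x) <= C * expR (- (n%:R * delta * Yf x))) ->
  (4 * T)^-1 <= delta -> 0 <= t <= T -> {ae mu, forall x, cmp c (u t x) = 0}.
Proof.
move=> T0 hu L1 C0 uT dT tT.
apply: gauss_pairing_inj; first exact: (L2w_heat u T t c hu tT).
move=> e; apply: (solution_pairing_eq0 u T t c e T0 hu tT).
exact: (initial_pairing_eq0 u T C delta c e T0 hu L1 C0 uT dT).
Qed.

End Kernel.

Local Open Scope complex_scope.

Theorem theorem4p1 (R : realType) (n : nat) (k T C delta : R)
    (u : R -> R -> R[i]) :
  (1 <= n)%N ->
  (n%:R - 1) / (2 * n%:R) <= k ->
  0 < 2 * k + 2 / n%:R - 2 ->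
  0 < T ->
  heat_solution n k T u ->
  Lpkn n k 1 (u 0) ->
  0 < C -> 0 < delta ->
  (forall x : R, Normc.normc (u T x) <= C * expR (- (n%:R * delta * `|x| `^ (2 / n%:R)))) ->
  (4 * T)^-1 <= delta ->
  forall t : R, 0 <= t <= T -> {ae @lebesgue_measure R, forall x, u t x = 0}.
Proof.
move=> n1 kn gm T0 hu L1 C0 _ uT dT t tT.
have Z := heat_cmp_eq0 n k n1 kn gm u T C delta _ t T0 hu L1 C0 uT dT tT.
apply: aeS2 (Z false) (Z true) => x /= h0 h1.
by apply/eqP; rewrite eq_complex h0 h1 /= !eqxx.
Qed.
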